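(* Let $Q=(0,1)^2$, $(u_\eta,u_c)\in BV(Q)\times BV(Q)$, and $c_0\in(0,1)$. Then there exists an optimal solution $u^*$ to the box-constrained weighted-TV learning scheme with box $[c_0,1/c_0]$; that is, with $u_{\mathscr L}$ defined as in the context, there exists $\mathscr L^*\in\mathscr P$ such that $u^*=u_{\mathscr L^*}$ satisfies $$\int_Q|u_c-u_{\mathscr L^*}|^2dx=\min\Big\{\int_Q|u_c-u_{\mathscr L}|^2dx:\ \mathscr L\in\mathscr P\Big\}.$$
   Context: A dyadic square of $Q=(0,1)^2$ is a set $L=(z+(0,2^{-k}]^2)\cap Q$ with $k\in\mathbb N_0$ and $z\in 2^{-k}\mathbb Z^2\cap[0,1)^2$. $\mathscr P$ is the class of all finite partitions $\mathscr L$ of $Q$ into dyadic squares (possibly of different sizes). Spaces and variations on $L$ are understood on the interior of $L$; $TV(u,L)=|Du|(L)$. For a locally integrable $\omega:Q\to[0,\infty)$, $TV_\omega(u,Q)=\sup\{\int_Q u\,\mathrm{div}\,\varphi\,dx:\ \varphi\in\mathrm{Lip}_c(Q;\mathbb R^2),\ |\varphi|\le\omega\}$ ($\mathrm{Lip}_c$: compactly supported Lipschitz maps), and $BV_\omega(Q)=\{u \text{ measurable}:\int_Q|u|\,\omega\,dx<\infty,\ TV_\omega(u,Q)<\infty\}$. Box-constrained weighted-TV learning scheme with box $[c_0,1/c_0]$: Level 3: for a dyadic square $L$ and $\alpha\in(0,\infty)$ let $u_{\alpha,L}$ be the unique minimizer over $u\in BV(L)$ of $\int_L|u_\eta-u|^2\,dx+\alpha\,TV(u,L)$;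 let $\alpha_L$ be the smallest minimizer of $\alpha\mapsto\int_L|u_c-u_{\alpha,L}|^2dx$ over $[c_0,1/c_0]$. Level 2: for $\mathscr L\in\mathscr P$ set $\omega_{\mathscr L}=\sum_{L\in\mathscr L}\alpha_L\chi_L$ and let $u_{\mathscr L}$ be the minimizer over $u\in BV_{\omega_{\mathscr L}}(Q)$ of $\int_Q|u_\eta-u|^2dx+TV_{\omega_{\mathscr L}}(u,Q)$. Level 1: an optimal solution $u^*$ is a function $u_{\mathscr L}$ minimizing $\int_Q|u_c-u_{\mathscr L}|^2dx$ among all $\mathscr L\in\mathscr P$. *)

(* Defs.v *)
From HB Require Import structures.
From mathcomp Require Import all_boot all_order all_algebra.
From mathcomp Require Import all_classical all_reals all_analysis.

Set Implicit Arguments.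
Unset Strict Implicit.
Unset Printing Implicit Defensive.

Import Order.TTheory GRing.Theory Num.Theory numFieldNormedType.Exports.

Local Open Scope classical_set_scope.
Local Open Scope ring_scope.

Section Plane.
Context {R : realType}.

Definition leb2 : {measure set (measurableTypeR R * measurableTypeR R) -> \bar R} :=
  (@lebesgue_measure R \x @lebesgue_measure R)%E.

Definition partial1 (f : R * R -> R) (x : R * R) : R :=
  (fun t : R => f (t, x.2))^`()%classic x.1.

Definition partial2 (f : R * R -> R) (x : R * R) : R :=
  (fun t : R => f (x.1, t))^`()%classic x.2.

(* For a Lipschitz field this is the a.e. defined divergence: [^`()] is a total
   operator, and by Rademacher its default value only matters on a null set. *)
Definition div2 (phi : R * R -> R * R) (x : R * R) : R :=
  partial1 (fun y => (phi y).1) x + partial2 (fun y => (phi y).2) x.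

(* The library's norm on [R * R] is the maximum norm, hence this one. *)
Definition enorm (v : R * R) : R := Num.sqrt (v.1 ^+ 2 + v.2 ^+ 2).

Definition C1 (f : R * R -> R) : Prop :=
  (forall x, derivable (fun t : R => f (t, x.2)) x.1 1 /\
             derivable (fun t : R => f (x.1, t)) x.2 1) /\
  continuous (partial1 f) /\ continuous (partial2 f).

Definition compactly_supported (D : set (R * R)) (phi : R * R -> R * R) : Prop :=
  compact (closure [set x | phi x != 0]) /\ closure [set x | phi x != 0] `<=` D.

Definition C1c (D : set (R * R)) (phi : R * R -> R * R) : Prop :=
  [/\ C1 (fun x => (phi x).1), C1 (fun x => (phi x).2) & compactly_supported D phi].

(* Extension by 0 identifies compactly supported Lipschitz maps on D with
   Lipschitz maps on the plane whose support is a compact subset of D. *)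
Definition Lipc (D : set (R * R)) (phi : R * R -> R * R) : Prop :=
  lipschitz phi /\ compactly_supported D phi.

(* |Du|(D) for an open set D and u integrable on D. *)
Definition TV (D : set (R * R)) (u : R * R -> R) : \bar R :=
  ereal_sup [set (\int[leb2]_(x in D) (u x * div2 phi x)%:E)%E | phi in
    [set phi | C1c D phi /\ forall x, D x -> enorm (phi x) <= 1]].

Definition BV (D : set (R * R)) : set (R * R -> R) :=
  [set u : R * R -> R | leb2.-integrable D (fun x => (u x)%:E) /\ (TV D u < +oo)%E].

Definition TVw (w : R * R -> R) (D : set (R * R)) (u : R * R -> R) : \bar R :=
  ereal_sup [set (\int[leb2]_(x in D) (u x * div2 phi x)%:E)%E | phi in
    [set phi | Lipc D phi /\ forall x, D x -> enorm (phi x) <= w x]].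

Definition BVw (w : R * R -> R) (D : set (R * R)) : set (R * R -> R) :=
  [set u : R * R -> R | [/\ measurable_fun D u,
    (\int[leb2]_(x in D) (`|u x| * w x)%:E < +oo)%E & (TVw w D u < +oo)%E]].

Definition sqdist (D : set (R * R)) (u v : R * R -> R) : \bar R :=
  (\int[leb2]_(x in D) (`|u x - v x| ^+ 2)%:E)%E.

(* u is "the" minimizer of J over A: functions on D are identified a.e. *)
Definition unique_minimizer (D : set (R * R)) (A : set (R * R -> R))
    (J : (R * R -> R) -> \bar R) (u : R * R -> R) : Prop :=
  [/\ A u,
      forall v, A v -> (J u <= J v)%E &
      forall v, A v -> (forall v', A v' -> (J v <= J v')%E) -> ae_eq leb2 D v u].

Definition smallest_minimizer (A : set R) (f : R -> \bar R) (a : R) : Prop :=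
  [/\ A a,
      forall b, A b -> (f a <= f b)%E &
      forall b, A b -> (forall b', A b' -> (f b <= f b')%E) -> a <= b].

Definition Q : set (R * R) := [set x | 0 < x.1 < 1 /\ 0 < x.2 < 1].

Definition dyadic_square (L : set (R * R)) : Prop :=
  exists (k : nat) (i j : int),
    let z : R * R := (i%:~R / 2 ^+ k, j%:~R / 2 ^+ k) in
    [/\ 0 <= z.1 < 1, 0 <= z.2 < 1 &
        L = [set x | z.1 < x.1 <= z.1 + 2 ^- k /\ z.2 < x.2 <= z.2 + 2 ^- k]
            `&` Q].

Definition dyadic_partition (Ls : set (set (R * R))) : Prop :=
  [/\ finite_set Ls, Ls `<=` dyadic_square & partition Ls id Q].

Section Scheme.
Variables (ueta uc : R * R -> R) (c0 : R).

(* Functions on a square L are functions on its interior, which differs from L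
   by a null set. *)
Definition level3_solution (L : set (R * R)) (alpha : R) (u : R * R -> R) : Prop :=
  unique_minimizer (L°) (BV (L°))
    (fun v => sqdist (L°) ueta v + alpha%:E * TV (L°) v)%E u.

Definition level3_parameter (L : set (R * R)) (alphaL : R) : Prop :=
  exists2 u : R -> (R * R -> R),
    (forall alpha, 0 < alpha -> level3_solution L alpha (u alpha)) &
    smallest_minimizer `[c0, c0^-1] (fun alpha => sqdist (L°) uc (u alpha)) alphaL.

Definition weight (Ls : set (set (R * R))) (alpha : set (R * R) -> R)
    (x : R * R) : R :=
  \sum_(L \in Ls) alpha L * \1_L x.

Definition level2_solution (Ls : set (set (R * R))) (u : R * R -> R) : Prop :=
  exists2 alpha : set (R * R) -> R,
    (forall L, Ls L -> level3_parameter L (alpha L)) &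
    unique_minimizer Q (BVw (weight Ls alpha) Q)
      (fun v => sqdist Q ueta v + TVw (weight Ls alpha) Q v)%E u.

End Scheme.
End Plane.

(* Main.v *)
(* For f in L2, the functional v |-> int (f - v)^2 + beta TV(v) is strongly convex, so a
   minimizing sequence is Cauchy in L2; since TV is a supremum of integrals against
   bounded functions, it is lower semicontinuous and the limit u is a minimizer, with
   J(v) >= J(u) + |u - v|^2 / 2. In level 3 this quadratic growth makes alpha |-> u_alpha
   Hoelder continuous into L2, so that the cost has a smallest minimizer on the box.

   On a square, |v - c|_2 <= 5 TV(v) for some constant c, and in dimension 2 the factor 5
   does not depend on the size of the square. Hence, if |ueta|_2 <= c0 / 10 on a square L,
   the mean of ueta minimizes the level 3 functional for every alpha >= c0: the cost is
   constant on the box and alpha_L = c0. By absolute continuity of the integral this happens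
   on all but finitely many dyadic squares. So only finitely many weights occur, and the
   level 1 minimum is taken over a finite set of values. *)

Require Import Defs.
From HB Require Import structures.
From mathcomp Require Import finmap.
From mathcomp Require Import all_boot all_order all_algebra.
From mathcomp Require Import all_classical all_reals all_analysis.
From mathcomp Require Import measurable_realfun ring lra.

Set Implicit Arguments.
Unset Strict Implicit.
Unset Printing Implicit Defensive.

Import Order.TTheory GRing.Theory Num.Theory numFieldNormedType.Exports.

Local Open Scope classical_set_scope.
Local Open Scope ring_scope.

(** The analytic obstacle is the bound |v - c|_2 <= 5 TV(v): [BV] is defined by duality, so its
    members have no gradient to integrate along lines. No approximation by smooth functions is made.
    [TV] is tested on fields parallel to one axis, and nearly optimal fields on the single slices
    are glued together by a measurable selection. This produces an integrable A(y) that bounds the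
    horizontal oscillation of v on almost every line, and likewise a B(x) for the vertical one. Then
    |v - c|^2 is at most a function of x times a function of y, and Fubini splits the product, as in
    the Gagliardo-Nirenberg argument. The same bound on Q puts [ueta] and [uc] in L2, which the
    direct method presupposes.

    There are infinitely many partitions, but a weight is c0 plus a correction carried by the
    exceptional squares of its partition, so it is determined by a subset of a fixed finite set.
    Parameters and minimizers enter the definitions as relations; weights and costs can be compared
    only after their uniqueness, up to null sets, has been proved. *)

Section SquareIntegrable.
Context d (T : measurableType d) (R : realType)
  (mu : {measure set T -> \bar R}) (D : set T).
Hypotheses (mD : measurable D) (Dfin : (mu D < +oo)%E).
Implicit Types f g u v w : T -> R.

(** * Square-integrable functions on a set of finite measure *)

Definition L2 f : Prop :=
  measurable_fun D f /\ mu.-integrable D (fun x => (f x ^+ 2)%:E).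

Lemma dominated_integrable_fin f g : measurable_fun D f ->
  (forall x, D x -> `|f x| <= g x) -> mu.-integrable D (EFin \o g) ->
  mu.-integrable D (EFin \o f).
Proof.
move=> mf fg ig; apply: le_integrable ig => //; first exact/measurable_EFinP.
by move=> x Dx /=; rewrite lee_fin (le_trans (fg x Dx))// ler_norm.
Qed.

Lemma integrable_constant (c : R) : mu.-integrable D (EFin \o cst c).
Proof.
apply/integrableP; split; first exact/measurable_EFinP.
under eq_integral do rewrite /=.
by rewrite integral_cst// lte_mul_pinfty.
Qed.

Lemma L2_measurable f : L2 f -> measurable_fun D f.
Proof. by case. Qed.

Lemma L2_sqr f : L2 f -> mu.-integrable D (EFin \o (fun x => f x ^+ 2)).
Proof. by case. Qed.

Lemma integrableDf f g : mu.-integrable D (EFin \o f) ->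
  mu.-integrable D (EFin \o g) -> mu.-integrable D (EFin \o (fun x => f x + g x)).
Proof. by move=> jf jg; have := integrableD mD jf jg. Qed.

Lemma integrableZf (k : R) f : mu.-integrable D (EFin \o f) ->
  mu.-integrable D (EFin \o (fun x => k * f x)).
Proof. by move=> jf; have := integrableZl mD k jf. Qed.

Lemma L2_mul f g : L2 f -> L2 g ->
  mu.-integrable D (EFin \o (fun x => f x * g x)).
Proof.
move=> [mf jf] [mg jg].
apply: (@dominated_integrable_fin _ (fun x => f x ^+ 2 + g x ^+ 2)).
- exact: measurable_funM.
- move=> x _; rewrite ler_norml; apply/andP; split; nra.
- exact: integrableDf.
Qed.

Lemma L2_bounded f (K : R) : measurable_fun D f ->
  (forall x, D x -> `|f x| <= K) -> L2 f.
Proof.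
move=> mf fK; split=> //.
apply: (@dominated_integrable_fin _ (fun=> K ^+ 2)).
- exact: measurable_funX.
- move=> x Dx; rewrite normrX.
  by have := fK x Dx; have := normr_ge0 (f x); nra.
- exact: integrable_constant.
Qed.

Lemma L2_cst (c : R) : L2 (fun=> c).
Proof. by apply: (@L2_bounded _ `|c|). Qed.

Lemma L2_integrable f : L2 f -> mu.-integrable D (EFin \o f).
Proof.
move=> jf; have := L2_mul jf (L2_cst 1).
by apply: eq_integrable => // x _ /=; rewrite mulr1.
Qed.

Lemma L2_scale (k : R) f : L2 f -> L2 (fun x => k * f x).
Proof.
move=> [mf jf]; split; first exact: measurable_funM.
have := integrableZf (k ^+ 2) jf.
by apply: eq_integrable => // x _ /=; rewrite exprMn.
Qed.

Lemma L2_add f g : L2 f -> L2 g -> L2 (fun x => f x + g x).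
Proof.
move=> hf hg; have [mf jf] := hf; have [mg jg] := hg.
split; first exact: measurable_funD.
have := integrableDf (integrableDf jf jg) (integrableZf 2 (L2_mul hf hg)).
by apply: eq_integrable => // x _ /=; congr EFin; ring.
Qed.

Lemma L2_sub f g : L2 f -> L2 g -> L2 (fun x => f x - g x).
Proof.
move=> hf hg; have := L2_add hf (L2_scale (-1) hg).
by rewrite (_ : (fun x => _) = (fun x => f x - g x))//; apply/funext => x; ring.
Qed.

Lemma L2P f : measurable_fun D f ->
  (\int[mu]_(x in D) (f x ^+ 2)%:E < +oo)%E -> L2 f.
Proof.
move=> mf jf; split => //; apply/integrableP; split.
  by apply/measurable_EFinP; exact: measurable_funX.
rewrite (eq_integral (fun x => (f x ^+ 2)%:E))// => x _.
by rewrite gee0_abs// lee_fin sqr_ge0.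
Qed.

Lemma L2_int_ge0 f : 0 <= \int[mu]_(x in D) (f x ^+ 2).
Proof. by apply: Rintegral_ge0 => x _; exact: sqr_ge0. Qed.

Lemma L2_intE f : L2 f ->
  (\int[mu]_(x in D) (f x ^+ 2)%:E)%E = (\int[mu]_(x in D) (f x ^+ 2))%:E.
Proof. by move=> [_ jf]; rewrite fineK//; exact: integrable_fin_num. Qed.

Lemma L2_expand f g : L2 f -> L2 g ->
  \int[mu]_(x in D) ((f x + g x) ^+ 2) =
  \int[mu]_(x in D) (f x ^+ 2) + 2 * \int[mu]_(x in D) (f x * g x)
   + \int[mu]_(x in D) (g x ^+ 2).
Proof.
move=> hf hg.
have jfg := L2_mul hf hg.
rewrite -RintegralZl// -RintegralD//; last 2 first.
  by case: hf.
  exact: integrableZf.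
rewrite -RintegralD//; last 2 first.
- by apply: integrableDf; [case: hf|exact: integrableZf].
- by case: hg.
by apply: eq_Rintegral => x _; ring.
Qed.

(** The gain of [4^-1] times the squared distance is the only source of strong convexity; the
    variation term contributes plain convexity. With f - u and f - v halved, their sum is the
    midpoint term and their difference is half of v - u. *)
Lemma parallelogram f u v : L2 f -> L2 u -> L2 v ->
  \int[mu]_(x in D) ((f x - 2^-1 * (u x + v x)) ^+ 2) =
  2^-1 * \int[mu]_(x in D) ((f x - u x) ^+ 2)
  + 2^-1 * \int[mu]_(x in D) ((f x - v x) ^+ 2)
  - 4^-1 * \int[mu]_(x in D) ((u x - v x) ^+ 2).
Proof.
move=> hf hu hv.
have h1 := L2_scale 2^-1 (L2_sub hf hu).
have h2 := L2_scale 2^-1 (L2_sub hf hv).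
have E1 := L2_expand h1 h2.
have E2 := L2_expand h1 (L2_scale (-1) h2).
rewrite (@eq_Rintegral _ _ _ _ _ (fun x => (2^-1 * (f x - u x) + 2^-1 * (f x - v x)) ^+ 2)); last first.
  by move=> x _; congr (_ ^+ 2); field.
have S : forall (k : R) g, L2 g -> \int[mu]_(x in D) ((k * g x) ^+ 2) =
    k ^+ 2 * \int[mu]_(x in D) (g x ^+ 2).
  move=> k g [_ hg]; rewrite -RintegralZl//.
  by apply: eq_Rintegral => x _; rewrite exprMn.
have E3 : \int[mu]_(x in D) ((u x - v x) ^+ 2) = 4 *
   \int[mu]_(x in D) ((2^-1 * (f x - u x) + -1 * (2^-1 * (f x - v x))) ^+ 2).
  have hh := L2_add h1 (L2_scale (-1) h2).
  rewrite (_ : 4 = (-2)^+2 :> R); last by ring.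
  by rewrite -S//; apply: eq_Rintegral => x _; congr (_ ^+ 2); field.
have E4 : \int[mu]_(x in D) (2^-1 * (f x - u x) * (-1 * (2^-1 * (f x - v x)))) =
   - \int[mu]_(x in D) (2^-1 * (f x - u x) * (2^-1 * (f x - v x))).
  have := @RintegralZl _ _ _ mu D _ (-1) mD (L2_mul h1 h2).
  by rewrite mulN1r => <-; apply: eq_Rintegral => t _ /=; ring.
rewrite E3 E2 E1 E4 (S (-1)) ?(S 2^-1)//; try exact: L2_sub.
  by field.
Qed.

End SquareIntegrable.

(** * Rapidly converging sequences and the direct method *)

Section FastCauchy.
Context d (T : measurableType d) (R : realType)
  (mu : {measure set T -> \bar R}) (D : set T).
Hypotheses (mD : measurable D) (Dfin : (mu D < +oo)%E).

Lemma nneseries_fin_cvg (a : nat -> R) : (forall n, 0 <= a n) ->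
  (\sum_(0 <= n <oo) (a n)%:E < +oo)%E -> cvgn (series a).
Proof.
move=> a0 aoo.
apply: nondecreasing_is_cvgn; first exact/nondecreasing_series.
exists (fine (\sum_(0 <= n <oo) (a n)%:E)%E) => _ [n _ <-].
rewrite -lee_fin fineK; last first.
  by rewrite ge0_fin_numE// nneseries_ge0// => ? _ _; rewrite lee_fin.
rewrite /series/= -sumEFin.
by apply: (nneseries_lim_ge n) => k _ _; rewrite lee_fin.
Qed.

(** The Riesz-Fischer argument: on a set of finite measure the increments are summable in L1, so the
    telescoping series converges absolutely almost everywhere, and the sum of the absolute values is
    an integrable majorant [h]. Fatou's lemma will use the convergence, dominated convergence also
    the majorant. *)
Lemma fast_cauchy_ae_cvg (v : nat -> T -> R) (C : R) :
  (forall n, L2 mu D (v n)) ->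
  (forall n, \int[mu]_(x in D) ((v n.+1 x - v n x) ^+ 2) <= C * 4^-1 ^+ n) ->
  exists (w : T -> R) (h : T -> \bar R), [/\ measurable_fun D w, mu.-integrable D h,
    {ae mu, forall x, D x -> v ^~ x @ \oo --> w x} &
    forall x n, D x -> (`|(v n x)%:E| <= h x)%E].
Proof.
move=> hv hC.
pose De n x := v n.+1 x - v n x.
have hDe n : L2 mu D (De n) by exact: L2_sub.
have mDe n : measurable_fun D (De n) by exact: L2_measurable (hDe n).
pose h x := (`|v 0%N x|%:E + \sum_(0 <= n <oo) `|De n x|%:E)%E.
(* A limit superior is measurable in any case and agrees with the limit where there is one. *)
pose w x := fine (limn_esup (fun n => (v n x)%:E)).
have mDe' n : measurable_fun D (fun x => `|De n x|%:E).
  by apply/measurable_EFinP; exact: measurableT_comp.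
have De1 n : (\int[mu]_(x in D) `|De n x|%:E <=
    ((2^-1 * fine (mu D) + 2^-1 * C) * 2^-1 ^+ n)%:E)%E.
  have p0 : 0 < 2^-1 ^+ n :> R by rewrite exprn_gt0.
  (* Young's inequality with weight 2^n: |d| <= (2^-n + 2^n d^2) / 2. The hypothesis bounds 2^n
     times the integral of d^2 by C 2^-n, so both terms decay like 2^-n. *)
  apply: (@le_trans _ _ (\int[mu]_(x in D) (2^-1 * (2^-1 ^+ n + 2 ^+ n * De n x ^+ 2))%:E)%E).
    apply: ge0_le_integral => //.
    - apply/measurable_EFinP; apply: measurable_funM => //.
      apply: measurable_funD => //; apply: measurable_funM => //.
      exact: measurable_funX.
    - move=> x Dx; rewrite lee_fin -(@ler_pM2r _ (2^-1 ^+ n))//.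
      have -> : 2^-1 * (2^-1 ^+ n + 2 ^+ n * De n x ^+ 2) * 2^-1 ^+ n =
         2^-1 * ((2^-1 ^+ n) ^+ 2 + De n x ^+ 2).
        have : 2 ^+ n * 2^-1 ^+ n = 1 :> R by rewrite -exprMn divff// expr1n.
        move: (2 ^+ n) (2^-1 ^+ n) => a b ab.
        by rewrite (_ : _ * b = 2^-1 * (b ^+ 2 + (a * b) * De n x ^+ 2)); [rewrite ab; ring|ring].
      rewrite -[De n x ^+ 2]real_normK ?num_real//.
      by have := sqr_ge0 (2^-1 ^+ n - `|De n x|); nra.
  have jc : mu.-integrable D (EFin \o (fun=> 2^-1 ^+ n : R)).
    exact: (@integrable_constant _ _ _ mu D mD Dfin (2^-1 ^+ n)).
  have jd := integrableZf mD (2 ^+ n) (L2_sqr (hDe n)).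
  have jcd := integrableDf mD jc jd.
  rewrite -[leLHS]fineK; last exact: integrable_fin_num (integrableZf mD 2^-1 jcd).
  rewrite lee_fin -/(Rintegral _ _ _) RintegralZl// RintegralD// RintegralZl//; last exact: L2_sqr.
  rewrite Rintegral_cst//.
  apply: (@le_trans _ _ (2^-1 * (2^-1 ^+ n * fine (mu D) + 2 ^+ n * (C * 4^-1 ^+ n)))).
    by rewrite ler_pM2l// lerD2l ler_pM2l ?exprn_gt0//; exact: hC.
  rewrite (_ : 4^-1 = 2^-1 * 2^-1 :> R); last by field.
  rewrite exprMn.
  have : 2 ^+ n * 2^-1 ^+ n = 1 :> R by rewrite -exprMn divff// expr1n.
  move: (2 ^+ n) (2^-1 ^+ n) => a b ab.
  by rewrite (_ : a * _ = (a * b) * (C * b)); [rewrite ab; lra|ring].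
have ih : mu.-integrable D h.
  have mh : measurable_fun D h.
    apply: emeasurable_funD.
      by apply/measurable_EFinP; apply: measurableT_comp => //; exact: L2_measurable (hv 0%N).
    by apply: ge0_emeasurable_sum => // n x _ _; rewrite lee_fin.
  have h0 x : D x -> (0 <= h x)%E.
    by move=> _; rewrite adde_ge0// nneseries_ge0.
  apply/integrableP; split => //.
  under eq_integral => x /set_mem Dx do rewrite gee0_abs ?h0//.
  rewrite ge0_integralD//; last 3 first.
  - by apply/measurable_EFinP; apply: measurableT_comp => //; exact: L2_measurable (hv 0%N).
  - by move=> x _; rewrite nneseries_ge0.
  - by apply: ge0_emeasurable_sum => // n x _ _; rewrite lee_fin.
  apply: lte_add_pinfty.
    have := L2_integrable mD Dfin (hv 0%N) => /integrableP[_].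
    by under eq_integral do rewrite /=.
  rewrite integral_nneseries//.
  apply: (@le_lt_trans _ _ (\sum_(0 <= n <oo) ((2^-1 * fine (mu D) + 2^-1 * C) * 2^-1 ^+ n)%:E)%E).
    apply: lee_nneseries => // n _ _; exact: integral_ge0.
  have K0 : 0 <= 2^-1 * fine (mu D) + 2^-1 * C.
    have := le_trans (L2_int_ge0 mu D (De 0%N)) (hC 0%N).
    rewrite expr0 mulr1 => C0.
    by rewrite addr_ge0 ?mulr_ge0// fine_ge0.
  apply: (@le_lt_trans _ _ ((2^-1 * fine (mu D) + 2^-1 * C) * 2)%:E); last by rewrite ltry.
  apply: lime_le; first by apply: is_cvg_nneseries => n _ _; rewrite lee_fin mulr_ge0.
  apply: nearW => n; rewrite sumEFin lee_fin -mulr_sumr ler_wpM2l//.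
  have -> : \sum_(0 <= i < n) 2^-1 ^+ i = 2 - 2 * 2^-1 ^+ n :> R.
    elim: n => [|n IH]; first by rewrite big_geq// expr0; lra.
    by rewrite big_nat_recr//= IH exprS; field.
  by rewrite gerBl mulr_ge0.
exists w, h; split => //.
- apply: (measurableT_comp (@fine_measurable R _ measurableT)).
  apply: measurable_fun_limn_esup => n; apply/measurable_EFinP; exact: L2_measurable (hv n).
- have := integrable_ae mD ih; apply: filterS => x hx Dx; have {}hx := hx Dx.
  have cD : cvgn (series (fun n => `|De n x|)).
    apply: nneseries_fin_cvg => //.
    move: hx; rewrite /h fin_numD => /andP[_].
    by rewrite ge0_fin_numE// nneseries_ge0.
  have cD' : cvgn (series (fun n => De n x)) by exact: normed_cvg.
  have cv : cvgn (v ^~ x).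
    have -> : v ^~ x = (fun n => v 0%N x + series (De ^~ x) n).
      apply/funext => n; rewrite /series/= telescope_sumr//.
      by rewrite addrC subrK.
    by apply: is_cvgD => //; exact: is_cvg_cst.
  have cvE : (v n x)%:E @[n --> \oo] --> (limn (v ^~ x))%:E by apply: cvg_EFin => //; exact: nearW.
  by rewrite /w (cvg_limn_einf_sup cvE).2/=.
- move=> x n Dx; rewrite /h abse_EFin.
  apply: (@le_trans _ _ (`|v 0%N x|%:E + \sum_(0 <= i < n) `|De i x|%:E)%E).
    rewrite sumEFin -EFinD lee_fin.
    have -> : v n x = v 0%N x + \sum_(0 <= i < n) De i x.
      by rewrite telescope_sumr// addrC subrK.
    by rewrite (le_trans (ler_normD _ _))// lerD2l ler_norm_sum.
  by rewrite leeD2l//; exact: nneseries_lim_ge.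
Qed.

End FastCauchy.

Lemma limn_einf_le_cvg (R : realType) (a b : (\bar R)^nat) (l : \bar R) :
  b @ \oo --> l -> (forall n, (a n <= b n)%E) -> (limn_einf a <= l)%E.
Proof.
move=> bl ab; rewrite limn_einf_lim -(cvg_lim _ bl)//.
apply: lee_lim; [exact: is_cvg_einfs|by apply/cvg_ex; exists l|].
apply: nearW => n; apply: le_trans (ab n).
by apply: ereal_inf_lbound; exists n => /=.
Qed.

Section DirectMethod.
Context d (T : measurableType d) (R : realType)
  (mu : {measure set T -> \bar R}) (D : set T).
Hypotheses (mD : measurable D) (Dfin : (mu D < +oo)%E).
Variable Phi : set (T -> R).
Hypotheses (Phi0 : Phi (fun=> 0))
  (PhiB : forall psi, Phi psi -> measurable_fun D psi /\
     exists K : R, forall x, D x -> `|psi x| <= K).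

(** An abstract total variation: [Phi] stands for the divergences of the admissible fields, so that
    one argument serves [TV] at level 3 and [TVw] at level 2. *)
Definition dual_sup (v : T -> R) : \bar R :=
  ereal_sup [set (\int[mu]_(x in D) (v x * psi x)%:E)%E | psi in Phi].

Definition energy (f : T -> R) (beta : R) (v : T -> R) : \bar R :=
  (\int[mu]_(x in D) (`|f x - v x| ^+ 2)%:E + beta%:E * dual_sup v)%E.

Lemma dual_sup_ge0 v : (0 <= dual_sup v)%E.
Proof.
apply: le_ereal_sup_tmp; exists 0%E => //; exists (fun=> 0) => //.
by under eq_integral do rewrite mulr0; rewrite integral0.
Qed.

Lemma L2_test psi : Phi psi -> L2 mu D psi.
Proof. by move=> /PhiB[mp [K hK]]; exact: L2_bounded hK. Qed.

Lemma L2_pairingE v psi : L2 mu D v -> Phi psi ->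
  (\int[mu]_(x in D) (v x * psi x)%:E)%E = (\int[mu]_(x in D) (v x * psi x))%:E.
Proof.
move=> hv /L2_test hp; rewrite fineK//.
exact: integrable_fin_num (L2_mul mD hv hp).
Qed.

Lemma dual_supE v : (dual_sup v < +oo)%E -> dual_sup v = (fine (dual_sup v))%:E.
Proof. by move=> voo; rewrite fineK// ge0_fin_numE// dual_sup_ge0. Qed.

Lemma pairing_le_dual_sup v psi : L2 mu D v -> Phi psi -> (dual_sup v < +oo)%E ->
  \int[mu]_(x in D) (v x * psi x) <= fine (dual_sup v).
Proof.
move=> hv hp voo; rewrite -lee_fin -dual_supE//.
by rewrite -L2_pairingE//; apply: ereal_sup_ubound; exists psi.
Qed.

Lemma energyE f (beta : R) v : L2 mu D f -> L2 mu D v -> (dual_sup v < +oo)%E ->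
  energy f beta v =
  (\int[mu]_(x in D) ((f x - v x) ^+ 2) + beta * fine (dual_sup v))%:E.
Proof.
move=> hf hv voo; rewrite /energy EFinD EFinM -dual_supE// -L2_intE//; last exact: L2_sub.
by congr (_ + _)%E; apply: eq_integral => x _; rewrite real_normK// num_real.
Qed.

(** Finite energy puts f - v in L2, hence also v = f - (f - v). The minimization can thus run over
    all measurable functions, whatever space a level prescribes. *)
Lemma energy_fin f (beta : R) v : L2 mu D f -> 0 < beta -> measurable_fun D v ->
  (energy f beta v < +oo)%E -> L2 mu D v /\ (dual_sup v < +oo)%E.
Proof.
move=> hf beta0 mv; rewrite /energy => voo.
have h1 : (0 <= \int[mu]_(x in D) (`|f x - v x| ^+ 2)%:E)%E.
  by apply: integral_ge0 => x _; rewrite lee_fin sqr_ge0.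
have h2 : (0 <= beta%:E * dual_sup v)%E.
  by rewrite mule_ge0 ?dual_sup_ge0// lee_fin ltW.
split.
  have hfv : L2 mu D (fun x => f x - v x).
    apply: L2P => //; first exact: measurable_funB (L2_measurable hf) mv.
    apply: le_lt_trans voo.
    rewrite (eq_integral (fun x => (`|f x - v x| ^+ 2)%:E)) ?leeDl//.
    by move=> x _; rewrite real_normK// num_real.
  have := L2_sub mD hf hfv.
  by rewrite (_ : (fun x => _) = v)//; apply/funext => x; ring.
rewrite ltey; apply/eqP => voo'; move: voo; rewrite voo' gt0_muley ?lte_fin//.
by rewrite addey// gt_eqF// (lt_le_trans _ h1).
Qed.

(** A supremum of linear functionals is convex, so the defect in [parallelogram] survives in the
    energy. *)
Lemma energy_midpoint f (beta : R) u v : 0 < beta -> L2 mu D f ->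
  L2 mu D u -> L2 mu D v -> (dual_sup u < +oo)%E -> (dual_sup v < +oo)%E ->
  (energy f beta (fun x => (2^-1 * (u x + v x))%R)
    <= (2^-1 * fine (energy f beta u) + 2^-1 * fine (energy f beta v)
       - 4^-1 * \int[mu]_(x in D) ((u x - v x) ^+ 2))%:E)%E.
Proof.
move=> beta0 hf hu hv uoo voo.
pose w x := 2^-1 * (u x + v x).
have hw : L2 mu D w by exact: L2_scale (L2_add _ _ _).
have dw : (dual_sup w <= (2^-1 * fine (dual_sup u) + 2^-1 * fine (dual_sup v))%:E)%E.
  apply: ge_ereal_sup => _ [psi hpsi <-].
  rewrite L2_pairingE// lee_fin.
  have hp := L2_test hpsi.
  have -> : \int[mu]_(x in D) (w x * psi x) =
      2^-1 * \int[mu]_(x in D) (u x * psi x) + 2^-1 * \int[mu]_(x in D) (v x * psi x).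
    have j1 := L2_mul mD hu hp; have j2 := L2_mul mD hv hp.
    rewrite -!RintegralZl// -RintegralD//; try exact: integrableZf.
    by apply: eq_Rintegral => x _; rewrite /w; ring.
  by apply: lerD; rewrite ler_pM2l//; exact: pairing_le_dual_sup.
have woo : (dual_sup w < +oo)%E by rewrite (le_lt_trans dw)// ltry.
rewrite -/w !energyE//= lee_fin parallelogram//.
have : beta * fine (dual_sup w) <= beta * (2^-1 * fine (dual_sup u) + 2^-1 * fine (dual_sup v)).
  by rewrite ler_pM2l// -lee_fin -dual_supE.
lra.
Qed.

Theorem direct_method f (beta : R) : L2 mu D f -> 0 < beta ->
  exists u, [/\ L2 mu D u, (dual_sup u < +oo)%E &
    forall v : T -> R, measurable_fun D v ->
    (energy f beta u + (2^-1 * \int[mu]_(x in D) ((u x - v x) ^+ 2))%:E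
       <= energy f beta v)%E].
Proof.
move=> hf beta0.
pose A := [set energy f beta v | v in [set v : T -> R | measurable_fun D v]].
have E0 v : (0 <= energy f beta v)%E.
  rewrite adde_ge0 ?mule_ge0 ?dual_sup_ge0 ?lee_fin ?(ltW beta0)//.
  by apply: integral_ge0 => x _; rewrite lee_fin sqr_ge0.
have d0 : dual_sup (fun=> 0) = 0%E.
  apply/eqP; rewrite eq_le dual_sup_ge0 andbT; apply: ge_ereal_sup => _ [psi _ <-].
  by under eq_integral do rewrite mul0r; rewrite integral0.
pose m := ereal_inf A.
have mfin : m \is a fin_num.
  rewrite ge0_fin_numE; last by apply: le_ereal_inf_tmp => _ [v _ <-].
  apply: (@le_lt_trans _ _ (energy f beta (fun=> 0))).
    by apply: ereal_inf_lbound; exists (fun=> 0) => //; exact: measurable_cst.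
  by rewrite energyE// ?d0 ?ltry//; exact: L2_cst.
pose I := fine m.
have mI : m = I%:E by rewrite fineK.
(* The tolerance 4^-n is made for [fast_cauchy_ae_cvg]: [energy_midpoint] turns it into the decay of
   the squared distances of consecutive terms. *)
have /choice[v hvn] : forall n, exists v : T -> R, measurable_fun D v /\
    (energy f beta v < (I + 4^-1 ^+ n)%:E)%E.
  move=> n; have := @lb_ereal_inf_adherent R A (4^-1 ^+ n).
  rewrite exprn_gt0// => /(_ isT mfin)[_ [v mv <-] hv].
  by exists v; split => //; rewrite EFinD -mI.
have vfin n : L2 mu D (v n) /\ (dual_sup (v n) < +oo)%E.
  by have [mv hv] := hvn n; apply: energy_fin hf beta0 mv _; rewrite (lt_trans hv)// ltry.
have vL n : L2 mu D (v n) by case: (vfin n).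
have voo n : (dual_sup (v n) < +oo)%E by case: (vfin n).
have below (w : T -> R) : measurable_fun D w -> (I%:E <= energy f beta w)%E.
  by move=> mw; rewrite -mI; apply: ereal_inf_lbound; exists w.
have fE n : fine (energy f beta (v n)) <= I + 4^-1 ^+ n.
  by have := ltW (hvn n).2; rewrite energyE// lee_fin.
have hC n : \int[mu]_(x in D) ((v n.+1 x - v n x) ^+ 2) <= 8 * 4^-1 ^+ n.
  have := energy_midpoint beta0 hf (vL n.+1) (vL n) (voo _) (voo _).
  have mw : measurable_fun D (fun x => 2^-1 * (v n.+1 x + v n x)).
    exact/L2_measurable/L2_scale/L2_add.
  move=> /(le_trans (below _ mw)); rewrite lee_fin.
  have := fE n; have := fE n.+1; rewrite exprS.
  have : 0 <= 4^-1 ^+ n :> R by rewrite exprn_ge0.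
  move: (4^-1 ^+ n) => c c0; lra.
have [u [h [mu_ ih cvu hh]]] := fast_cauchy_ae_cvg mD Dfin vL hC.
have mvn n : measurable_fun D (v n) by exact: L2_measurable (vL n).
have pcv psi : Phi psi -> mu.-integrable D (EFin \o (fun x => u x * psi x)) /\
    \int[mu]_(x in D) (v n x * psi x) @[n --> \oo] --> \int[mu]_(x in D) (u x * psi x).
  move=> hp; have [mp [K hK]] := PhiB hp.
  have [] := @dominated_convergence _ T R mu D mD (fun n x => (v n x * psi x)%:E)
    (fun x => (u x * psi x)%:E) (fun x => (`|K|%:E * h x)%E).
  - by move=> n; apply/measurable_EFinP; exact: measurable_funM.
  - by apply/measurable_EFinP; exact: measurable_funM.
  - apply: filterS cvu => x cx Dx; apply: cvg_EFin; first exact: nearW.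
    by apply: cvgM; [exact: cx|exact: cvg_cst].
  - exact: integrableZl.
  - apply: aeW => x n Dx; rewrite EFinM abseM muleC; apply: lee_pmul => //.
      by rewrite abse_EFin lee_fin (le_trans (hK x Dx))// ler_norm.
    exact: hh.
  move=> ip _ cp; split => //.
  by apply: (fine_cvg (f := fun n => _)); rewrite fineK//; exact: integrable_fin_num.
(* Lower semicontinuity for one test function at a time: Fatou for the distance, dominated
   convergence for the pairing. The supremum over [psi] is taken later, in [du]; the choice [psi] =
   0 already shows that u is in L2. *)
have key psi : Phi psi ->
  (\int[mu]_(x in D) (`|f x - u x| ^+ 2)%:E <=
   (I - beta * \int[mu]_(x in D) (u x * psi x))%:E)%E.
  move=> hp.
  have mfn n : measurable_fun D (fun x => ((f x - v n x) ^+ 2)%:E).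
    apply/measurable_EFinP/measurable_funX/measurable_funB => //; exact: L2_measurable hf.
  have := @fatou _ T R mu D mD (fun n x => ((f x - v n x) ^+ 2)%:E) mfn.
  have -> : (\int[mu]_(x in D) limn_einf (fun n => ((f x - v n x) ^+ 2)%:E))%E =
     (\int[mu]_(x in D) (`|f x - u x| ^+ 2)%:E)%E.
    apply: ae_eq_integral => //.
    - apply: (measurableT_comp (@oppe_measurable _ _)).
      by apply: measurable_fun_limn_esup => n; exact: measurableT_comp.
    - apply/measurable_EFinP/measurable_funX; apply: measurableT_comp => //.
      by apply: measurable_funB => //; exact: L2_measurable hf.
    apply: filterS cvu => x cx Dx.
    have : ((f x - v n x) ^+ 2)%:E @[n --> \oo] --> (`|f x - u x| ^+ 2)%:E.
      apply: cvg_EFin; first exact: nearW.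
      rewrite real_normK ?num_real//=.
      rewrite expr2 (_ : _ \o _ = (fun n => (f x - v n x) * (f x - v n x))); last first.
        by apply/funext => n /=; rewrite expr2.
      by apply: cvgM; apply: cvgB; [exact: cvg_cst|exact: cx|exact: cvg_cst|exact: cx].
    by move=> /cvg_limn_einf_sup[->].
  move=> /(_ _)/le_trans; apply; first by move=> n x _; rewrite lee_fin sqr_ge0.
  have cb : ((I + 4^-1 ^+ n - beta * \int[mu]_(x in D) (v n x * psi x))%:E)
     @[n --> \oo] --> ((I - beta * \int[mu]_(x in D) (u x * psi x))%:E).
    apply: cvg_EFin; first exact: nearW.
    have [_ cp] := pcv psi hp.
    apply: cvgB; last by apply: cvgM; [exact: cvg_cst|exact: cp].
    rewrite -[X in _ --> X]addr0; apply: cvgD; first exact: cvg_cst.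
    by apply: cvg_expr; rewrite ger0_norm// invf_lt1 ?ltr1n.
  apply: limn_einf_le_cvg cb _ => n.
  rewrite L2_intE//; last exact: L2_sub.
  rewrite lee_fin; have := fE n; rewrite energyE//=.
  have := pairing_le_dual_sup (vL n) hp (voo n).
  by rewrite -(@ler_pM2l _ beta beta0 (\int[mu]_(x in D) (v n x * psi x))); lra.
have uL : L2 mu D u.
  have := key _ Phi0; rewrite (eq_integral (fun x => ((f x - u x) ^+ 2)%:E)); last first.
    by move=> x _; rewrite real_normK// num_real.
  move=> /le_lt_trans/(_ (ltry _)) => fin.
  have := L2_sub mD hf (L2P (measurable_funB (L2_measurable hf) mu_) fin).
  by rewrite (_ : (fun x => _) = u)//; apply/funext => x /=; ring.
have Fu : (\int[mu]_(x in D) (`|f x - u x| ^+ 2)%:E)%E = (\int[mu]_(x in D) ((f x - u x) ^+ 2))%:E.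
  rewrite -L2_intE//; last exact: L2_sub.
  by apply: eq_integral => x _; rewrite real_normK// num_real.
have du : (dual_sup u <= (beta^-1 * (I - \int[mu]_(x in D) ((f x - u x) ^+ 2)))%:E)%E.
  apply: ge_ereal_sup => _ [psi hp <-]; rewrite L2_pairingE// lee_fin ler_pdivlMl//.
  by have := key _ hp; rewrite Fu lee_fin; lra.
have uoo : (dual_sup u < +oo)%E by rewrite (le_lt_trans du)// ltry.
exists u; split => // w mw.
have uI : energy f beta u = I%:E.
  apply/eqP; rewrite eq_le below ?andbT; last by case: uL.
  rewrite energyE// lee_fin; have := du; rewrite {1}dual_supE// lee_fin ler_pdivlMl//; lra.
have [->|] := eqVneq (energy f beta w) +oo%E; first by rewrite leey.
rewrite -ltey => woo; have [wL dwoo] := energy_fin hf beta0 mw woo.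
have mw2 : measurable_fun D (fun x => 2^-1 * (u x + w x)).
  exact: L2_measurable (L2_scale mD 2^-1 (L2_add mD uL wL)).
(* The midpoint of u and w cannot beat the infimum I, so [energy_midpoint] leaves 4^-1 |u - w|^2 <=
   (E w - I) / 2, which is the quadratic growth. *)
have := le_trans (below _ mw2) (energy_midpoint beta0 hf uL wL uoo dwoo).
rewrite lee_fin uI energyE//= -EFinD lee_fin; lra.
Qed.

End DirectMethod.

(** * Measurability and boundedness of divergences *)

Section PlaneMeasurability.
Context {R : realType}.
Implicit Types (U : set (R * R)) (f : R * R -> R).

(** The topology of the plane and the product sigma-algebra are separate structures; the countably
    many squares with rational center and radius 1 / (n + 1) link them. *)
Lemma open_measurable_plane U : open U ->
  measurable (U : set (measurableTypeR R * measurableTypeR R)).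
Proof.
move=> oU.
pose box (p q : rat) (n : nat) : set (R * R) :=
  ball (ratr p : R) n.+1%:R^-1 `*` ball (ratr q : R) n.+1%:R^-1.
have mb p q n : measurable (box p q n : set (measurableTypeR R * measurableTypeR R)).
  by apply: measurableX; exact: measurable_ball.
have -> : U = \bigcup_p \bigcup_q \bigcup_n
    (if `[< box p q n `<=` U >] then box p q n else set0).
  apply/seteqP; split => [z Uz|z [p _ [q _ [n _]]]]; last first.
    by case: ifPn => // /asboolP; apply.
  have /nbhs_ballP[e /= e0 eU] : nbhs z U by exact: open_nbhs_nbhs.
  have [n ne] : exists n, n.+1%:R^-1 < e / 2.
    have [N _ /(_ N (leqnn _))] := near_infty_natSinv_lt (PosNum (divr_gt0 e0 (ltr0n R 2))).
    by exists N.
  have n0 : 0 < n.+1%:R^-1 :> R by rewrite invr_gt0.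
  have ne2 : n.+1%:R^-1 + n.+1%:R^-1 <= e by rewrite [leRHS]splitr lerD// ltW.
  have pick (t : R) : exists p : rat, ball (ratr p : R) n.+1%:R^-1 t.
    have [|r [br [p _ pr]]] := @dense_rat R (ball t n.+1%:R^-1) _ (ball_open t _).
      by exists t; exact: ballxx.
    by exists p; rewrite pr; exact: ball_sym.
  have [p hp] := pick z.1; have [q hq] := pick z.2.
  exists p => //; exists q => //; exists n => //.
  rewrite asboolT//= => y [y1 y2]; apply: eU; split => /=.
    apply: (@le_ball _ _ _ (n.+1%:R^-1 + n.+1%:R^-1)); first exact: ne2.
    exact: ball_triangle (ball_sym hp) y1.
  apply: (@le_ball _ _ _ (n.+1%:R^-1 + n.+1%:R^-1)); first exact: ne2.
  exact: ball_triangle (ball_sym hq) y2.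
apply: bigcupT_measurable_rat => p; apply: bigcupT_measurable_rat => q.
by apply: bigcupT_measurable => n; case: ifPn.
Qed.

Lemma closed_measurable_plane U : closed U ->
  measurable (U : set (measurableTypeR R * measurableTypeR R)).
Proof.
by move=> cU; rewrite -(setCK U); apply: measurableC; apply: open_measurable_plane; exact: closed_openC.
Qed.

Lemma continuous_measurable_plane f : continuous f ->
  measurable_fun setT (f : measurableTypeR R * measurableTypeR R -> R).
Proof.
move=> cf; apply: (measurability _ (RGenOpens.measurableE R)).
move=> _ [_ [a [b ->] <-]]; rewrite setTI.
apply: open_measurable_plane; apply: open_comp; last exact: interval_open.
by move=> x _; exact: cf.
Qed.

(** The divergence of a Lipschitz field uses a total derivative, which must be measurable also where
    the difference quotients diverge. The Cauchy criterion describes the set [C] of convergence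
    through the closed sets [S k n]; on [C] the limit may be taken along 1 / (n + 1), and elsewhere
    [lim] is the constant [point]. *)
Lemma measurable_lim_dnbhs0 (q : R -> R * R -> R) :
  (forall h, h != 0 -> continuous (q h)) ->
  measurable_fun setT
    ((fun x => lim (q h x @[h --> 0^'])) : measurableTypeR R * measurableTypeR R -> R).
Proof.
move=> cq.
pose e n : R := n.+1%:R^-1.
have e0 n : 0 < e n by rewrite invr_gt0.
(* All increments h and h' are quantified at once: each condition is closed in x, and closed sets
   may be intersected over uncountable families. *)
pose S k n := [set x | forall h h', 0 < `|h| < e n -> 0 < `|h'| < e n ->
  `|q h x - q h' x| <= e k].
have mS k n : measurable (S k n : set (measurableTypeR R * measurableTypeR R)).
  apply: closed_measurable_plane.
  rewrite (_ : S k n = \bigcap_(h in [set h | 0 < `|h| < e n])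
     \bigcap_(h' in [set h | 0 < `|h| < e n])
     ((fun x => `|q h x - q h' x|) @^-1` [set r | r <= e k])); last first.
    apply/seteqP; split => x /=; first by move=> hx h hh h' hh'; exact: hx.
    by move=> hx h h' hh hh'; exact: (hx h hh h' hh').
  apply: closed_bigI => h /andP[h0 _]; apply: closed_bigI => h' /andP[h'0 _].
  apply: preimage_closed; last exact: closed_le.
  by move=> x _; apply: cvg_norm; apply: cvgB; apply: cq; rewrite -normr_gt0.
pose C := \bigcap_k \bigcup_n S k n.
have mC : measurable (C : set (measurableTypeR R * measurableTypeR R)).
  by apply: bigcapT_measurable => k; apply: bigcupT_measurable => n; exact: mS.
have en (r : R) : 0 < r -> exists n, e n < r.
  move=> r0; have [N _ /(_ N (leqnn _))] := near_infty_natSinv_lt (PosNum r0).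
  by exists N.
have CP x : C x <-> cvg (q h x @[h --> 0^']).
  split => [Cx|/cvg_ex[l ql] k _].
    apply/cauchy_cvgP/cauchy_exP => r r0.
    have [k kr] := en _ r0.
    have [n _ hn] := Cx k I.
    exists (q (e n / 2) x).
    have hn2 : 0 < `|e n / 2| < e n.
      by rewrite gtr0_norm ?divr_gt0//=; have := e0 n; lra.
    apply/nbhs_ballP; exists (e n) => //= h; rewrite /ball/= sub0r normrN => hh h0.
    by rewrite /= (le_lt_trans _ kr)//; apply: hn => //; rewrite normr_gt0 h0.
  have ek : 0 < e k / 2 by rewrite divr_gt0.
  move/cvgrPdist_le : ql => /(_ _ ek)/nbhs_ballP[r /= r0 hr].
  have [n nr] := en _ r0.
  exists n => // h h' /andP[h0 hn] /andP[h'0 h'n].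
  have H t : 0 < `|t| -> `|t| < e n -> `|l - q t x| <= e k / 2.
    move=> t0 tn; apply: hr; rewrite ?sub0r ?normrN -?normr_gt0//=.
    by rewrite /ball/= sub0r normrN (lt_trans tn).
  have -> : q h x - q h' x = (l - q h' x) - (l - q h x) by ring.
  rewrite (le_trans (ler_normB _ _))// [leRHS]splitr.
  by apply: lerD; apply: H.
pose g x := fine (limn_esup (fun n => (q (e n) x)%:E)).
have mg : measurable_fun setT (g : measurableTypeR R * measurableTypeR R -> R).
  apply: (measurableT_comp (@fine_measurable R _ measurableT)).
  apply: measurable_fun_limn_esup => n; apply/measurable_EFinP.
  by apply: continuous_measurable_plane; apply: cq; rewrite gt_eqF.
pose p0 : R := point.
have -> : (fun x => lim (q h x @[h --> 0^'])) = (fun x => (g x - p0) * \1_C x + p0).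
  apply/funext => x; rewrite indicE; have [xC|xC] := boolP (x \in C).
    rewrite mulr1 subrK; have /CP cx := set_mem xC.
    suff : (q (e n) x)%:E @[n --> \oo] --> (lim (q h x @[h --> 0^']))%:E.
      by move=> /cvg_limn_einf_sup[_]; rewrite /g => ->.
    apply: cvg_EFin; first exact: nearW.
    have /cvgr_dnbhsP : q h x @[h --> 0^'] --> lim (q h x @[h --> 0^']) by exact: cx.
    apply; split; last exact: cvg_harmonic.
    by move=> n; rewrite gt_eqF.
  rewrite mulr0 add0r; apply: xgetPN => l ql.
  by move/negP: xC; apply; apply/mem_set/CP/cvg_ex; exists l.
apply: measurable_funD => //; apply: measurable_funM; first exact: measurable_funB.
exact: measurable_indic.
Qed.

End PlaneMeasurability.

Section FieldDivergence.
Context {R : realType}.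
Implicit Types (D : set (R * R)) (f : R * R -> R) (phi : R * R -> R * R).

Lemma lipschitz_components phi : lipschitz phi -> exists2 k : R, 0 < k &
  forall x y, `|(phi x).1 - (phi y).1| <= k * `|x - y| /\
              `|(phi x).2 - (phi y).2| <= k * `|x - y|.
Proof.
move=> /pinfty_ex_gt0[k k0 /= hk]; exists k => // x y.
have := hk (x, y) (conj I I); rewrite /= prod_normE/= ge_max => /andP[h1 h2].
by split; [exact: h1|exact: h2].
Qed.

Lemma lipschitz_continuous_plane f (k : R) :
  (forall x y, `|f x - f y| <= k * `|x - y|) -> continuous f.
Proof.
move=> fk x; apply/cvgrPdist_le => e e0.
have k1 : 0 < `|k| + 1 by rewrite ltr_pwDr.
have d0 : 0 < e / (`|k| + 1) by rewrite divr_gt0.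
have := @nbhsx_ballx _ (R * R)%type x _ d0; apply: filterS => y [/= xy1 xy2].
have xy : `|x - y| < e / (`|k| + 1) by rewrite prod_normE/= gt_max; apply/andP.
rewrite (le_trans (fk x y))//.
apply: (@le_trans _ _ ((`|k| + 1) * `|x - y|)).
  by rewrite ler_wpM2r// (le_trans (ler_norm k))// lerDl.
by rewrite -ler_pdivlMl// mulrC ltW.
Qed.

(** The summand with [point] pays for the default value of [lim] where the quotients have no
    limit. *)
Lemma lim_dnbhs0_bound (g : R -> R) (k : R) :
  (forall h, h != 0 -> `|g h| <= k) ->
  `|lim (g h @[h --> 0^'])| <= `|k| + `|point : R|.
Proof.
move=> gk; have [cg|ncg] := pselect (cvg (g h @[h --> 0^'])); last first.
  rewrite [lim _](_ : _ = point) ?lerDr//.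
  by apply: xgetPN => l gl; apply: ncg; apply/cvg_ex; exists l.
apply: (@le_trans _ _ k); last by rewrite (le_trans (ler_norm k))// lerDl.
rewrite ler_norml; apply/andP; split.
  apply: limr_ge => //; apply/nbhs_ballP; exists 1 => //= h _ h0.
  by have := gk _ h0; rewrite ler_norml => /andP[].
apply: limr_le => //; apply/nbhs_ballP; exists 1 => //= h _ h0.
by have := gk _ h0; rewrite ler_norml => /andP[].
Qed.

Lemma lipschitz_partials f (k : R) : (forall x y, `|f x - f y| <= k * `|x - y|) ->
  [/\ measurable_fun setT (partial1 f : measurableTypeR R * measurableTypeR R -> R),
      measurable_fun setT (partial2 f : measurableTypeR R * measurableTypeR R -> R) &
      forall x, `|partial1 f x| <= `|k| + `|point : R| /\
                `|partial2 f x| <= `|k| + `|point : R|].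
Proof.
move=> fk; have cf := lipschitz_continuous_plane fk.
have q0 (h : R) (x y : R * R) : h != 0 -> `|x - y| = `|h| ->
    `|h^-1 *: (f x - f y)| <= k.
  move=> h0 xy; rewrite normrZ normfV mulrC ler_pdivrMr ?normr_gt0//.
  by rewrite -xy fk.
have ct (a b : R) : continuous (fun x => f (a + x.1, b + x.2)).
  apply: (@lipschitz_continuous_plane _ k) => x y; rewrite (le_trans (fk _ _))//.
  rewrite !prod_normE/=.
  have E (c s t : R) : c + s - (c + t) = s - t by ring.
  by rewrite !E.
split.
- apply: (@measurable_lim_dnbhs0 _ (fun h x => h^-1 *: (f (h + x.1, x.2) - f (x.1, x.2)))).
  move=> h h0 x; apply: cvgZr; apply: cvgB.
    by have := ct h 0; under eq_fun do rewrite add0r; exact.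
  by have := ct 0 0; under eq_fun do rewrite !add0r; exact.
- apply: (@measurable_lim_dnbhs0 _ (fun h x => h^-1 *: (f (x.1, h + x.2) - f (x.1, x.2)))).
  move=> h h0 x; apply: cvgZr; apply: cvgB.
    by have := ct 0 h; under eq_fun do rewrite add0r; exact.
  by have := ct 0 0; under eq_fun do rewrite !add0r; exact.
- move=> x; split.
    apply: lim_dnbhs0_bound => h h0; apply: q0 => //.
    by rewrite prod_normE/= addrK subrr normr0; apply/max_idPl.
  apply: lim_dnbhs0_bound => h h0; apply: q0 => //.
  by rewrite prod_normE/= addrK subrr normr0; apply/max_idPr.
Qed.

Lemma Lipc_div2 D phi : Lipc D phi ->
  measurable_fun setT (div2 phi : measurableTypeR R * measurableTypeR R -> R) /\
  exists K : R, forall x, `|div2 phi x| <= K.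
Proof.
move=> [/lipschitz_components[k k0 hk] _].
have [m1 _ b1] := lipschitz_partials (fun x y => (hk x y).1).
have [_ m2 b2] := lipschitz_partials (fun x y => (hk x y).2).
split; first exact: measurable_funD.
exists ((`|k| + `|point : R|) + (`|k| + `|point : R|)) => x.
by rewrite (le_trans (ler_normD _ _))// lerD//; [case: (b1 x)|case: (b2 x)].
Qed.

(** Off the closure f vanishes on a whole ball, so all small difference quotients are 0. *)
Lemma partials_out f x : ~ closure [set x | f x != 0] x ->
  partial1 f x = 0 /\ partial2 f x = 0.
Proof.
move=> xK.
have oK : open (~` closure [set x | f x != 0]) by apply: closed_openC; exact: closed_closure.
have /nbhs_ballP[e /= e0 he] : nbhs x (~` closure [set x | f x != 0]).
  by apply: open_nbhs_nbhs.
have f0 y : ball x e y -> f y = 0.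
  move=> /he; apply: contra_notP => /eqP fy; exact: subset_closure.
have fx : f (x.1, x.2) = 0 by rewrite -surjective_pairing; apply: f0; exact: ballxx.
split; apply: cvg_lim => //; apply: cvg_near_cst; apply/nbhs_ballP;
  exists e => //= h; rewrite /ball/= sub0r normrN => hh _; rewrite fx subr0.
  rewrite f0 ?scaler0//; split; rewrite /ball/= ?subrr ?normr0//.
  by rewrite opprD addrCA subrr addr0 normrN.
rewrite f0 ?scaler0//; split; rewrite /ball/= ?subrr ?normr0//.
by rewrite opprD addrCA subrr addr0 normrN.
Qed.

Lemma continuous_compact_bound f (K : set (R * R)) : continuous f -> compact K ->
  (forall x, ~ K x -> f x = 0) -> exists M : R, forall x, `|f x| <= M.
Proof.
move=> cf cK f0.
have /compact_bounded/pinfty_ex_gt0[M M0 /= hM] : compact (f @` K).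
  by apply: continuous_compact => //; exact: continuous_subspaceT.
exists M => x; have [Kx|/f0->] := pselect (K x); last by rewrite normr0 ltW.
by apply: hM; exists x.
Qed.

Lemma C1c_div2 D phi : C1c D phi ->
  measurable_fun setT (div2 phi : measurableTypeR R * measurableTypeR R -> R) /\
  exists K : R, forall x, `|div2 phi x| <= K.
Proof.
move=> [[_ [c11 c12]] [_ [c21 c22]] [cK _]].
split; first by apply: measurable_funD; exact: continuous_measurable_plane.
have cd : continuous (div2 phi).
  by move=> x; apply: cvgD; [exact: c11|exact: c22].
apply: continuous_compact_bound cd cK _ => x xK.
have out g : (forall y, phi y = 0 -> g y = 0) ->
    partial1 g x = 0 /\ partial2 g x = 0.
  move=> gphi; apply: partials_out => /closureS H; apply: xK; apply: H.
  by move=> y /=; apply: contra_neq => /gphi.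
rewrite /div2 (out (fun y => (phi y).1) _).1 ?(out (fun y => (phi y).2) _).2 ?addr0//.
  by move=> y ->.
by move=> y ->.
Qed.

End FieldDivergence.

(** * An explicit C1 kernel and its bumps *)

Section SplineKernel.
Context {R : realType}.
Implicit Types (r s t x y c : R).

(** A remainder estimate treats the knot of a truncated power like any other point, by cases on the
    signs of t and t + h, without one-sided limits. *)
Lemma is_derive_quadratic_remainder (f : R -> R) (t d C : R) :
  (forall h, `|h| < 1 -> `|f (t + h) - f t - d * h| <= C * h ^+ 2) ->
  is_derive t 1 f d.
Proof.
move=> H.
suff cv : (fun h => h^-1 *: ((f \o shift t) (h *: 1) - f t)) @ 0^' --> d.
  by apply: DeriveDef; [apply/cvg_ex; exists d|exact: cvg_lim].
apply/cvgrPdist_le => e e0.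
have C1 : 0 < `|C| + 1 by rewrite ltr_pwDr.
have d0 : 0 < Num.min 1 (e / (`|C| + 1)) by rewrite lt_min ltr01 divr_gt0.
apply/nbhs_ballP; exists (Num.min 1 (e / (`|C| + 1))) => //= h.
rewrite /ball/= sub0r normrN lt_min => /andP[h1 he] h0.
have := H h h1; rewrite scaler1 (addrC h) => Hh.
rewrite -(ler_pM2r (x := `|h|)) ?normr_gt0// -normrM.
have -> : (d - h^-1 *: (f (t + h) - f t)) * h = - (f (t + h) - f t - d * h).
  by rewrite /GRing.scale/= mulrBl mulrAC mulVf// mul1r; ring.
rewrite normrN (le_trans Hh)// -(real_normK (num_real h)) expr2 mulrA ler_wpM2r//.
have := ltW he; rewrite ler_pdivlMr// mulrC; apply: le_trans.
by rewrite ler_wpM2r// (le_trans (ler_norm C))// lerDl.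
Qed.

Definition pos_part t := Num.max t 0.

Lemma is_derive_pos_part_sqr t : is_derive t 1 (fun s => pos_part s ^+ 2) (2 * pos_part t).
Proof.
apply: (@is_derive_quadratic_remainder _ _ _ 1) => h _.
rewrite /pos_part ler_norml mul1r.
by case: (leP t 0) => t0; case: (leP (t + h) 0) => th; apply/andP; split; nra.
Qed.

Lemma is_derive_pos_part_cube t : is_derive t 1 (fun s => pos_part s ^+ 3) (3 * pos_part t ^+ 2).
Proof.
(* For t and t + h positive the remainder is exactly (3 t + h) h^2; |h| < 1 then turns 3 |t| + |h|
   into a constant. *)
apply: (@is_derive_quadratic_remainder _ _ _ (3 * `|t| + 1)) => h h1.
have h2 : 0 <= h ^+ 2 by exact: sqr_ge0.
apply: (@le_trans _ _ ((3 * `|t| + `|h|) * h ^+ 2)); last first.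
  by rewrite ler_wpM2r// lerD2l ltW.
rewrite /pos_part; case: (leP t 0) => t0; case: (leP (t + h) 0) => th.
- by rewrite !expr0n/= subr0 mulr0 mul0r subr0 normr0 mulr_ge0// addr_ge0// mulr_ge0.
- have h0 : 0 < h by lra.
  rewrite !expr0n/= subr0 mulr0 mul0r subr0 (gtr0_norm h0) ger0_norm; last by rewrite exprn_ge0// ltW.
  rewrite (ler0_norm t0).
  have : (t + h) ^+ 3 <= h ^+ 3 by rewrite ler_pXn2r ?nnegrE//; lra.
  move=> /le_trans; apply.
  by rewrite exprS ler_wpM2r//; lra.
- have h0 : h < 0 by lra.
  rewrite (gtr0_norm t0) (ltr0_norm h0) expr0n/= sub0r.
  have -> : - t ^+ 3 - 3 * t ^+ 2 * h = t ^+ 2 * (3 * (- h) - t) by ring.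
  have a : 0 <= 3 * - h - t by lra.
  rewrite ger0_norm; last exact: mulr_ge0 (sqr_ge0 _) a.
  have -> : h ^+ 2 = (- h) ^+ 2 by ring.
  have : t <= - h by lra.
  move: (- h) a => k a tk.
  have k0 : 0 < k by lra.
  have H1 : 0 <= t * k * (k - t) by rewrite !mulr_ge0 ?subr_ge0// ltW.
  have H2 : 0 <= t ^+ 2 * t by rewrite mulr_ge0 ?sqr_ge0// ltW.
  have H3 : 0 <= k * k ^+ 2 by rewrite mulr_ge0 ?sqr_ge0// ltW.
  lra.
- rewrite (gtr0_norm t0).
  have -> : (t + h) ^+ 3 - t ^+ 3 - 3 * t ^+ 2 * h = (3 * t + h) * h ^+ 2 by ring.
  rewrite normrM (ger0_norm h2) ler_wpM2r// (le_trans (ler_normD _ _))//.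
  by rewrite lerD2r gtr0_norm ?mulr_gt0.
Qed.

(* The quadratic B-spline with knots 0, 1, 2, 3. *)
Definition spline t := 2^-1 * (pos_part t ^+ 2 - 3 * pos_part (t - 1) ^+ 2
  + 3 * pos_part (t - 2) ^+ 2 - pos_part (t - 3) ^+ 2).

(** The third difference of t^3 is 6, so dividing by 6 gives the spline integral 1. Degree two makes
    the kernel C1, hence also what is mollified with it, while the primitive stays explicit and the
    bounds reduce to polynomial arithmetic. *)
Definition spline_primitive t := 6^-1 * (pos_part t ^+ 3 - 3 * pos_part (t - 1) ^+ 3
  + 3 * pos_part (t - 2) ^+ 3 - pos_part (t - 3) ^+ 3).

Definition spline_derivative t := pos_part t - 3 * pos_part (t - 1)
  + 3 * pos_part (t - 2) - pos_part (t - 3).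

Lemma is_derive_shift (f : R -> R) t c d : is_derive (t - c) 1 f d ->
  is_derive t 1 (fun s => f (s - c)) d.
Proof.
move=> fd; rewrite -[d]mulr1.
apply: (@is_derive1_comp _ f (fun s => s - c)) => //.
by rewrite -[X in is_derive _ _ _ X]subr0; apply: is_deriveB.
Qed.

Lemma is_derive_spline_sum (f : R -> R) (k t : R) (f' : R -> R) :
  (forall s, is_derive s 1 f (f' s)) ->
  is_derive t 1 (fun t => k * (f t - 3 * f (t - 1) + 3 * f (t - 2) - f (t - 3)))
    (k * (f' t - 3 * f' (t - 1) + 3 * f' (t - 2) - f' (t - 3))).
Proof.
move=> df; have d c : is_derive t 1 (fun s => f (s - c)) (f' (t - c)).
  exact: is_derive_shift.
have dZ (a : R) (g : R -> R) g' : is_derive t 1 g g' -> is_derive t 1 (fun s => a * g s) (a * g').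
  by move=> dg; exact: (@is_deriveZ _ _ _ g a t 1 g').
apply: dZ.
Qed.

Lemma is_derive_spline t : is_derive t 1 spline (spline_derivative t).
Proof.
have := @is_derive_spline_sum _ 2^-1 t _ is_derive_pos_part_sqr.
by move=> /is_derive_eq; apply; rewrite /spline_derivative; field.
Qed.

Lemma is_derive_spline_primitive t : is_derive t 1 spline_primitive (spline t).
Proof.
have := @is_derive_spline_sum _ 6^-1 t _ is_derive_pos_part_cube.
by move=> /is_derive_eq; apply; rewrite /spline; field.
Qed.

Lemma spline_ge0 t : 0 <= spline t.
Proof.
rewrite /spline /pos_part mulr_ge0//.
case: (leP t 0) => h0; case: (leP (t - 1) 0) => h1; case: (leP (t - 2) 0) => h2;
  case: (leP (t - 3) 0) => h3; nra.
Qed.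

Lemma spline_le1 t : spline t <= 1.
Proof.
rewrite /spline /pos_part.
case: (leP t 0) => h0; case: (leP (t - 1) 0) => h1; case: (leP (t - 2) 0) => h2;
  case: (leP (t - 3) 0) => h3; nra.
Qed.

Lemma spline_out t : t <= 0 \/ 3 <= t -> spline t = 0.
Proof.
by rewrite /spline /pos_part => -[] ht;
case: (leP t 0) => h0; case: (leP (t - 1) 0) => h1; case: (leP (t - 2) 0) => h2;
  case: (leP (t - 3) 0) => h3; nra.
Qed.

Lemma spline_primitive0 t : t <= 0 -> spline_primitive t = 0.
Proof.
rewrite /spline_primitive /pos_part => ht.
case: (leP t 0) => h0; case: (leP (t - 1) 0) => h1; case: (leP (t - 2) 0) => h2;
  case: (leP (t - 3) 0) => h3; rewrite ?expr0n/=; try lra.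
Qed.

Lemma spline_primitive1 t : 3 <= t -> spline_primitive t = 1.
Proof.
move=> ht; have E c : c <= 3 -> pos_part (t - c) = t - c.
  by move=> c3; rewrite /pos_part max_l//; lra.
have := E 0; rewrite subr0 => E0.
by rewrite /spline_primitive E0 ?E //; try lra; field.
Qed.

Lemma spline_derivative_bound t : `|spline_derivative t| <= 3.
Proof.
rewrite /spline_derivative /pos_part ler_norml.
case: (leP t 0) => h0; case: (leP (t - 1) 0) => h1; case: (leP (t - 2) 0) => h2;
  case: (leP (t - 3) 0) => h3; lra.
Qed.

Lemma continuous_pos_part : continuous pos_part.
Proof. by move=> t; rewrite /pos_part; apply: (@continuous_max _ _ id (cst 0)); [exact: cvg_id|exact: cvg_cst]. Qed.

Lemma continuous_spline_derivative : continuous spline_derivative.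
Proof.
have ct c : continuous (fun t => pos_part (t - c)).
  move=> t; apply: continuous_cvg; first exact: continuous_pos_part.
  by apply: cvgB; [exact: cvg_id|exact: cvg_cst].
move=> t; apply: cvgB; last exact: ct.
apply: cvgD; last by apply: cvgM; [exact: cvg_cst|exact: ct].
apply: cvgB; last by apply: cvgM; [exact: cvg_cst|exact: ct].
exact: continuous_pos_part.
Qed.

End SplineKernel.

Section Bumps.
Context {R : realType}.
Implicit Types (r s t x y c a b : R) (f k : R -> R).
Local Notation mu := (@lebesgue_measure R).

Definition bump c r t := r^-1 * spline ((t - c) / r).

Definition bump_primitive c r t := spline_primitive ((t - c) / r).

Lemma continuous_spline : continuous (@spline R).
Proof.
move=> t; apply: differentiable_continuous; apply/derivable1_diffP.
by have [] := is_derive_spline t.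
Qed.

Lemma is_derive_affine f (a c t d : R) : is_derive ((t - c) / a) 1 f d ->
  is_derive t 1 (fun s => f ((s - c) / a)) (a^-1 * d).
Proof.
move=> fd; rewrite mulrC.
apply: (@is_derive1_comp _ f (fun s => (s - c) / a)).
have -> : (fun s => (s - c) / a) = a^-1 \*: (fun s : R => s - c).
  by apply/funext => s; rewrite /= /GRing.scale/= mulrC.
rewrite -[X in is_derive _ _ _ X]mulr1.
apply: is_deriveZ; rewrite -[X in is_derive _ _ _ X]subr0.
exact: is_deriveB.
Qed.

Lemma is_derive_bump_primitive c r t : is_derive t 1 (bump_primitive c r) (bump c r t).
Proof. by apply: is_derive_affine; exact: is_derive_spline_primitive. Qed.

Lemma is_derive_bump c r t :
  is_derive t 1 (bump c r) (r^-1 * (r^-1 * spline_derivative ((t - c) / r))).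
Proof.
apply: (@is_deriveZ _ _ _ (fun t => spline ((t - c) / r)) r^-1).
by apply: is_derive_affine; exact: is_derive_spline.
Qed.

Lemma continuous_affine f (a c : R) : continuous f -> continuous (fun t => f ((t - c) / a)).
Proof.
move=> cf t; apply: (@continuous_comp _ _ _ (fun s => (s - c) / a) f); last exact: cf.
by apply: cvgM; [apply: cvgB; [exact: cvg_id|exact: cvg_cst]|exact: cvg_cst].
Qed.

Lemma continuous_affine_rev f (a y : R) : continuous f -> continuous (fun t => f ((y - t) / a)).
Proof.
move=> cf t; apply: (@continuous_comp _ _ _ (fun s => (y - s) / a) f); last exact: cf.
by apply: cvgM; [apply: cvgB; [exact: cvg_cst|exact: cvg_id]|exact: cvg_cst].
Qed.

Lemma continuous_bump c r : continuous (bump c r).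
Proof.
move=> t; apply: cvgM; first exact: cvg_cst.
exact: (continuous_affine continuous_spline).
Qed.

Lemma continuous_bump_center r y : continuous (fun t => bump t r y).
Proof.
move=> t; apply: cvgM; first exact: cvg_cst.
exact: (continuous_affine_rev continuous_spline).
Qed.

Lemma bump_ge0 c r t : 0 < r -> 0 <= bump c r t.
Proof. by move=> r0; rewrite mulr_ge0 ?spline_ge0// invr_ge0 ltW. Qed.

Lemma bump_le c r t : 0 < r -> bump c r t <= r^-1.
Proof. by move=> r0; rewrite ger_pMr ?invr_gt0// spline_le1. Qed.

Lemma bump_out c r t : 0 < r -> t <= c \/ c + 3 * r <= t -> bump c r t = 0.
Proof.
move=> r0 h; rewrite /bump spline_out ?mulr0//.
case: h => h; [left|right].
  by rewrite pmulr_lle0 ?invr_gt0// subr_le0.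
by rewrite ler_pdivlMr// lerBrDl.
Qed.

Lemma bump_primitive0 c r t : 0 < r -> t <= c -> bump_primitive c r t = 0.
Proof.
by move=> r0 h; rewrite /bump_primitive spline_primitive0// pmulr_lle0 ?invr_gt0// subr_le0.
Qed.

Lemma bump_primitive1 c r t : 0 < r -> c + 3 * r <= t -> bump_primitive c r t = 1.
Proof.
by move=> r0 h; rewrite /bump_primitive spline_primitive1// ler_pdivlMr// lerBrDl.
Qed.

(** The primitive of a nonnegative kernel is monotone and runs from 0 to 1. This makes differences
    of two such primitives admissible as components of fields of length at most 1. *)
Lemma bump_primitive_itv c r t : 0 < r -> 0 <= bump_primitive c r t <= 1.
Proof.
move=> r0.
have cF : continuous (bump_primitive c r).
  move=> s; apply: differentiable_continuous; apply/derivable1_diffP.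
  by have [] := is_derive_bump_primitive c r s.
have nd x y : x <= y -> bump_primitive c r x <= bump_primitive c r y.
  move=> xy.
  have h1 s : s \in `]x, y[%R -> derivable (bump_primitive c r) s 1.
    by move=> _; have [] := is_derive_bump_primitive c r s.
  have h2 s : s \in `]x, y[%R -> 0 <= (bump_primitive c r)^`()%classic s.
    by move=> _; rewrite derive1E; have [_ ->] := is_derive_bump_primitive c r s; exact: bump_ge0.
  have h3 : {within `[x, y], continuous (bump_primitive c r)} by exact: continuous_subspaceT.
  have hx : x \in `[x, y]%R by rewrite in_itv/= lexx.
  have hy : y \in `[x, y]%R by rewrite in_itv/= lexx andbT.
  exact: (ger0_derive1_le_cc h1 h2 h3 hx hy xy).
apply/andP; split.
  have [tc|ct] := leP t c; first by rewrite bump_primitive0.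
  by rewrite -(@bump_primitive0 c r c)// nd// ltW.
have [tc|ct] := leP t (c + 3 * r); last by rewrite bump_primitive1// ltW.
by rewrite -(@bump_primitive1 c r (c + 3 * r))// nd.
Qed.

Lemma integrable_compact_support f a b : continuous f ->
  (forall t, t < a \/ b < t -> f t = 0) -> mu.-integrable setT (EFin \o f).
Proof.
move=> cf f0.
have h : mu.-integrable `[a, b] (EFin \o f).
  apply: continuous_compact_integrable; first exact: segment_compact.
  exact: continuous_subspaceT.
have -> : EFin \o f = (EFin \o f) \_ `[a, b].
  apply/funext => t; rewrite /patch; case: ifPn => // /negP ht.
  rewrite /= f0//; case: (ltP t a) => [|ta]; first by left.
  case: (ltP b t) => [|tb]; first by right.
  by exfalso; apply: ht; rewrite inE/= in_itv/= ta tb.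
by rewrite -integrable_mkcond.
Qed.

Lemma integral_compact_support (f F : R -> R) a b : a < b -> continuous f ->
  (forall t, is_derive t 1 F (f t)) ->
  (forall t, t < a \/ b < t -> f t = 0) -> \int[mu]_t f t = F b - F a.
Proof.
move=> ab cf dF f0.
have cF : continuous F.
  move=> t; apply: differentiable_continuous; apply/derivable1_diffP.
  by have [] := dF t.
rewrite (_ : f = f \_ `[a, b]); last first.
  apply/funext => t; rewrite /patch; case: ifPn => // /negP ht.
  rewrite f0//; case: (ltP t a) => [|ta]; first by left.
  case: (ltP b t) => [|tb]; first by right.
  by exfalso; apply: ht; rewrite inE/= in_itv/= ta tb.
rewrite -Rintegral_mkcond /Rintegral (@continuous_FTC2 _ f F)//.
- exact: continuous_subspaceT.
- split.
  + by move=> t _; have [] := dF t.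
  + by apply: cvg_at_right_filter; exact: cF.
  + by apply: cvg_at_left_filter; exact: cF.
- by move=> t _; rewrite derive1E; have [_ ] := dF t.
Qed.

Lemma integrable_bump c r : 0 < r -> mu.-integrable setT (EFin \o bump c r).
Proof.
move=> r0; apply: (@integrable_compact_support _ c (c + 3 * r)).
  exact: continuous_bump.
by move=> t [h|h]; apply: bump_out => //; [left|right]; exact: ltW.
Qed.

Lemma integral_bump c r : 0 < r -> \int[mu]_t bump c r t = 1.
Proof.
move=> r0.
have ab : c < c + 3 * r by rewrite ltrDl mulr_gt0.
have out t : t < c \/ c + 3 * r < t -> bump c r t = 0.
  by move=> [h|h]; apply: bump_out => //; [left|right]; exact: ltW.
rewrite (integral_compact_support ab (@continuous_bump c r) (is_derive_bump_primitive c r) out).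
by rewrite bump_primitive1// bump_primitive0// subr0.
Qed.

Lemma bump_center_out r y t : 0 < r -> t < y - 3 * r \/ y < t -> bump t r y = 0.
Proof. by move=> r0 [h|h]; apply: bump_out => //; [right|left]; lra. Qed.

Lemma integrable_bump_center r y : 0 < r ->
  mu.-integrable setT (EFin \o (fun t => bump t r y)).
Proof.
move=> r0; apply: (@integrable_compact_support _ (y - 3 * r) y).
  exact: continuous_bump_center.
by move=> t ?; exact: bump_center_out.
Qed.

Lemma integral_bump_center r y : 0 < r -> \int[mu]_t bump t r y = 1.
Proof.
move=> r0.
have ab : y - 3 * r < y by rewrite ltrBlDr ltrDl mulr_gt0.
(* With the left end t of the bump as variable, (y - t) / r is (t - y) / (-r): an affine change of
   scale -r, whence the sign. *)
have dF t : is_derive t 1 (fun t => - bump_primitive t r y) (bump t r y).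
  have -> : (fun t => - bump_primitive t r y) = \- (fun t => spline_primitive ((t - y) / (- r))).
    apply/funext => s /=; congr (- spline_primitive _).
    by rewrite invrN mulrN -mulNr opprB.
  rewrite -[bump t r y]opprK; apply: is_deriveN.
  rewrite -mulNr -invrN (_ : (y - t) / r = (t - y) / (- r)).
    by apply: is_derive_affine; exact: is_derive_spline_primitive.
  by rewrite invrN mulrN -mulNr opprB.
rewrite (integral_compact_support ab (@continuous_bump_center r y) dF); last first.
  by move=> t; exact: bump_center_out.
by rewrite bump_primitive0// bump_primitive1 ?subrK// oppr0 add0r opprK.
Qed.

End Bumps.

Lemma integrable_bounded_mul (R : realType) d (T : measurableType d) (nu : {measure set T -> \bar R})
    (f k : T -> R) (C : R) : nu.-integrable setT (EFin \o f) ->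
  measurable_fun setT k -> (forall z, `|k z| <= C) ->
  nu.-integrable setT (EFin \o (fun z => f z * k z)).
Proof.
move=> jf mk kC.
have mf : measurable_fun setT f by apply/measurable_EFinP; exact: measurable_int jf.
apply: (@dominated_integrable_fin _ _ _ _ _ _ _ (fun z => C * `|f z|)) => //.
- exact: measurable_funM.
- by move=> z _; rewrite normrM mulrC ler_wpM2r.
- apply: integrableZf => //; have := integrable_abse jf.
  exact: eq_integrable.
Qed.

(** * Kernels at Lebesgue points and mollification *)

Section LebesguePointKernels.
Context {R : realType}.
Implicit Types (r s t x y c a b : R) (f k : R -> R).
Local Notation mu := (@lebesgue_measure R).

(** A kernel below C / de that lives on the ball of radius de is dominated by 2 C times the average
    over that ball, whose length is 2 de. Symmetry and a fixed shape are not asked for, so one-sided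
    bumps with moving ends are covered. *)
Lemma kernel_lebesgue_bound f k (x de C : R) : mu.-integrable setT (EFin \o f) ->
  measurable_fun setT k -> 0 < de -> (forall t, 0 <= k t <= C / de) ->
  (forall t, ~ ball x de t -> k t = 0) ->
  mu.-integrable setT (EFin \o k) -> \int[mu]_t k t = 1 ->
  (`|\int[mu]_t (f t * k t) - f x|%:E <= (2 * C)%:E * davg f x de)%E.
Proof.
move=> jf mk de0 kb kout jk k1.
have kC t : `|k t| <= C / de by rewrite ger0_norm; case/andP: (kb t).
have jfk := integrable_bounded_mul jf mk kC.
have mf : measurable_fun setT f by apply/measurable_EFinP; exact: measurable_int jf.
have jxk := integrableZf measurableT (f x) jk.
have -> : \int[mu]_t (f t * k t) - f x = \int[mu]_t ((f t - f x) * k t).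
  rewrite -[X in _ - X]mulr1 -k1 -RintegralZl// -RintegralB//.
  by apply: eq_Rintegral => t _; rewrite mulrBl.
have jd : mu.-integrable setT (EFin \o (fun t => (f t - f x) * k t)).
  have := integrableB measurableT jfk jxk.
  by apply: eq_integrable => // t _ /=; rewrite -EFinB mulrBl.
rewrite EFin_normr_Rintegral//.
have mfx : measurable_fun setT (fun t => `|f t - f x|).
  by apply: measurableT_comp => //; exact: measurable_funB.
apply: (le_trans (le_abse_integral _ _ _)) => //.
  by case/integrableP: jd.
apply: (@le_trans _ _ (\int[mu]_(t in ball x de) ((C / de) * `|f t - f x|)%:E)%E).
  rewrite [leRHS]integral_mkcond; apply: ge0_le_integral => //.
  - by apply: measurableT_comp => //; case/integrableP: jd.
  - apply/(measurable_restrictT _ _).1; first exact: measurable_ball.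
    apply/measurable_EFinP/measurable_funTS; exact: measurable_funM.
  - move=> t _; rewrite patchE; case: ifPn => [tb|/negP tb].
      by rewrite /= lee_fin normrM mulrC ler_wpM2r.
    by rewrite kout ?mulr0 ?abse0// => h; apply: tb; exact/mem_set.
have C0 : 0 <= C / de by case/andP: (kb x) => /le_trans; exact.
under eq_integral do rewrite EFinM.
have mb : measurable_fun (ball x de) (fun t => (`|f t - f x|)%:E).
  by apply/measurable_EFinP/measurable_funTS.
have -> : (\int[mu]_(t in ball x de) ((C / de)%:E * `|f t - f x|%:E) =
    (C / de)%:E * \int[mu]_(t in ball x de) `|f t - f x|%:E)%E.
  by apply: ge0_integralZl => //; exact: measurable_ball.
rewrite /davg /iavg (lebesgue_measure_ball _ (ltW de0)) muleA.
rewrite inver mulrn_eq0/= gt_eqF// -EFinM.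
rewrite (_ : 2 * C * (de *+ 2)^-1 = C / de)//.
rewrite -mulr_natl; field; exact: lt0r_neq0.
Qed.

Lemma kernel_cvg f (k : nat -> R -> R) (x C : R) (de : nat -> R) :
  lebesgue_pt f x -> mu.-integrable setT (EFin \o f) ->
  (forall n, measurable_fun setT (k n)) -> (forall n, 0 < de n) ->
  de @ \oo --> (0 : R) -> (forall n t, 0 <= k n t <= C / de n) ->
  (forall n t, ~ ball x (de n) t -> k n t = 0) ->
  (forall n, mu.-integrable setT (EFin \o k n)) -> (forall n, \int[mu]_t k n t = 1) ->
  \int[mu]_t (f t * k n t) @[n --> \oo] --> f x.
Proof.
move=> Lx jf mk de0 cde kb kout jk k1.
have H n := kernel_lebesgue_bound jf (mk n) (de0 n) (kb n) (kout n) (jk n) (k1 n).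
have cd : ((2 * C)%:E * davg f x (de n))%E @[n --> \oo] --> 0%E.
  rewrite -[X in _ --> X](mule0 (2 * C)%:E); apply: cvgeZl => //.
  have cr : de @ \oo --> (0 : R)^'+.
    move=> A /= [e /= e0 hA]; move/cvgrPdist_lt : cde => /(_ e e0).
    by apply: filterS => n hn; exact: hA.
  exact: (cvg_comp _ _ cr Lx).
have ca : (`|\int[mu]_t (f t * k n t) - f x|%:E) @[n --> \oo] --> 0%E.
  apply: (@squeeze_cvge _ _ _ _ (fun=> 0%E) _ (fun n => (2 * C)%:E * davg f x (de n))%E) => //.
  - by apply: nearW => n; rewrite lee_fin normr_ge0 H.
  - exact: cvg_cst.
have /fine_cvg := ca => /=.
move/norm_cvg0 => c0.
rewrite (_ : (fun n => _) = (fun n => f x + (\int[mu]_t (f t * k n t) - f x))).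
  by rewrite -[X in _ --> X]addr0; apply: cvgD; [exact: cvg_cst|exact: c0].
by apply/funext => n; rewrite addrC subrK.
Qed.

End LebesguePointKernels.

Section Mollification.
Context {R : realType}.
Implicit Types (r t x y a b : R) (s f : R -> R).
Local Notation mu := (@lebesgue_measure R).

(** Integration is over the left end of the bump, so mollifying spreads a support by 3 r to the
    right and not at all to the left. *)
Definition mollify s r y := \int[mu]_t (s t * bump t r y).

Lemma integrable_mollify s r y : 0 < r -> mu.-integrable setT (EFin \o s) ->
  mu.-integrable setT (EFin \o (fun t => s t * bump t r y)).
Proof.
move=> r0 js; apply: (@integrable_bounded_mul _ _ _ _ _ _ r^-1) => //.
  by apply: continuous_measurable_fun; exact: continuous_bump_center.
by move=> t; rewrite ger0_norm ?bump_ge0// bump_le.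
Qed.

Let dbump r t y := r^-1 * (r^-1 * spline_derivative ((y - t) / r)).

Let dbump_bound r t y : 0 < r -> `|dbump r t y| <= r^-1 * (r^-1 * 3).
Proof.
move=> r0; have ri : 0 < r^-1 by rewrite invr_gt0.
by rewrite !normrM (gtr0_norm ri) !ler_pM2l// spline_derivative_bound.
Qed.

Let derive_mollify_integrand s r t y : 0 < r ->
  is_derive y 1 (fun y => s t * bump t r y) (s t * dbump r t y).
Proof.
by move=> r0; apply: (@is_deriveZ _ _ _ (bump t r) (s t)); exact: is_derive_bump.
Qed.

Let integrable_dbump s r y : 0 < r -> mu.-integrable setT (EFin \o s) ->
  mu.-integrable setT (EFin \o (fun t => s t * dbump r t y)).
Proof.
move=> r0 js; apply: (@integrable_bounded_mul _ _ _ _ _ _ (r^-1 * (r^-1 * 3))) => //.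
  apply: measurable_funM => //; apply: measurable_funM => //.
  by apply: continuous_measurable_fun; apply: continuous_affine_rev; exact: continuous_spline_derivative.
by move=> t; exact: dbump_bound.
Qed.

Let G s r t := (r^-1 * (r^-1 * 3)) * `|s t|.

Let integrable_G s r : mu.-integrable setT (EFin \o s) ->
  mu.-integrable setT (EFin \o G s r).
Proof.
move=> js; apply: integrableZf => //.
by have := integrable_abse js; exact: eq_integrable.
Qed.

Lemma mollify_derivable s r y : 0 < r -> mu.-integrable setT (EFin \o s) ->
  derivable (mollify s r) y 1.
Proof.
move=> r0 js.
have yI : `]y - 1, y + 1[%classic y by rewrite /= in_itv/=; lra.
apply: (@derivable_under_integral _ _ _ mu (fun y t => s t * bump t r y) setT measurableT
  y (y - 1) (y + 1) yI _ _ (G s r)).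
- by move=> x _; exact: integrable_mollify.
- by move=> x t _ _; have [] := derive_mollify_integrand s t x r0.
- by move=> t; rewrite mulr_ge0// !mulr_ge0// invr_ge0 ltW.
- exact: integrable_G.
- move=> x t _ _; rewrite partial1of2E; have [_ ->] := derive_mollify_integrand s t x r0.
  by rewrite normrM mulrC ler_wpM2r// dbump_bound.
Qed.

Lemma mollify_derive1 s r y : 0 < r -> mu.-integrable setT (EFin \o s) ->
  (mollify s r)^`()%classic y = \int[mu]_t (s t * dbump r t y).
Proof.
move=> r0 js.
have yI : `]y - 1, y + 1[%classic y by rewrite /= in_itv/=; lra.
rewrite (@differentiation_under_integral _ _ _ mu (fun y t => s t * bump t r y) setT measurableT
  y (y - 1) (y + 1) yI _ _ (G s r)).
- apply: eq_Rintegral => t _; rewrite partial1of2E.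
  by have [_ ->] := derive_mollify_integrand s t y r0.
- by move=> x _; exact: integrable_mollify.
- by move=> x t _ _; have [] := derive_mollify_integrand s t x r0.
- by move=> t; rewrite mulr_ge0// !mulr_ge0// invr_ge0 ltW.
- exact: integrable_G.
- move=> x t _ _; rewrite partial1of2E; have [_ ->] := derive_mollify_integrand s t x r0.
  by rewrite normrM mulrC ler_wpM2r// dbump_bound.
Qed.

Lemma mollify_derive1_continuous s r : 0 < r -> mu.-integrable setT (EFin \o s) ->
  continuous (mollify s r)^`()%classic.
Proof.
move=> r0 js y.
rewrite (_ : (mollify s r)^`()%classic = (fun y => \int[mu]_t (s t * dbump r t y))); last first.
  by apply/funext => x; exact: mollify_derive1.
apply: (@continuity_under_integral _ _ _ mu (fun y t => s t * dbump r t y) setT measurableT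
  (y - 1) (y + 1) _ _ (G s r)).
- by move=> x _; exact: integrable_dbump.
- apply: aeW => t _ x _; apply: cvgM; first exact: cvg_cst.
  apply: cvgM; first exact: cvg_cst.
  apply: cvgM; first exact: cvg_cst.
  exact: (continuous_affine (@continuous_spline_derivative R)).
- exact: integrable_G.
- move=> x _; apply: aeW => t _.
  by rewrite normrM mulrC ler_wpM2r// dbump_bound.
- by rewrite inE/= in_itv/=; lra.
Qed.

Lemma mollify_out s r a b y : 0 < r -> (forall t, t < a \/ b < t -> s t = 0) ->
  y < a \/ b + 3 * r < y -> mollify s r y = 0.
Proof.
move=> r0 sout hy; rewrite /mollify.
rewrite (@eq_Rintegral _ _ _ mu setT (fun=> 0)); first by rewrite Rintegral_cst// mul0r.
move=> t _; have [ta|ta] := ltP t a; first by rewrite sout ?mul0r//; left.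
have [bt|bt] := ltP b t; first by rewrite sout ?mul0r//; right.
rewrite bump_center_out ?mulr0//.
by case: hy => hy; [right|left]; lra.
Qed.

(** The bump has integral 1 in its left end, so averaging respects the joint constraint on all k at
    once. This keeps a mollified selection of coefficients admissible. *)
Lemma mollify_sum_le1 (N : nat) (s : nat -> R -> R) r y : 0 < r ->
  (forall k, mu.-integrable setT (EFin \o s k)) ->
  (forall t, \sum_(k < N) `|s k t| <= 1) ->
  \sum_(k < N) `|mollify (s k) r y| <= 1.
Proof.
move=> r0 js s1.
have jb k : mu.-integrable setT (EFin \o (fun t => `|s k t| * bump t r y)).
  by apply: integrable_mollify => //; have := integrable_abse (js k); exact: eq_integrable.
have H : forall M : nat, mu.-integrable setT (EFin \o (fun t => (\sum_(k < M) `|s k t|) * bump t r y)) /\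
   \sum_(k < M) `|mollify (s k) r y| <= \int[mu]_t ((\sum_(k < M) `|s k t|) * bump t r y).
  elim => [|M [IH1 IH2]].
    split.
      have := integrableZf measurableT 0 (js 0%N).
      by apply: eq_integrable => // t _ /=; rewrite big_ord0 !mul0r.
    by rewrite big_ord0; apply: Rintegral_ge0 => t _; rewrite big_ord0 mul0r.
  have e t : (\sum_(k < M.+1) `|s k t|) * bump t r y = (\sum_(k < M) `|s k t|) * bump t r y + `|s M t| * bump t r y.
    by rewrite big_ord_recr/= mulrDl.
  split.
    by have := integrableDf measurableT IH1 (jb M); apply: eq_integrable => // t _ /=; rewrite e.
  under eq_Rintegral do rewrite e.
  rewrite RintegralD//.
  rewrite big_ord_recr/=; apply: lerD => //.
  apply: (le_trans (le_normr_Rintegral _ _)) => //; first exact: integrable_mollify.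
  apply: le_Rintegral => //.
    by have := integrable_abse (integrable_mollify y r0 (js M)); exact: eq_integrable.
  by move=> t _; rewrite normrM (ger0_norm (bump_ge0 _ _ r0)).
apply: (le_trans (H N).2).
rewrite -(integral_bump_center y r0); apply: le_Rintegral => //.
- exact: (H N).1.
- exact: integrable_bump_center.
- by move=> t _; rewrite ler_piMl ?bump_ge0.
Qed.

Lemma mollify_cvg s (r : nat -> R) y : lebesgue_pt s y ->
  mu.-integrable setT (EFin \o s) -> (forall n, 0 < r n) -> r @ \oo --> (0 : R) ->
  mollify s (r n) y @[n --> \oo] --> s y.
Proof.
move=> Ls js r0 cr.
apply: (@kernel_cvg _ _ _ _ 4 (fun n => 4 * r n)) => //.
- by move=> n; apply: continuous_measurable_fun; exact: continuous_bump_center.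
- by move=> n; rewrite mulr_gt0.
- by rewrite -[X in _ --> X](mulr0 4); apply: cvgM; [exact: cvg_cst|exact: cr].
- move=> n t; rewrite bump_ge0//= (le_trans (bump_le _ _ _))//.
  by rewrite invfM mulrA divff// mul1r.
- move=> n t; rewrite /ball/= => h; apply: bump_center_out => //.
  have [|h1] := ltP t (y - 3 * r n); first by left.
  have [|h2] := ltP y t; first by right.
  by exfalso; apply: h; rewrite ger0_norm; have := r0 n; lra.
- by move=> n; exact: integrable_bump_center.
- by move=> n; exact: integral_bump_center.
Qed.

End Mollification.

Lemma ae_mono d (T : measurableType d) (R : realType) (mu : set T -> \bar R)
    (P Q : T -> Prop) : (forall x, P x -> Q x) ->
  {ae mu, forall x, P x} -> {ae mu, forall x, Q x}.
Proof.
move=> PQ [N [mN N0 hN]]; exists N; split => //.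
by apply: subset_trans hN => x; apply: contra_not => /PQ.
Qed.

(** * Fubini for slices of a function on the plane *)

Section PlaneFubini.
Context {R : realType}.
Local Notation mu := (@lebesgue_measure R).
Local Notation mR := (measurableTypeR R).
Implicit Types (u : R * R -> R) (g s : R -> R).

Definition swap_plane (z : R * R) : R * R := (z.2, z.1).

Lemma measurable_swap_plane : measurable_fun setT (swap_plane : mR * mR -> mR * mR).
Proof. by apply: measurable_fun_pair; [exact: measurable_snd|exact: measurable_fst]. Qed.

Lemma ge0_integral_swap (f : R * R -> \bar R) :
  measurable_fun setT (f : mR * mR -> \bar R) -> (forall z, (0 <= f z)%E) ->
  (\int[leb2]_z f (swap_plane z) = \int[leb2]_z f z)%E.
Proof.
move=> mf f0.
have mfs : measurable_fun setT ((f \o swap_plane) : mR * mR -> \bar R).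
  exact: measurableT_comp mf measurable_swap_plane.
rewrite /leb2 (fubini_tonelli1 _ mf f0).
by rewrite (fubini_tonelli2 _ mfs)//= => z; exact: f0.
Qed.

Lemma integrable_swap u : leb2.-integrable setT (EFin \o u) ->
  leb2.-integrable setT (EFin \o (u \o swap_plane)).
Proof.
move=> /integrableP[mu_ fin]; apply/integrableP; split.
  exact: measurableT_comp mu_ measurable_swap_plane.
have mabs : measurable_fun setT ((fun z => `|(u z)%:E|%E) : mR * mR -> \bar R).
  by apply: measurableT_comp => //; exact: mu_.
by have := ge0_integral_swap mabs (fun z => abse_ge0 _) => /= ->.
Qed.

Lemma ae_swap (P : R * R -> Prop) : {ae leb2, forall z, P z} ->
  {ae leb2, forall z, P (swap_plane z)}.
Proof.
move=> [N [mN N0 PN]]; exists (swap_plane @^-1` N); split.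
- by rewrite -[X in measurable X]setTI; exact: measurable_swap_plane.
- rewrite -[X in leb2 X]setIT -integral_indic//; last by rewrite -[X in measurable X]setTI; exact: measurable_swap_plane.
  transitivity (\int[leb2]_z (EFin \o \1_N) (swap_plane z))%E.
    by apply: eq_integral => z _ /=; rewrite !indicE.
  rewrite ge0_integral_swap//=; last by apply/measurable_EFinP; exact: measurable_indic.
  by rewrite integral_indic// setIT.
- by move=> z Pz; apply: PN.
Qed.

(** Tonelli, in the form in which Lebesgue points found on each horizontal line separately yield a
    statement about the plane. *)
Lemma ae_slices (B : set (R * R)) : measurable (B : set (mR * mR)) ->
  {ae mu, forall y, {ae mu, forall x, ~ B (x, y)}} ->
  {ae leb2, forall z, ~ B z}.
Proof.
move=> mB hB; exists B; split => //; last by move=> z /= /contrapT.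
rewrite -[LHS]/(leb2 B) -[B in leb2 B]setIT -integral_indic//.
have mI : measurable_fun setT (EFin \o \1_B : mR * mR -> \bar R).
  by apply/measurable_EFinP; exact: measurable_indic.
rewrite /leb2 fubini_tonelli1// fubini_tonelli//.
rewrite (@ae_eq_integral _ _ _ _ _ (cst 0%E)) ?integral0//.
  by apply: (@measurable_fun_fubini_tonelli_G _ _ _ _ _ mu (EFin \o \1_B) mI) => z; rewrite lee_fin.
apply: ae_mono hB => y hy _.
rewrite /fubini_G (@ae_eq_integral _ _ _ _ _ (cst 0%E)) ?integral0//.
  exact: measurableT_comp mI (measurable_pair2 y).
apply: ae_mono hy => x hx _ /=; rewrite indicE.
by rewrite memNset.
Qed.

Lemma integrable_fubini_section (f : R * R -> R) : leb2.-integrable setT (EFin \o f) ->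
  mu.-integrable setT (fun y => \int[mu]_x (f (x, y))%:E)%E.
Proof. by move=> /integrable_swap; exact: integrable_fubini_F. Qed.

Variable u : R * R -> R.
Hypothesis ju : leb2.-integrable setT (EFin \o u).

Definition slice_pairing g y := \int[mu]_x (u (x, y) * g x).

Lemma ae_slice_integrable :
  {ae mu, forall y, mu.-integrable setT (EFin \o (fun x => u (x, y)))}.
Proof. by have := @ae_integrable2 _ _ _ _ _ mu mu (EFin \o u) ju; apply: ae_mono. Qed.

Lemma integrable_tensor s g (C K : R) : measurable_fun setT s -> measurable_fun setT g ->
  (forall y, `|s y| <= C) -> (forall x, `|g x| <= K) ->
  leb2.-integrable setT (EFin \o (fun z => u z * (s z.2 * g z.1))).
Proof.
move=> ms mg sC gK; apply: (@integrable_bounded_mul _ _ _ _ _ _ (C * K)) => //.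
  apply: measurable_funM.
    exact: measurableT_comp ms measurable_snd.
  exact: measurableT_comp mg measurable_fst.
by move=> z; rewrite normrM ler_pM.
Qed.

Lemma slice_pairing_integrable g (K : R) : measurable_fun setT g ->
  (forall x, `|g x| <= K) -> mu.-integrable setT (EFin \o slice_pairing g).
Proof.
move=> mg gK.
have c1 (y : R) : `|cst (1 : R) y| <= 1 by rewrite normr1.
have h := @integrable_tensor (cst 1) g _ _ (measurable_cst _) mg c1 gK.
have iG := integrable_fubini_section h.
have E y : slice_pairing g y = fine (\int[mu]_x (u (x, y) * (cst 1 y * g x))%:E)%E.
  by rewrite /slice_pairing /Rintegral; congr fine; apply: eq_integral => x _ /=; rewrite mul1r.
have mG := measurable_int _ iG.
apply: le_integrable iG => //.
- apply/measurable_EFinP; rewrite (_ : slice_pairing g = fine \o (fun y => \int[mu]_x (u (x, y) * (cst 1 y * g x))%:E)%E).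
    exact: measurableT_comp (@fine_measurable R _ measurableT) mG.
  by apply/funext => y; rewrite E.
(* [fine] sends an infinite inner integral to 0, which only lowers the absolute value. *)
- by move=> y _ /=; rewrite E; case: (\int[_]_x _)%E => //= *; rewrite ?normr0 ?leey.
Qed.

Lemma integral_tensor s g (C K : R) : measurable_fun setT s -> measurable_fun setT g ->
  (forall y, `|s y| <= C) -> (forall x, `|g x| <= K) ->
  \int[leb2]_z (u z * (s z.2 * g z.1)) = \int[mu]_y (s y * slice_pairing g y).
Proof.
move=> ms mg sC gK.
have h := integrable_tensor ms mg sC gK.
rewrite /Rintegral; congr fine; rewrite -(integral21_prod_meas1 h).
apply: ae_eq_integral => //.
- exact: measurable_int (integrable_fubini_section h).
- apply/measurable_EFinP; apply: measurable_funM => //.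
  by apply/measurable_EFinP; exact: measurable_int (slice_pairing_integrable mg gK).
apply: ae_mono ae_slice_integrable => y iy _.
have ig : mu.-integrable setT (EFin \o (fun x => u (x, y) * g x)).
  exact: integrable_bounded_mul iy mg gK.
transitivity (\int[mu]_x (s y * (u (x, y) * g x))%:E)%E.
  by apply: eq_integral => x _ /=; congr EFin; ring.
have -> : s y * slice_pairing g y = \int[mu]_x (s y * (u (x, y) * g x)).
  by rewrite RintegralZl.
by rewrite fineK//; apply: integrable_fin_num => //; exact: integrableZf.
Qed.

End PlaneFubini.

(** * Exchanging a supremum over test functions with the integral over slices *)

Section SliceSupremum.
Context {R : realType}.
Local Notation mu := (@lebesgue_measure R).
Implicit Types (p q : R) (u : R * R -> R) (f g s : R -> R).

Definition C1_in p q f : Prop :=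
  [/\ forall t, derivable f t 1, continuous f^`()%classic &
      exists a b, [/\ p < a, b < q & forall t, t < a \/ b < t -> f t = 0]].

(* The bound |Du| <= T tested on the horizontal fields (sum_k s_k (x) z_k, 0). *)
Definition tensor_bound u p p' q q' (T : R) : Prop :=
  forall (N : nat) (z s : nat -> R -> R),
    (forall k, C1_in p p' (z k)) -> (forall k t, `|z k t| <= 1) ->
    (forall k, C1_in q q' (s k)) -> (forall t, \sum_(k < N) `|s k t| <= 1) ->
    \int[leb2]_x (u x * \sum_(k < N) (s k x.2 * (z k)^`()%classic x.1)) <= T.

Fixpoint running_max (F : nat -> R -> R) (N : nat) (y : R) : R :=
  if N is M.+1 then Num.max (running_max F M y) `|F M y| else 0.

Lemma running_max_ge0 (F : nat -> R -> R) N y : 0 <= running_max F N y.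
Proof. by elim: N => //= N IH; rewrite le_max IH. Qed.

Lemma running_max_ge (F : nat -> R -> R) N k y : (k < N)%N -> `|F k y| <= running_max F N y.
Proof.
elim: N => //= N IH; rewrite ltnS leq_eqVlt => /predU1P[->|/IH kN].
  by rewrite le_max lexx orbT.
by rewrite le_max kN.
Qed.

Lemma running_max_nd (F : nat -> R -> R) y : {homo (running_max F ^~ y) : n m / (n <= m)%N >-> n <= m}.
Proof. by apply/nondecreasing_seqP => n /=; rewrite le_max lexx. Qed.

Lemma measurable_running_max (F : nat -> R -> R) N : (forall k, measurable_fun setT (F k)) ->
  measurable_fun setT (running_max F N).
Proof.
move=> mF; elim: N => [|N IH]; first exact: measurable_cst.
by apply: measurable_maxr => //; exact: measurableT_comp.
Qed.

(** For each t the coefficients pick at most one index at which |F k t| is largest, with its sign,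
    and vanish at the others. In the induction the new index wins on the set [E], and the old choice
    is kept off [E]. *)
Lemma running_max_selection (F : nat -> R -> R) N : (forall k, measurable_fun setT (F k)) ->
  exists s : nat -> R -> R, [/\ forall k, measurable_fun setT (s k),
    forall t, \sum_(k < N) `|s k t| <= 1 &
    forall t, \sum_(k < N) s k t * F k t = running_max F N t].
Proof.
move=> mF; elim: N => [|N [s [ms s1 sF]]].
  exists (fun _ _ => 0); split => [k|t|t]; rewrite ?big_ord0//; exact: measurable_cst.
pose E : set R := [set t | running_max F N t < `|F N t|].
have mE : measurable E.
  have mD : measurable_fun setT (fun t => `|F N t| - running_max F N t).
    apply: measurable_funB; last exact: measurable_running_max.
    exact: measurableT_comp.
  have -> : E = setT `&` (fun t => `|F N t| - running_max F N t) @^-1` `]0, +oo[.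
    by apply/seteqP; split => t /=; rewrite in_itv/= andbT subr_gt0; [move=> ?; split|case].
  exact: mD.
pose P : set R := setT `&` F N @^-1` `[0, +oo[.
have mP : measurable P by exact: mF.
pose sg t : R := 2 * \1_P t - 1.
have sgF t : sg t * F N t = `|F N t|.
  rewrite /sg indicE; have [Pt|Pt] := boolP (t \in P).
    move/set_mem : Pt => [_]; rewrite /= in_itv/= andbT => h; rewrite ger0_norm//=; ring.
  rewrite ltr0_norm/=; first by ring.
  by rewrite ltNge; apply: contraNN Pt => h; rewrite inE; split => //=; rewrite in_itv/= h.
have sg1 t : `|sg t| = 1.
  rewrite /sg indicE; case: (_ \in _) => /=; first by rewrite (_ : 2 * 1 - 1 = 1) ?normr1//; ring.
  by rewrite mulr0 sub0r normrN1.
pose s' k t := if k == N then \1_E t * sg t else (1 - \1_E t) * s k t.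
have s'E k t : (k < N)%N -> s' k t = (1 - \1_E t) * s k t by move=> kN; rewrite /s' ltn_eqF.
have E01 t : E t -> \1_E t = 1 :> R by move=> Et; rewrite indicE mem_set.
have nE01 t : ~ E t -> \1_E t = 0 :> R by move=> Et; rewrite indicE memNset.
exists s'; split => [k|t|t].
- rewrite /s'; case: (k == N).
    apply: measurable_funM; first exact: measurable_indic.
    apply: measurable_funB => //; apply: measurable_funM => //; exact: measurable_indic.
  by apply: measurable_funM => //; apply: measurable_funB => //; exact: measurable_indic.
- rewrite big_ord_recr/= {2}/s' eqxx.
  under eq_bigr do rewrite s'E//.
  have [Et|nEt] := pselect (E t).
    rewrite E01// subrr mul1r big1 ?add0r; last by move=> i _; rewrite mul0r normr0.
    by rewrite sg1.
  rewrite nE01// mul0r normr0 addr0 subr0.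
  by under eq_bigr do rewrite mul1r.
- rewrite big_ord_recr/= {2}/s' eqxx.
  under eq_bigr do rewrite s'E//.
  have [Et|nEt] := pselect (E t).
    rewrite E01// subrr mul1r big1 ?add0r; last by move=> i _; rewrite !mul0r.
    by rewrite sgF max_r// ltW.
  rewrite nE01// !mul0r addr0 subr0.
  under eq_bigr do rewrite mul1r.
  by rewrite sF max_l// leNgt; apply/negP.
Qed.


Lemma cvg_sum_ord (N : nat) (f : nat -> nat -> R) (l : nat -> R) :
  (forall k, f k n @[n --> \oo] --> l k) ->
  \sum_(k < N) f k n @[n --> \oo] --> \sum_(k < N) l k.
Proof.
move=> fl; elim: N => [|N IH].
  by under eq_fun do rewrite big_ord0; rewrite big_ord0; exact: cvg_cst.
by under eq_fun do rewrite big_ord_recr/=; rewrite big_ord_recr/=; exact: cvgD.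
Qed.

Variables (u : R * R -> R) (p p' q q' T : R) (z : nat -> R -> R) (K : nat -> R).
Hypothesis ju : leb2.-integrable setT (EFin \o u).
Hypothesis T0 : 0 <= T.
Hypothesis qq' : q < q'.
Hypothesis hz : forall k, C1_in p p' (z k).
Hypothesis z1 : forall k t, `|z k t| <= 1.
Hypothesis gK : forall k t, `|(z k)^`()%classic t| <= K k.
Hypothesis TB : tensor_bound u p p' q q' T.

Let F k := slice_pairing u (z k)^`()%classic.

Let mg k : measurable_fun setT (z k)^`()%classic.
Proof. by have [_ cg _] := hz k; exact: continuous_measurable_fun. Qed.

Let jF k : mu.-integrable setT (EFin \o F k).
Proof. exact: slice_pairing_integrable (gK k). Qed.

Let mF k : measurable_fun setT (F k).
Proof. by apply/measurable_EFinP; exact: measurable_int (jF k). Qed.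

Let sum_integrable (s : nat -> R -> R) (N : nat) :
  (forall k, measurable_fun setT (s k)) -> (forall k t, `|s k t| <= 1) ->
  mu.-integrable setT (EFin \o (fun y => \sum_(k < N) s k y * F k y)) /\
  leb2.-integrable setT (EFin \o (fun x => u x * \sum_(k < N) (s k x.2 * (z k)^`()%classic x.1))) /\
  \int[leb2]_x (u x * \sum_(k < N) (s k x.2 * (z k)^`()%classic x.1)) =
  \int[mu]_y (\sum_(k < N) s k y * F k y).
Proof.
move=> ms s1; elim: N => [|N [IH1 [IH2 IH3]]].
  split; first by have := integrableZf measurableT 0 (jF 0%N); apply: eq_integrable => // y _ /=; rewrite big_ord0 mul0r.
  split; first by have := integrableZf measurableT 0 ju; apply: eq_integrable => // y _ /=; rewrite big_ord0 mul0r mulr0.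
  under eq_Rintegral do rewrite big_ord0 mulr0.
  under [RHS]eq_Rintegral do rewrite big_ord0.
  by rewrite /Rintegral !integral0.
have i1 : mu.-integrable setT (EFin \o (fun y => s N y * F N y)).
  have := integrable_bounded_mul (jF N) (ms N) (s1 N).
  by apply: eq_integrable => // y _ /=; rewrite mulrC.
have i2 := integrable_tensor ju (ms N) (mg N) (s1 N) (gK N).
split; last split.
- by have := integrableDf measurableT IH1 i1; apply: eq_integrable => // y _ /=; rewrite big_ord_recr.
- by have := integrableDf measurableT IH2 i2; apply: eq_integrable => // y _ /=; rewrite big_ord_recr/= mulrDr.
- under eq_Rintegral do rewrite big_ord_recr/= mulrDr.
  under [RHS]eq_Rintegral do rewrite big_ord_recr/=.
  by rewrite !RintegralD// IH3 (integral_tensor ju (ms N) (mg N) (s1 N) (gK N)).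
Qed.

(** Mollification in y carries the bound from C1 coefficients to measurable ones: the mollified
    coefficients are admissible by [mollify_sum_le1], they converge at Lebesgue points, and the sum
    of the |F k| dominates. *)
Lemma tensor_bound_measurable (N : nat) (s : nat -> R -> R) (a b : R) :
  (forall k, measurable_fun setT (s k)) ->
  (forall t, \sum_(k < N) `|s k t| <= 1) ->
  (forall k t, `|s k t| <= 1) ->
  q < a -> b < q' -> (forall k t, t < a \/ b < t -> s k t = 0) ->
  \int[mu]_y (\sum_(k < N) s k y * F k y) <= T.
Proof.
move=> ms s1 s1' qa bq' sout.
have js k : mu.-integrable setT (EFin \o s k).
  have ab_fin : (mu `[a, b] < +oo)%E.
    by rewrite lebesgue_measure_itv/=; case: ifP => _; rewrite ?ltry// -EFinB ltry.
  have mab : measurable (`[a, b] : set R) by [].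
  have jab : mu.-integrable `[a, b] (EFin \o s k).
    apply: (@dominated_integrable_fin _ _ _ mu _ mab _ (fun=> 1)).
    - exact: (measurable_funTS (ms k)).
    - by move=> t _; exact: s1'.
    - exact: (@integrable_constant _ _ _ mu _ mab ab_fin 1).
  move: jab; rewrite integrable_mkcond//.
  apply: eq_integrable => // t _; rewrite patchE.
  have [//|/negP h] := boolP (t \in _); rewrite /= sout//.
  have [|at_] := ltP t a; first by left.
  have [|tb] := ltP b t; first by right.
  by exfalso; apply: h; rewrite inE/= in_itv/= at_ tb.
(* The support [a, b] grows to [a, b + 3 r], and the divisor 6 makes 3 r at most half of the gap q'
   - b. *)
pose r n := ((q' - b) / 6) * n.+1%:R^-1.
have r0 n : 0 < r n by rewrite mulr_gt0// ?invr_gt0// divr_gt0// subr_gt0.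
have cr : r @ \oo --> (0 : R).
  rewrite -[X in _ --> X](mulr0 ((q' - b) / 6)); apply: cvgM; first exact: cvg_cst.
  exact: cvg_harmonic.
have rb n : b + 3 * r n < q'.
  have : r n <= (q' - b) / 6.
    rewrite /r ger_pMr ?divr_gt0 ?subr_gt0//.
    by rewrite invf_le1// ler1n.
  lra.
have mol1 n k t : `|mollify (s k) (r n) t| <= 1.
  have := @mollify_sum_le1 _ 1 (fun=> s k) (r n) t (r0 n) (fun=> js k).
  by rewrite big_ord1; apply => t'; rewrite big_ord1.
have mm n k : measurable_fun setT (mollify (s k) (r n)).
  apply: continuous_measurable_fun => t; apply: differentiable_continuous.
  by apply/derivable1_diffP; exact: mollify_derivable.
have c1 n k : C1_in q q' (mollify (s k) (r n)).
  split.
  - by move=> t; exact: mollify_derivable.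
  - exact: mollify_derive1_continuous.
  - exists a, (b + 3 * r n); split => // t ht.
    exact: (mollify_out (r0 n) (sout k) ht).
have le n : \int[mu]_y (\sum_(k < N) mollify (s k) (r n) y * F k y) <= T.
  have [_ [_ <-]] := sum_integrable N (mm n) (mol1 n).
  apply: (TB hz z1 (c1 n)) => t.
  exact: mollify_sum_le1.
have [i0 [_ _]] := sum_integrable N ms s1'.
have [] := @dominated_convergence _ _ R mu setT measurableT
  (fun n y => (\sum_(k < N) mollify (s k) (r n) y * F k y)%:E)
  (fun y => (\sum_(k < N) s k y * F k y)%:E)
  (fun y => (\sum_(k < N) `|F k y|)%:E).
- by move=> n; apply: measurable_int (sum_integrable N (mm n) (mol1 n)).1.
- exact: measurable_int i0.
- have H k : {ae mu, forall t, lebesgue_pt (s k) t}.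
    apply: lebesgue_differentiation.
    have := integrable_locally_restrict measurableT (js k).
    by rewrite patch_setT.
  apply: ae_mono (ae_foralln H) => y hy _.
  apply: cvg_EFin; first exact: nearW.
  apply: (@cvg_sum_ord N (fun k n => mollify (s k) (r n) y * F k y) (fun k => s k y * F k y)) => k.
  apply: cvgM; last exact: cvg_cst.
  exact: mollify_cvg.
- have := @integrable_sum _ _ _ mu setT measurableT _ (index_enum 'I_N) xpredT (fun k y => `|F k y|%:E).
  move=> /(_ _); under eq_fun do rewrite sumEFin; apply => k _.
  by have := integrable_abse (jF k); exact: eq_integrable.
- apply: aeW => y n _; rewrite /= lee_fin (le_trans (ler_norm_sum _ _ _))//.
  by apply: ler_sum => k _; rewrite normrM ler_piMl.
move=> _ _ cv.
have cv' : \int[mu]_y (\sum_(k < N) mollify (s k) (r n) y * F k y) @[n --> \oo] -->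
    \int[mu]_y (\sum_(k < N) s k y * F k y).
  by apply: (fine_cvg (f := fun n => _)); rewrite fineK//; exact: integrable_fin_num.
apply: (cvgr_to_le cv').
by apply: nearW => n; exact: le.
Qed.

End SliceSupremum.

Section SliceOscillation.
Context {R : realType}.
Local Notation mu := (@lebesgue_measure R).
Local Notation mR := (measurableTypeR R).

(** For finitely many k, [running_max_selection] turns the integral of the pointwise maximum into
    one admissible pairing, hence it is at most T; monotone convergence passes to all k. The
    function A takes extended values because the supremum may be infinite on a null set of
    slices. *)
Lemma slice_supremum (u : R * R -> R) (p p' q q' T : R) (z : nat -> R -> R) (K : nat -> R) :
  leb2.-integrable setT (EFin \o u) -> q < q' ->
  (forall k, C1_in p p' (z k)) -> (forall k t, `|z k t| <= 1) ->
  (forall k t, `|(z k)^`()%classic t| <= K k) -> tensor_bound u p p' q q' T ->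
  exists A : R -> \bar R, [/\ measurable_fun setT A, forall y, (0 <= A y)%E,
    (\int[mu]_y A y <= T%:E)%E &
    forall k y, q < y < q' -> (`|slice_pairing u (z k)^`()%classic y|%:E <= A y)%E].
Proof.
move=> ju qq' hz z1 gK TB.
pose F k := slice_pairing u (z k)^`()%classic.
have mg k : measurable_fun setT (z k)^`()%classic.
  by have [_ cg _] := hz k; exact: continuous_measurable_fun.
have jF k : mu.-integrable setT (EFin \o F k) by exact: slice_pairing_integrable (gK k).
have mF k : measurable_fun setT (F k) by apply/measurable_EFinP; exact: measurable_int (jF k).
(* The selected coefficients need not have compact support in ]q, q'[, so they are cut off to closed
   intervals that exhaust it. *)
pose de n := (q' - q) / 2 * n.+1%:R^-1.
have de0 n : 0 < de n by rewrite mulr_gt0// ?invr_gt0// divr_gt0// subr_gt0.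
pose I n : set R := `[q + de n, q' - de n]%classic.
have mI n : measurable (I n) by exact: measurable_itv.
pose f n y := running_max F n y * \1_(I n) y.
have mf n : measurable_fun setT (f n).
  apply: measurable_funM; first exact: measurable_running_max.
  exact: measurable_indic.
have i0 n y : 0 <= \1_(I n) y :> R by rewrite indicE.
have f0 n y : 0 <= f n y by rewrite mulr_ge0// running_max_ge0.
have ndf y : {homo (f ^~ y) : n m / (n <= m)%N >-> n <= m}.
  move=> n m nm; rewrite /f; apply: ler_pM => //; first exact: running_max_ge0.
    exact: running_max_nd.
  rewrite !indicE; have [/set_mem yn|] := boolP (y \in I n); last by rewrite ler0n.
  rewrite mem_set//; move: yn; rewrite /I/= !in_itv/= => /andP[h1 h2].
  have dd : de m <= de n.
    rewrite ler_pM2l ?divr_gt0 ?subr_gt0//.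
    by rewrite lef_pV2 ?posrE// ler_nat ltnS.
  by apply/andP; split; lra.
have fT n : (\int[mu]_y (f n y)%:E <= T%:E)%E.
  have [s [ms s1 sF]] := running_max_selection n mF.
  pose s' k y := if (k < n)%N then s k y * \1_(I n) y else 0.
  have I1 y : `|\1_(I n) y| <= 1 :> R.
    by rewrite indicE; case: (y \in I n); rewrite ?normr1// normr0.
  have ms' k : measurable_fun setT (s' k).
    rewrite /s'; case: (k < n)%N; last exact: measurable_cst.
    by apply: measurable_funM => //; exact: measurable_indic.
  have s's k y : `|s' k y| <= `|s k y|.
    by rewrite /s'; case: ifP => _; rewrite ?normr0// normrM ler_piMr.
  have s1' y : \sum_(k < n) `|s' k y| <= 1.
    by apply: le_trans (s1 y); apply: ler_sum => k _; exact: s's.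
  have s1'' k y : `|s' k y| <= 1.
    rewrite /s'; case: ifPn => kn; last by rewrite normr0.
    have := s1' y; rewrite (bigD1 (Ordinal kn))//= {1}/s' kn; apply: le_trans.
    by rewrite lerDl sumr_ge0.
  have sout k t : t < q + de n \/ q' - de n < t -> s' k t = 0.
    move=> ht; rewrite /s'; case: ifP => // _; rewrite indicE memNset ?mulr0//.
    by rewrite /I/= in_itv/= => /andP[h1 h2]; case: ht => ?; lra.
  have qa : q < q + de n by rewrite ltrDl.
  have bq : q' - de n < q' by rewrite gtrBl.
  have := tensor_bound_measurable ju hz z1 gK TB ms' s1' s1'' qa bq sout.
  have E : (fun y => \sum_(k < n) s' k y * F k y) = f n.
    apply/funext => y; rewrite /f -sF mulr_suml; apply: eq_bigr => k _.
    by rewrite /s' ltn_ord; ring.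
  rewrite -[X in X <= _]/(\int[mu]_y ((fun y => \sum_(k < n) s' k y * F k y) y)) E.
  rewrite -lee_fin fineK//.
  have jr : mu.-integrable setT (EFin \o running_max F n).
    elim: (n) => [|m IH].
      by have := integrableZf measurableT 0 (jF 0%N); apply: eq_integrable => // y _ /=; rewrite mul0r.
    apply: (@dominated_integrable_fin _ _ _ mu _ measurableT (running_max F m.+1) (fun y => running_max F m y + `|F m y|)).
    - exact: measurable_running_max.
    - move=> y _; rewrite (ger0_norm (running_max_ge0 F m.+1 y)).
      rewrite -[leLHS]/(Num.max (running_max F m y) (`|F m y|)) ge_max.
      by rewrite lerDl lerDr normr_ge0 running_max_ge0.
    - by apply: integrableDf => //; have := integrable_abse (jF m); exact: eq_integrable.
  have jf : mu.-integrable setT (EFin \o f n).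
    apply: (@dominated_integrable_fin _ _ _ mu _ measurableT (f n) _ (mf n) _ jr) => y _.
    by rewrite ger0_norm// /f ler_piMr ?running_max_ge0//; have := I1 y; rewrite ger0_norm.
  exact: integrable_fin_num jf.
pose A y := limn (fun n => (f n y)%:E).
have ndE y : nondecreasing_seq (fun n => (f n y)%:E).
  by move=> n m nm; rewrite lee_fin ndf.
have cA y : (f n y)%:E @[n --> \oo] --> A y by exact: ereal_nondecreasing_is_cvgn.
have fA n y : ((f n y)%:E <= A y)%E.
  rewrite /A (cvg_lim _ (ereal_nondecreasing_cvgn (ndE y)))//.
  by apply: ereal_sup_ubound; exists n.
exists A; split.
- by apply: (emeasurable_fun_cvg (fun n y => (f n y)%:E)) => // n; apply/measurable_EFinP.
- by move=> y; rewrite (le_trans _ (fA 0%N y))// lee_fin.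
- rewrite monotone_convergence//.
  + apply: lime_le; last exact: nearW.
    apply: ereal_nondecreasing_is_cvgn => n m nm; apply: ge0_le_integral => //.
    * by move=> y _; rewrite lee_fin.
    * by apply/measurable_EFinP; exact: mf.
    * by apply/measurable_EFinP; exact: mf.
    * by move=> y _; rewrite lee_fin ndf.
  + by move=> n; by apply/measurable_EFinP; exact: mf.
  + by move=> n y _; rewrite lee_fin.
- move=> k y /andP[qy yq'].
  have [n [kn yn]] : exists n, (k < n)%N /\ I n y.
    pose e := Num.min (y - q) (q' - y).
    have e0 : 0 < e by rewrite lt_min !subr_gt0 qy.
    have d0 : 0 < e / ((q' - q) / 2) by rewrite !divr_gt0 ?subr_gt0.
    have [N _ hN] := near_infty_natSinv_lt (PosNum d0).
    exists (maxn N k.+1); split; first by rewrite leq_max leqnn orbT.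
    have := hN (maxn N k.+1) (leq_maxl _ _); rewrite /= ltr_pdivlMr ?divr_gt0 ?subr_gt0// mulrC => h.
    have {}h : de (maxn N k.+1) < e by exact: h.
    move: h; rewrite lt_min => /andP[h1 h2].
    by rewrite /I/= in_itv/=; apply/andP; split; lra.
  apply: le_trans (fA n y); rewrite lee_fin /f indicE mem_set// mulr1.
  exact: (@running_max_ge _ F).
Qed.

End SliceOscillation.

(** * Oscillation of a function around its weighted means on slices *)

Section PlaneOscillation.
Context {R : realType}.
Local Notation mu := (@lebesgue_measure R).
Local Notation mR := (measurableTypeR R).

Definition open_rectangle (p p' q q' : R) : set (R * R) :=
  `]p, p'[%classic `*` `]q, q'[%classic.

Lemma measurable_open_rectangle p p' q q' :
  measurable (open_rectangle p p' q q' : set (mR * mR)).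
Proof. exact: measurableX. Qed.

(* [bump c r] is supported in [c, c + 3 r]: here the middle three quarters of ]p, p'[. *)
Definition weight_start (p p' : R) := p + (p' - p) / 8.
Definition weight_scale (p p' : R) := (p' - p) / 4.
Definition center_weight (p p' : R) : R -> R := bump (weight_start p p') (weight_scale p p').

Lemma weight_scale_gt0 p p' : p < p' -> 0 < weight_scale p p'.
Proof. by move=> pp'; rewrite divr_gt0// subr_gt0. Qed.

Lemma weight_start_in p p' : p < p' ->
  p < weight_start p p' /\ weight_start p p' + 3 * weight_scale p p' < p'.
Proof. by move=> pp'; rewrite /weight_start /weight_scale; split; lra. Qed.

(** Both primitives rise from 0 to 1 inside ]p, p'[, so their difference has compact support there
    and values in [-1, 1]. The pairing of u with its derivative is a local average minus a fixed
    weighted mean of the slice. *)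
Lemma bump_difference_C1 (p p' c r : R) : p < p' -> 0 < r -> p < c -> c + 3 * r < p' ->
  let z t := bump_primitive c r t - bump_primitive (weight_start p p') (weight_scale p p') t in
  [/\ C1_in p p' z, forall t, `|z t| <= 1 &
      z^`()%classic = fun t => bump c r t - center_weight p p' t].
Proof.
move=> pp' r0 pc cp' z.
have w0 := weight_scale_gt0 pp'; have [wp wp'] := weight_start_in pp'.
have dz (t : R) : is_derive t 1 z (bump c r t - center_weight p p' t).
  have d1 := is_derive_bump_primitive c r t.
  have d2 := is_derive_bump_primitive (weight_start p p') (weight_scale p p') t.
  exact: is_deriveB d1 d2.
have z'E : z^`()%classic = fun t => bump c r t - center_weight p p' t.
  by apply/funext => t; rewrite derive1E; have [_ ->] := dz t.
split => //.
- split.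
  + by move=> t; have [] := dz t.
  + by rewrite z'E => t; apply: cvgB; exact: continuous_bump.
  + exists (Num.min c (weight_start p p')), (Num.max (c + 3 * r) (weight_start p p' + 3 * weight_scale p p')).
    rewrite lt_min pc wp gt_max cp' wp'; split => // t [|].
      rewrite lt_min => /andP[h1 h2].
      by rewrite /z !bump_primitive0 ?subrr// ltW.
    rewrite gt_max => /andP[h1 h2].
    by rewrite /z !bump_primitive1 ?subrr// ltW.
- move=> t; rewrite ler_norml /z.
  have /andP[h1 h2] := bump_primitive_itv c t r0.
  have /andP[h3 h4] := bump_primitive_itv (weight_start p p') t w0.
  by apply/andP; split; lra.
Qed.

(** At a Lebesgue point of its slice, u (x, y) is the limit of averages over bumps near x. Rational
    left ends and scales 1 / (n + 1) make a countable family of bumps, so [slice_supremum] gives one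
    A (y) for all of them. *)
Lemma slice_oscillation (u : R * R -> R) (p p' q q' T : R) :
  leb2.-integrable setT (EFin \o u) -> p < p' -> q < q' ->
  tensor_bound u p p' q q' T ->
  exists A : R -> \bar R, [/\ measurable_fun setT A, forall y, (0 <= A y)%E,
    (\int[mu]_y A y <= T%:E)%E &
    {ae leb2, forall z, open_rectangle p p' q q' z ->
      (`|u z - slice_pairing u (center_weight p p') z.2|%:E <= A z.2)%E}].
Proof.
move=> ju pp' qq' TB.
have w0 := weight_scale_gt0 pp'; have [wp wp'] := weight_start_in pp'.
pose valid (c r : R) := (p < c) && (c + 3 * r < p').
pose rr (n : nat) : R := n.+1%:R^-1.
have rr0 n : 0 < rr n by rewrite invr_gt0.
(* Codes of inadmissible pairs are sent to the reference weight itself, for which [z k] is 0. *)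
pose dec k : R * R := match unpickle k : option (rat * nat) with
  | Some cn => if valid (ratr cn.1) (rr cn.2) then (ratr cn.1, rr cn.2)
    else (weight_start p p', weight_scale p p')
  | None => (weight_start p p', weight_scale p p') end.
have decP k : [/\ 0 < (dec k).2, p < (dec k).1 & (dec k).1 + 3 * (dec k).2 < p'].
  rewrite /dec; case: unpickle => [[c n]|//]; case: ifPn => // /andP[h1 h2].
  by split => //=.
pose z k t := bump_primitive (dec k).1 (dec k).2 t - bump_primitive (weight_start p p') (weight_scale p p') t.
have zP k : [/\ C1_in p p' (z k), forall t, `|z k t| <= 1 &
    (z k)^`()%classic = fun t => bump (dec k).1 (dec k).2 t - center_weight p p' t].
  by have [h1 h2 h3] := decP k; exact: bump_difference_C1.
have bb (c r t : R) : 0 < r -> `|bump c r t| <= r^-1.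
  by move=> r0; rewrite ger0_norm ?bump_ge0// bump_le.
pose K k := (dec k).2^-1 + (weight_scale p p')^-1.
have gK k t : `|(z k)^`()%classic t| <= K k.
  have [_ _ ->] := zP k; have [h1 _ _] := decP k.
  by rewrite (le_trans (ler_normB _ _))// lerD// bb.
have z_C1 k : C1_in p p' (z k) by case: (zP k).
have z_1 k t : `|z k t| <= 1 by case: (zP k).
have [A [mA A0 AT Ab]] := slice_supremum ju qq' z_C1 z_1 gK TB.
exists A; split => //.
pose m := slice_pairing u (center_weight p p').
have mbump c r : measurable_fun setT (bump c r : R -> R).
  by apply: continuous_measurable_fun; exact: continuous_bump.
have mw : measurable_fun setT (center_weight p p') by exact: mbump.
have bw t : `|center_weight p p' t| <= (weight_scale p p')^-1 by exact: bb.
have jm : mu.-integrable setT (EFin \o m).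
  exact: (slice_pairing_integrable ju mw bw).
have mm : measurable_fun setT m by apply/measurable_EFinP; exact: measurable_int jm.
have mu_ : measurable_fun setT (u : mR * mR -> R) by apply/measurable_EFinP; exact: measurable_int ju.
(* The exceptional set is measurable in the plane, so it suffices that almost all of its horizontal
   slices are null. *)
pose B := open_rectangle p p' q q' `&` [set z : R * R | (A z.2 < `|u z - m z.2|%:E)%E].
have mB : measurable (B : set (mR * mR)).
  apply: measurable_lte.
  - exact: measurable_open_rectangle.
  - by apply: measurable_funTS; exact: measurableT_comp mA measurable_snd.
  - apply: measurable_funTS; apply/measurable_EFinP; apply: measurableT_comp => //.
    apply: measurable_funB => //; exact: measurableT_comp mm measurable_snd.
suff : {ae leb2, forall z, ~ B z}.
  apply: ae_mono => x nB rx; rewrite leNgt; apply/negP => h; exact: nB.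
apply: ae_slices => //.
apply: ae_mono (ae_slice_integrable ju) => y iy.
have loc : locally_integrable setT (fun x => u (x, y)).
  by have := integrable_locally_restrict measurableT iy; rewrite patch_setT.
apply: ae_mono (lebesgue_differentiation loc) => x Lx [[/= xI yJ]]; apply/negP; rewrite -leNgt.
move: xI yJ; rewrite !in_itv/= => /andP[px xp'] yJ.
have [->|Afin] := eqVneq (A y) +oo%E; first by rewrite leey.
have {}Afin : A y = (fine (A y))%:E by rewrite fineK// ge0_fin_numE// ltey.
pose e := Num.min (x - p) (p' - x).
have e0 : 0 < e by rewrite lt_min !subr_gt0 px.
have e4 : 0 < e / 4 by rewrite divr_gt0.
have [N _ hN] := near_infty_natSinv_lt (PosNum e4).
(* The bump will start less than [rr] to the left of x and have length 3 [rr]. So it lies in the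
   ball of radius 4 [rr] around x, and this inequality keeps it inside ]p, p'[. *)
have hN' n : 4 * rr (n + N)%N < e.
  by rewrite -ltr_pdivlMl// mulrC; apply: (hN (n + N)%N); exact: leq_addl.
have /choice[c hc] : forall n, exists c : rat, x - rr (n + N)%N < ratr c < x.
  move=> n.
  have oI : open `]x - rr (n + N)%N, x[%classic by exact: interval_open.
  have [|t [tI [c _ ct]]] := @dense_rat R _ _ oI.
    by exists (x - rr (n + N)%N / 2); rewrite /= in_itv/=; have := rr0 (n + N)%N; lra.
  by exists c; rewrite ct; move: tI; rewrite /= in_itv.
have cb n : [/\ x - rr (n + N)%N < ratr (c n), ratr (c n) < x, p < ratr (c n) & ratr (c n) + 3 * rr (n + N)%N < p'].
  have := hc n => /andP[h1 h2]; have := hN' n; rewrite lt_min => /andP[h3 h4].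
  by have := rr0 (n + N)%N; split; lra.
have cv : \int[mu]_t (u (t, y) * bump (ratr (c n)) (rr (n + N)%N) t) @[n --> \oo] --> u (x, y).
  apply: (@kernel_cvg _ _ _ _ 4 (fun n => 4 * rr (n + N)%N)) => //.
  - by move=> n; rewrite mulr_gt0.
  - rewrite -[X in _ --> X](mulr0 4); apply: cvgM; first exact: cvg_cst.
    have : rr (n + N)%N @[n --> \oo] --> (0 : R) by rewrite (cvg_shiftn N rr); exact: cvg_harmonic.
    exact.
  - move=> n t; rewrite bump_ge0//= (le_trans (bump_le _ _ _))//.
    by rewrite invfM mulrA divff// mul1r.
  - move=> n t; rewrite /ball/= => h; apply: bump_out => //.
    have [h1 h2 _ _] := cb n; have [|h3] := leP t (ratr (c n)); first by left.
    have [|h4] := leP (ratr (c n) + 3 * rr (n + N)%N) t; first by right.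
    by exfalso; apply: h; have rp := rr0 (n + N)%N; rewrite ltr_norml; apply/andP; split; lra.
  - by move=> n; exact: integrable_bump.
  - by move=> n; exact: integral_bump.
have bnd n : `|\int[mu]_t (u (t, y) * bump (ratr (c n)) (rr (n + N)%N) t) - m y| <= fine (A y).
  rewrite -lee_fin -Afin.
  pose k := pickle (c n, (n + N)%N).
  have kE : dec k = (ratr (c n), rr (n + N)%N).
    have [_ _ h3 h4] := cb n.
    by rewrite /dec /k pickleK/= /valid h3 h4.
  have := Ab k y yJ; have [_ _ ->] := zP k; rewrite kE/=.
  congr ((`| _ |)%:E <= _)%E.
  rewrite /slice_pairing -RintegralB//.
  - by apply: eq_Rintegral => t _; rewrite mulrBr.
  - exact: (integrable_bounded_mul iy (mbump _ _) (fun t => bb _ _ t (rr0 _))).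
  - exact: (integrable_bounded_mul iy mw bw).
rewrite Afin lee_fin.
have cvn : `|\int[mu]_t (u (t, y) * bump (ratr (c n)) (rr (n + N)%N) t) - m y| @[n --> \oo] --> `|u (x, y) - m y|.
  by apply: cvg_norm; apply: cvgB; [exact: cv|exact: cvg_cst].
by apply: (cvgr_to_le cvn); exact: nearW.
Qed.

End PlaneOscillation.

(** * Tensor fields as competitors in the total variation *)

Section TensorFields.
Context {R : realType}.
Local Notation mu := (@lebesgue_measure R).
Local Notation mR := (measurableTypeR R).
Implicit Types (p q : R).

Definition tensor (N : nat) (a b : nat -> R -> R) (x : R * R) : R :=
  \sum_(k < N) (b k x.2 * a k x.1).

Lemma is_derive_sum_scale (N : nat) (c : nat -> R) (a : nat -> R -> R) (t : R) :
  (forall k, derivable (a k) t 1) ->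
  is_derive t 1 (fun t => \sum_(k < N) (c k * a k t))
    (\sum_(k < N) (c k * (a k)^`()%classic t)).
Proof.
move=> da; elim: N => [|N IH].
  rewrite big_ord0 (_ : (fun t => _) = cst 0); first exact: is_derive_cst.
  by apply/funext => s; rewrite big_ord0.
rewrite big_ord_recr/= (_ : (fun t => _) =
    (fun t => \sum_(k < N) (c k * a k t)) + (fun t => c N * a N t)); last first.
  by apply/funext => s; rewrite big_ord_recr.
have dN : is_derive t 1 (fun t => c N * a N t) (c N * (a N)^`()%classic t).
  by rewrite derive1E; have h := @derivableP _ _ _ _ _ _ (da N); exact: (@is_deriveZ _ _ _ (a N) (c N) t 1 _ h).
exact: is_deriveD IH dN.
Qed.

Lemma tensor_partial1 (N : nat) (a b : nat -> R -> R) : (forall k t, derivable (a k) t 1) ->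
  partial1 (tensor N a b) = tensor N (fun k => (a k)^`()%classic) b.
Proof.
move=> da; apply/funext => x; rewrite /partial1 derive1E.
by have [_ ->] := is_derive_sum_scale N (fun k => b k x.2) (fun k => da k x.1).
Qed.

Lemma tensor_sym (N : nat) (a b : nat -> R -> R) x : tensor N a b x = \sum_(k < N) (a k x.1 * b k x.2).
Proof. by apply: eq_bigr => k _; rewrite mulrC. Qed.

Lemma tensor_partial2 (N : nat) (a b : nat -> R -> R) : (forall k t, derivable (b k) t 1) ->
  partial2 (tensor N a b) = tensor N a (fun k => (b k)^`()%classic).
Proof.
move=> db; apply/funext => x; rewrite /partial2 derive1E tensor_sym.
under eq_fun do rewrite tensor_sym/=.
by have [_ ->] := is_derive_sum_scale N (fun k => a k x.1) (fun k => db k x.2).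
Qed.

Lemma continuous_tensor (N : nat) (a b : nat -> R -> R) :
  (forall k, continuous (a k)) -> (forall k, continuous (b k)) -> continuous (tensor N a b).
Proof.
move=> ca cb; elim: N => [|N IH].
  rewrite (_ : tensor 0 a b = cst 0); first by move=> x; exact: cvg_cst.
  by apply/funext => x; rewrite /tensor big_ord0.
rewrite (_ : tensor N.+1 a b = fun x => tensor N a b x + b N x.2 * a N x.1); last first.
  by apply/funext => x; rewrite /tensor big_ord_recr.
move=> x; apply: cvgD; first exact: IH.
apply: cvgM.
  by apply: (@continuous_comp _ _ _ snd (b N)); [exact: cvg_snd|exact: cb].
by apply: (@continuous_comp _ _ _ fst (a N)); [exact: cvg_fst|exact: ca].
Qed.

Lemma C1_in_continuous p p' f : C1_in p p' f -> continuous f.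
Proof.
by move=> [df _ _] t; apply: differentiable_continuous; apply/derivable1_diffP.
Qed.

Lemma C1_tensor (N : nat) p p' q q' (a b : nat -> R -> R) :
  (forall k, C1_in p p' (a k)) -> (forall k, C1_in q q' (b k)) -> C1 (tensor N a b).
Proof.
move=> ha hb.
have da k t : derivable (a k) t 1 by case: (ha k).
have db k t : derivable (b k) t 1 by case: (hb k).
split; last split.
- move=> x; split.
    by have [] := is_derive_sum_scale N (fun k => b k x.2) (fun k => da k x.1).
  rewrite (_ : (fun t => _) = (fun t => \sum_(k < N) (a k x.1 * b k t))).
    by have [] := is_derive_sum_scale N (fun k => a k x.1) (fun k => db k x.2).
  by apply/funext => t; rewrite tensor_sym.
- rewrite tensor_partial1//; apply: continuous_tensor => k; first by case: (ha k).
  exact: C1_in_continuous (hb k).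
- rewrite tensor_partial2//; apply: continuous_tensor => k; last by case: (hb k).
  exact: C1_in_continuous (ha k).
Qed.

Lemma C1_in_common_support (N : nat) p p' (a : nat -> R -> R) : p < p' ->
  (forall k, C1_in p p' (a k)) -> exists c d, [/\ p < c, d < p' &
    forall k t, (k < N)%N -> t < c \/ d < t -> a k t = 0].
Proof.
move=> pp' ha; elim: N => [|N [c [d [pc dp' cd]]]].
  by exists ((p + p') / 2), ((p + p') / 2); split => //; lra.
have [_ _ [c' [d' [pc' dp'' cd']]]] := ha N.
exists (Num.min c c'), (Num.max d d'); rewrite lt_min pc pc' gt_max dp' dp''; split => // k t.
rewrite ltnS leq_eqVlt => /predU1P[->|kN] h.
  by apply: cd'; case: h; rewrite ?lt_min ?gt_max => /andP[_ h]; [left|right].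
by apply: cd => //; case: h; rewrite ?lt_min ?gt_max => /andP[h _]; [left|right].
Qed.

(** Stated for any field that vanishes with the tensor, so that both (f, 0) and (0, f) are
    covered. *)
Lemma tensor_support (N : nat) p p' q q' (a b : nat -> R -> R) : p < p' -> q < q' ->
  (forall k, C1_in p p' (a k)) -> (forall k, C1_in q q' (b k)) ->
  forall phi : R * R -> R * R, (forall x, tensor N a b x = 0 -> phi x = 0) ->
  compactly_supported (open_rectangle p p' q q') phi.
Proof.
move=> pp' qq' ha hb phi hphi.
have [c [d [pc dp' cd]]] := C1_in_common_support N pp' ha.
have [c' [d' [qc' dq' cd']]] := C1_in_common_support N qq' hb.
pose K : set (R * R) := `[c, d] `*` `[c', d'].
have cK : compact K by apply: compact_setX; exact: segment_compact.
have clK : closed K by apply: compact_closed => //; exact: norm_hausdorff.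
have sK : [set x | phi x != 0] `<=` K.
  move=> x /= /eqP; apply: contra_notP => nK; apply: hphi.
  rewrite /tensor big1// => k _.
  have [h1|h1] := ltP x.1 c; first by rewrite cd ?mulr0//; left.
  have [h2|h2] := ltP d x.1; first by rewrite cd ?mulr0//; right.
  have [h3|h3] := ltP x.2 c'; first by rewrite cd' ?mul0r//; left.
  have [h4|h4] := ltP d' x.2; first by rewrite cd' ?mul0r//; right.
  by exfalso; apply: nK; split; rewrite /= in_itv/= ?h1 ?h2 ?h3 ?h4.
have sK' : closure [set x | phi x != 0] `<=` K.
  by move: clK => /closure_id ->; exact: closureS.
split.
  by apply: (subclosed_compact _ cK sK'); exact: closed_closure.
apply: subset_trans sK' _ => x [/=]; rewrite !in_itv/= => /andP[h1 h2] /andP[h3 h4].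
by split; rewrite /= in_itv/=; apply/andP; split; lra.
Qed.

Lemma partials_zero : partial1 (fun=> 0 : R) = (fun=> 0) /\ partial2 (fun=> 0 : R) = (fun=> 0).
Proof. by split; apply/funext => x; rewrite /partial1 /partial2 derive1_cst. Qed.

Lemma div2_zero x : div2 (fun=> 0 : R * R) x = 0.
Proof. by rewrite /div2/= partials_zero.1 partials_zero.2 addr0. Qed.

Lemma C1_zero : C1 (fun=> 0 : R).
Proof.
split; last by rewrite partials_zero.1 partials_zero.2; split => x; exact: cvg_cst.
by move=> x; split; exact: derivable_cst.
Qed.

Lemma compactly_supported_zero (D : set (R * R)) : compactly_supported D (fun=> 0).
Proof.
rewrite /compactly_supported (_ : [set x | _] = set0); last first.
  by apply/seteqP; split => x //=; rewrite eqxx.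
by rewrite closure0; split; [exact: compact0|].
Qed.

Lemma C1c_zero (D : set (R * R)) : C1c D (fun=> 0).
Proof. by split; [exact: C1_zero|exact: C1_zero|exact: compactly_supported_zero]. Qed.

Lemma TV_ge0 (S : set (R * R)) v : (0 <= TV S v)%E.
Proof.
apply: le_ereal_sup_tmp; exists 0%E => //; exists (fun=> 0); last first.
  under eq_integral do rewrite div2_zero mulr0.
  by rewrite integral0.
split; last by move=> x _; rewrite /enorm/= expr0n/= addr0 sqrtr0.
exact: C1c_zero.
Qed.

Lemma TV_pairing_le (S : set (R * R)) v phi : (TV S v < +oo)%E -> C1c S phi ->
  (forall x, S x -> enorm (phi x) <= 1) -> leb2.-integrable S (EFin \o (fun x => v x * div2 phi x)) ->
  measurable (S : set (mR * mR)) ->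
  \int[leb2]_(x in S) (v x * div2 phi x) <= fine (TV S v).
Proof.
move=> fin cphi phi1 jphi mS.
rewrite -lee_fin [leRHS]fineK ?ge0_fin_numE ?TV_ge0// fineK; last exact: integrable_fin_num.
by apply: ereal_sup_ubound; exists phi.
Qed.

End TensorFields.

Section TVTensorBound.
Context {R : realType}.
Local Notation mu := (@lebesgue_measure R).
Local Notation mR := (measurableTypeR R).

Lemma Rintegral_swap (f : R * R -> R) : leb2.-integrable setT (EFin \o f) ->
  \int[leb2]_z f (swap_plane z) = \int[leb2]_z f z.
Proof.
move=> jf; have jfs := integrable_swap jf.
rewrite /Rintegral; congr fine.
have E1 := integral12_prod_meas1 jfs.
have E2 := integral21_prod_meas1 jf.
by rewrite -[RHS]E2 -[LHS]E1.
Qed.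

Variables (p p' q q' : R) (v : R * R -> R).
Hypotheses (pp' : p < p') (qq' : q < q').
Let S := open_rectangle p p' q q'.
Hypothesis BVv : BV S v.

Let mS : measurable (S : set (mR * mR)) := measurable_open_rectangle p p' q q'.

Let u : R * R -> R := v \_ S.

Lemma integrable_extension : leb2.-integrable setT (EFin \o u).
Proof.
have := BVv.1; rewrite integrable_mkcond//; apply: eq_integrable => // x _.
by rewrite /u /= !patchE; case: ifP.
Qed.

Lemma pairing_extension (w : R * R -> R) (phi : R * R -> R * R) :
  C1c S phi -> (forall x, S x -> enorm (phi x) <= 1) -> div2 phi = w ->
  \int[leb2]_x (u x * w x) <= fine (TV S v).
Proof.
move=> cphi phi1 <-.
have [md [M hM]] := C1c_div2 cphi.
have jw : leb2.-integrable setT (EFin \o (fun x => u x * div2 phi x)).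
  exact: (integrable_bounded_mul integrable_extension md hM).
have E : (fun x => u x * div2 phi x) = (fun x => v x * div2 phi x) \_ S.
  by apply/funext => x; rewrite /u !patchE; case: ifP => //; rewrite mul0r.
rewrite E -Rintegral_mkcond; apply: TV_pairing_le => //; first exact: BVv.2.
rewrite integrable_mkcond//; move: jw; rewrite E; apply: eq_integrable => // x _.
by rewrite /= !patchE; case: ifP.
Qed.

(** The field (f, 0) has length at most the sum of the |s k| |z k|, hence at most 1, and its
    divergence differentiates only the factors z k. *)
Lemma TV_tensor_bound : tensor_bound u p p' q q' (fine (TV S v)).
Proof.
move=> N z s hz z1 hs s1.
pose f := tensor N z s.
have Cf : C1 f by exact: C1_tensor hz hs.
apply: (@pairing_extension _ (fun x => (f x, 0))).
- split => //=; first exact: C1_zero.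
  by apply: (tensor_support pp' qq' hz hs (N := N)) => x; rewrite -/f => ->.
- move=> x _; rewrite /enorm/= expr0n addr0 sqrtr_sqr /f /tensor.
  rewrite (le_trans (ler_norm_sum _ _ _))// (le_trans _ (s1 x.2))//.
  by apply: ler_sum => k _; rewrite normrM ler_piMr.
- apply/funext => x; rewrite /div2/= partials_zero.2 addr0 tensor_partial1//.
  by move=> k t; case: (hz k).
Qed.

(** The vertical counterpart, with the field (0, f). Exchanging the coordinates lets the results on
    horizontal slices be applied a second time. *)
Lemma TV_tensor_bound_swap :
  tensor_bound (u \o swap_plane) q q' p p' (fine (TV S v)).
Proof.
move=> N z s hz z1 hs s1.
pose f := tensor N s z.
have Cf : C1 f by exact: C1_tensor hs hz.
have H : \int[leb2]_x (u x * \sum_(k < N) (s k x.1 * (z k)^`()%classic x.2)) <= fine (TV S v).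
  apply: (@pairing_extension _ (fun x => (0, f x))).
  - split => //=; first exact: C1_zero.
    by apply: (tensor_support pp' qq' hs hz (N := N)) => x; rewrite -/f => ->.
  - move=> x _; rewrite /enorm/= expr0n add0r sqrtr_sqr /f /tensor.
    rewrite (le_trans (ler_norm_sum _ _ _))// (le_trans _ (s1 x.1))//.
    by apply: ler_sum => k _; rewrite normrM ler_piMl.
  - apply/funext => x; rewrite /div2/= partials_zero.1 add0r tensor_partial2//.
      by rewrite tensor_sym.
    by move=> k t; case: (hz k).
apply: le_trans H; rewrite le_eqVlt; apply/orP; left; apply/eqP.
apply: (@Rintegral_swap (fun x => u x * \sum_(k < N) (s k x.1 * (z k)^`()%classic x.2))).
have [md [M hM]] : measurable_fun setT ((fun x => \sum_(k < N) (s k x.1 * (z k)^`()%classic x.2)) : mR * mR -> R) /\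
    exists M : R, forall x : R * R, `|\sum_(k < N) (s k x.1 * (z k)^`()%classic x.2)| <= M.
  have cphi : C1c S (fun x => (0, f x)).
    split => //=; first exact: C1_zero.
    by apply: (tensor_support pp' qq' hs hz (N := N)) => x; rewrite -/f => ->.
  have := C1c_div2 cphi.
  rewrite (_ : div2 _ = fun x => \sum_(k < N) (s k x.1 * (z k)^`()%classic x.2))//.
  apply/funext => x; rewrite /div2/= partials_zero.1 add0r tensor_partial2//.
    by rewrite tensor_sym.
  by move=> k t; case: (hz k).
exact: (integrable_bounded_mul integrable_extension md hM).
Qed.

End TVTensorBound.

Lemma ae_conj d (T : measurableType d) (R : realType) (mu : {measure set T -> \bar R})
    (P Q : T -> Prop) : {ae mu, forall x, P x} -> {ae mu, forall x, Q x} ->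
  {ae mu, forall x, P x /\ Q x}.
Proof.
move=> [N [mN N0 hN]] [M [mM M0 hM]]; exists (N `|` M); split.
- exact: measurableU.
- by rewrite null_set_setU.
- move=> x /= /not_andP[h|h]; [left; exact: hN|right; exact: hM].
Qed.

(** * The Poincare-Sobolev inequality on squares *)

Section PoincareSobolev.
Context {R : realType}.
Local Notation mu := (@lebesgue_measure R).
Local Notation mR := (measurableTypeR R).

Lemma ae_sections (P : R * R -> Prop) : {ae leb2, forall z, P z} ->
  {ae mu, forall y, {ae mu, forall x, P (x, y)}}.
Proof.
move=> [N [mN N0 PN]].
have mI : measurable_fun setT (EFin \o \1_N : mR * mR -> \bar R).
  by apply/measurable_EFinP; exact: measurable_indic.
have I0 z : (0 <= (EFin \o \1_N : mR * mR -> \bar R) z)%E by rewrite lee_fin.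
have mG := @measurable_fun_fubini_tonelli_G _ _ _ _ _ mu (EFin \o \1_N) mI I0.
have G0 : (\int[mu]_y `|fubini_G mu (EFin \o \1_N) y| = 0)%E.
  have := fubini_tonelli2 (m1 := mu) (m2 := mu) _ mI I0.
  rewrite integral_indic// setIT -/leb2 [X in X = _]N0 => H.
  rewrite [RHS]H; apply: eq_integral => y _; rewrite gee0_abs//.
  by apply: integral_ge0 => x _; exact: I0.
have [+ _] := @ae_eq_integral_abs _ _ _ mu setT measurableT _ mG.
move=> /(_ G0).
apply: ae_mono => y /(_ I) hy.
exists (ysection N y); split; first exact: measurable_ysection.
  rewrite -[X in mu X]setIT -integral_indic//; last exact: measurable_ysection.
  move: hy; rewrite /fubini_G/= => <-; apply: eq_integral => x _ /=; rewrite !indicE.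
  by rewrite mem_ysection.
move=> x /= nP; rewrite /ysection/= inE; exact: PN.
Qed.

Lemma ae_snd (P : R -> Prop) : {ae mu, forall y, P y} -> {ae leb2, forall z : R * R, P z.2}.
Proof.
move=> [N [mN N0 PN]].
have mN2 : measurable (snd @^-1` N : set (mR * mR)).
  by rewrite -[X in measurable X]setTI; exact: measurable_snd.
have H : {ae leb2, forall z : R * R, ~ (snd @^-1` N) z}.
  apply: ae_slices => //; exists N; split => // y /=.
  apply: contra_notP => nNy; exact: aeW.
by apply: ae_mono H => z; apply: contra_notP => /PN.
Qed.

Lemma center_weight_itv (a b t : R) : a < b -> 0 <= center_weight a b t <= 4 / (b - a).
Proof.
move=> ab; rewrite bump_ge0 ?weight_scale_gt0//= (le_trans (bump_le _ _ _)) ?weight_scale_gt0//.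
by rewrite /weight_scale invf_div.
Qed.

Lemma center_weight_norm (a b t : R) : a < b -> `|center_weight a b t| <= 4 / (b - a).
Proof. by move=> ab; have /andP[h1 h2] := center_weight_itv t ab; rewrite ger0_norm. Qed.

Lemma measurable_center_weight (a b : R) : measurable_fun setT (center_weight a b : R -> R).
Proof. by apply: continuous_measurable_fun; exact: continuous_bump. Qed.

Lemma center_weight_out (a b t : R) : a < b -> ~ (a < t < b) -> center_weight a b t = 0.
Proof.
move=> ab h; apply: bump_out; first exact: weight_scale_gt0.
have [h1 h2] := weight_start_in ab.
have [|h3] := leP t (weight_start a b); first by left.
have [|h4] := leP (weight_start a b + 3 * weight_scale a b) t; first by right.
by exfalso; apply: h; rewrite (lt_trans h1 h3) (lt_trans h4 h2).
Qed.

Lemma integral_scaled_itv (k r r' : R) : 0 <= k -> r < r' ->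
  (\int[mu]_y (k * \1_(`]r, r'[%classic : set R) y)%:E = (k * (r' - r))%:E)%E.
Proof.
move=> k0 rr'.
have mJ : measurable (`]r, r'[%classic : set R) by exact: measurable_itv.
have E : mu (`]r, r'[%classic : set R) = (r' - r)%:E.
  by rewrite lebesgue_measure_itv/= lte_fin rr' -EFinD.
under eq_integral do rewrite EFinM.
rewrite integralZl//.
  rewrite integral_indic// setIT [RHS]EFinM; congr (_ * _)%E; exact: E.
apply/integrableP; split; first by apply/measurable_EFinP; exact: measurable_indic.
under eq_integral do rewrite gee0_abs ?lee_fin//.
by rewrite integral_indic// setIT (_ : _ `]r, r'[%classic = (r' - r)%:E) ?ltry.
Qed.

(** Averaging |u - n (x)| <= B (x) over x compares the horizontal mean at y with a number that does
    not depend on y. The error is at most the bound 4 / (b - a) on the weight times the integral of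
    B. *)
Lemma weighted_mean_difference (u : R * R -> R) (a b T : R) (B : R -> \bar R) (n : R -> R)
    (J : R -> Prop) :
  let w := center_weight a b in
  leb2.-integrable setT (EFin \o u) -> a < b -> 0 <= T -> measurable_fun setT B ->
  (forall x, (0 <= B x)%E) -> (\int[mu]_x B x <= T%:E)%E ->
  mu.-integrable setT (EFin \o n) ->
  {ae leb2, forall z, a < z.1 < b -> J z.2 -> (`|u z - n z.1|%:E <= B z.1)%E} ->
  {ae mu, forall y, J y ->
    `|slice_pairing u w y - \int[mu]_x (w x * n x)| <= 4 * T / (b - a)}.
Proof.
move=> w ju ab T0 mB B0 BT jn Bae.
have l0 : 0 < b - a by rewrite subr_gt0.
have l0' := ltW l0.
have l4 : (0 <= (4 / (b - a))%:E)%E by rewrite lee_fin divr_ge0.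
have mw := measurable_center_weight a b.
have wn t := center_weight_norm t ab.
have jB : mu.-integrable setT B.
  have BE : (\int[mu]_x `|B x| = \int[mu]_x B x)%E.
    by apply: eq_integral => x _; rewrite gee0_abs.
  apply/integrableP; split; first exact: mB.
  by rewrite BE; exact: (le_lt_trans BT (ltry _)).
have jwn : mu.-integrable setT (EFin \o (fun x => w x * n x)).
  have := integrable_bounded_mul jn mw wn.
  by apply: eq_integrable => // x _ /=; rewrite mulrC.
apply: ae_mono (ae_conj (ae_sections Bae) (ae_slice_integrable ju)) => y [H1 H2] yJ.
have juw : mu.-integrable setT (EFin \o (fun x => u (x, y) * w x)).
  exact: (integrable_bounded_mul H2 mw wn).
have jd : mu.-integrable setT (EFin \o (fun x => u (x, y) * w x - w x * n x)).
  by have := integrableB measurableT juw jwn; apply: eq_integrable.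
have -> : slice_pairing u w y - \int[mu]_x (w x * n x) =
    \int[mu]_x (u (x, y) * w x - w x * n x).
  exact: (esym (RintegralB measurableT juw jwn)).
rewrite -lee_fin (EFin_normr_Rintegral measurableT jd).
have mjd := measurable_int _ jd.
have jlB : mu.-integrable setT (fun x => (4 / (b - a))%:E * B x)%E by exact: integrableZl.
have aB : (\int[mu]_x ((4 / (b - a))%:E * B x) = (4 / (b - a))%:E * \int[mu]_x B x)%E.
  by rewrite integralZl.
apply: (le_trans (le_abse_integral mu measurableT mjd)).
apply: (@le_trans _ _ (\int[mu]_x ((4 / (b - a))%:E * B x))%E); last first.
  have -> : (4 * T / (b - a))%:E = ((4 / (b - a))%:E * T%:E)%E by rewrite -EFinM mulrAC.
  rewrite aB; apply: lee_pmul; [exact: l4| |exact: lexx|exact: BT].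
  by apply: integral_ge0 => x _; exact: B0.
apply: ae_ge0_le_integral.
- exact: measurableT.
- by move=> x _; exact: abse_ge0.
- by apply: measurableT_comp mjd.
- by move=> x _; rewrite mule_ge0.
- exact: measurable_int jlB.
apply: ae_mono H1 => x hx _ /=.
have [xI|/(center_weight_out ab) xw] := pselect (a < x < b); last first.
  by rewrite /w xw mulr0 mul0r subrr normr0 mule_ge0.
have hx' : (`|u (x, y) - n x|%:E <= B x)%E by exact: hx.
rewrite (_ : u (x, y) * w x - w x * n x = w x * (u (x, y) - n x)); last by ring.
have /andP[w0 w4] := center_weight_itv x ab.
by rewrite normrM EFinM (ger0_norm w0); apply: lee_pmul => //; rewrite lee_fin.
Qed.

Variables (p q l : R) (v : R * R -> R).
Hypothesis l0 : 0 < l.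
Let p' := p + l.
Let q' := q + l.
Let S := open_rectangle p p' q q'.
Hypothesis BVv : BV S v.
Let T := fine (TV S v).
Let u : R * R -> R := v \_ S.

(* u differs from its weighted horizontal (vertical) means by at most A (y) (B (x)), where
   A and B have integral at most |Dv|(S); averaging one bound turns the means of the other
   one into a constant c, and |u - c|^2 is at most (A (y) + 4 T / l) (B (x) + 4 T / l). *)
Theorem poincare_sobolev : exists c : R,
  (\int[leb2]_(x in S) ((v x - c) ^+ 2)%:E <= ((5 * fine (TV S v)) ^+ 2)%:E)%E.
Proof.
have pp' : p < p' by rewrite ltrDl.
have qq' : q < q' by rewrite ltrDl.
have ju : leb2.-integrable setT (EFin \o u) := integrable_extension BVv.
have jus := integrable_swap ju.
have T0 : 0 <= T by exact: fine_ge0 (TV_ge0 _ _).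
have [A [mA A0 AT Aae]] := slice_oscillation ju pp' qq' (TV_tensor_bound pp' qq' BVv).
have [B [mB B0 BT Bae]] := slice_oscillation jus qq' pp' (TV_tensor_bound_swap pp' qq' BVv).
set wp := center_weight p p'; set wq := center_weight q q'.
pose m y := slice_pairing u wp y.
pose n x := slice_pairing (u \o swap_plane) wq x.
have Bae' : {ae leb2, forall z, S z -> (`|u z - n z.1|%:E <= B z.1)%E}.
  apply: ae_mono (ae_swap Bae) => -[x y] H [xI yJ].
  exact: H (conj yJ xI).
have mw := @measurable_center_weight.
have wn (a b t : R) : a < b -> `|center_weight a b t| <= 4 / (b - a).
  exact: center_weight_norm.
pose c := \int[mu]_x (wp x * n x).
(* By Fubini, averaging the vertical means over x and the horizontal means over y gives the same
   number, the mean of u for the product weight. *)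
have cE : c = \int[mu]_y (wq y * m y).
  rewrite /c /m -(integral_tensor ju (mw q q') (mw p p') (fun t => wn _ _ t qq') (fun t => wn _ _ t pp')).
  rewrite /n -(integral_tensor jus (mw p p') (mw q q') (fun t => wn _ _ t pp') (fun t => wn _ _ t qq')).
  rewrite -Rintegral_swap.
    by apply: eq_Rintegral => z _ /=; rewrite /swap_plane/= -surjective_pairing [in RHS]mulrC [in RHS]mulrC (mulrC (wp _)).
  exact: (integrable_tensor jus (mw p p') (mw q q') (fun t => wn _ _ t pp') (fun t => wn _ _ t qq')).
pose k := 4 * T / l.
have l0' := ltW l0.
have k0 : 0 <= k by rewrite divr_ge0 ?mulr_ge0.
have l4 : (0 <= (4 / l)%:E)%E by rewrite lee_fin divr_ge0.
have jn : mu.-integrable setT (EFin \o n).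
  exact: (slice_pairing_integrable jus (mw q q') (fun t => wn _ _ t qq')).
have jm : mu.-integrable setT (EFin \o m).
  exact: (slice_pairing_integrable ju (mw p p') (fun t => wn _ _ t pp')).
have lp : p' - p = l by rewrite /p' addrAC subrr add0r.
have lq : q' - q = l by rewrite /q' addrAC subrr add0r.
have mc : {ae mu, forall y, q < y < q' -> `|m y - c| <= k}.
  have := @weighted_mean_difference u p p' T B n (fun y => q < y < q') ju pp' T0 mB B0 BT jn.
  rewrite lp; apply; apply: ae_mono Bae' => z H zI zJ; apply: H.
  by split; rewrite /= in_itv.
have nc : {ae mu, forall x, p < x < p' -> `|n x - c| <= k}.
  have := @weighted_mean_difference (u \o swap_plane) q q' T A m (fun x => p < x < p') jus qq' T0 mA A0 AT jm.
  rewrite lq -cE; apply; apply: ae_mono (ae_swap Aae) => z H zI zJ; apply: H.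
  by split; rewrite /= in_itv.
have mc2 : {ae leb2, forall z, S z -> (`|u z - c|%:E <= A z.2 + k%:E)%E}.
  apply: ae_mono (ae_conj Aae (ae_snd mc)) => z [h1 h2] Sz.
  have := h1 Sz; case: Sz => _; rewrite /= in_itv/= => /h2 h3 h4.
  apply: (@le_trans _ _ (`|u z - m z.2|%:E + `|m z.2 - c|%:E)%E).
    by rewrite -EFinD lee_fin; apply: ler_distD.
  by apply: leeD => //; rewrite lee_fin.
have nc2 : {ae leb2, forall z, S z -> (`|u z - c|%:E <= B z.1 + k%:E)%E}.
  apply: ae_mono (ae_conj Bae' (ae_swap (ae_snd nc))) => z [h1 h2] Sz.
  have := h1 Sz; case: Sz => + _; rewrite /= in_itv/= => /h2 h3 h4.
  apply: (@le_trans _ _ (`|u z - n z.1|%:E + `|n z.1 - c|%:E)%E).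
    by rewrite -EFinD lee_fin; apply: ler_distD.
  by apply: leeD => //; rewrite lee_fin.
exists c.
(* The constant k is not integrable over the line, so it is restricted to a side of the square. It
   adds k l = 4 T to an integral of at most T: this is the origin of the factor 5. *)
have plus_bound (C : R -> \bar R) (r r' : R) : measurable_fun setT C -> (forall y, (0 <= C y)%E) ->
    (\int[mu]_y C y <= T%:E)%E -> r' - r = l -> r < r' ->
    let C' y := (C y + (k * \1_(`]r, r'[%classic : set R) y)%:E)%E in
    [/\ measurable_fun setT C', forall y, (0 <= C' y)%E & (\int[mu]_y C' y <= (5 * T)%:E)%E].
  move=> mC C0 CT rl rr' C'.
  have mJ : measurable (`]r, r'[%classic : set R) by exact: measurable_itv.
  have i0 y : (0 <= (k * \1_(`]r, r'[%classic : set R) y)%:E)%E.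
    by rewrite lee_fin mulr_ge0.
  have mi : measurable_fun setT (fun y => (k * \1_(`]r, r'[%classic : set R) y)%:E).
    by apply/measurable_EFinP; apply: measurable_funM => //; exact: measurable_indic.
  split.
  - exact: emeasurable_funD.
  - by move=> y; rewrite adde_ge0.
  - have C0' : forall x : R, setT x -> (0 <= C x)%E by move=> x _; exact: C0.
    have i0' : forall x : R, setT x -> (0 <= (k * \1_(`]r, r'[%classic : set R) x)%:E)%E.
      by move=> x _; exact: i0.
    rewrite (ge0_integralD mu measurableT C0' mC i0' mi).
    rewrite (integral_scaled_itv k0 rr') rl.
    have -> : (5 * T)%:E = (T%:E + (k * l)%:E)%E.
      by rewrite -EFinD; congr EFin; rewrite /k divfK ?gt_eqF//; ring.
    by apply: leeD; [exact: CT|exact: lexx].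
have [ma a0 aT] := plus_bound A q q' mA A0 AT lq qq'.
have [mb b0 bT] := plus_bound B p p' mB B0 BT lp pp'.
set a := (fun y => _ + (k * \1_(`]q, q'[%classic : set R) y)%:E)%E in ma a0 aT.
set b := (fun y => _ + (k * \1_(`]p, p'[%classic : set R) y)%:E)%E in mb b0 bT.
pose ab (z : R * R) : \bar R := (a z.2 * b z.1)%E.
have mab : measurable_fun setT (ab : mR * mR -> \bar R).
  apply: emeasurable_funM; first exact: measurableT_comp ma measurable_snd.
  exact: measurableT_comp mb measurable_fst.
have ab0 z : (0 <= ab z)%E by apply: mule_ge0; [exact: a0|exact: b0].
have mS : measurable (S : set (mR * mR)) := measurable_open_rectangle p p' q q'.
have mv : measurable_fun S (v : mR * mR -> R).
  by apply/measurable_EFinP; exact: measurable_int BVv.1.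
apply: (@le_trans _ _ (\int[leb2]_(z in S) ab z)%E).
  apply: ae_ge0_le_integral.
  - exact: mS.
  - by move=> z _; rewrite lee_fin sqr_ge0.
  - by apply/measurable_EFinP; apply: measurable_funX; apply: measurable_funB.
  - by move=> z _; exact: ab0.
  - exact: measurable_funTS mab.
  apply: ae_mono (ae_conj mc2 nc2) => z [h1 h2] Sz.
  have -> : v z = u z by rewrite /u patchE mem_set.
  have {}h1 := h1 Sz; have {}h2 := h2 Sz.
  case: Sz => zI zJ.
  have ea : a z.2 = (A z.2 + k%:E)%E by rewrite /a indicE (mem_set zJ) mulr1.
  have eb : b z.1 = (B z.1 + k%:E)%E by rewrite /b indicE (mem_set zI) mulr1.
  have -> : ((u z - c) ^+ 2)%:E = (`|u z - c|%:E * `|u z - c|%:E)%E.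
    by rewrite -EFinM -expr2 real_normK// num_real.
  have uc0 : (0 <= `|u z - c|%:E)%E by rewrite lee_fin normr_ge0.
  rewrite /ab ea eb; exact: (lee_pmul uc0 uc0 h1 h2).
apply: (@le_trans _ _ (\int[leb2]_z ab z)%E).
  by apply: ge0_subset_integral; [exact: mS|exact: measurableT|exact: mab|move=> z _; exact: ab0|exact: subsetT].
rewrite /leb2 (fubini_tonelli1 _ mab ab0).
have ia0 : (0 <= \int[mu]_y a y)%E by apply: integral_ge0 => y _; exact: a0.
have ib0 : (0 <= \int[mu]_x b x)%E by apply: integral_ge0 => y _; exact: b0.
have -> : (\int[mu]_x fubini_F mu ab x = \int[mu]_x ((\int[mu]_y a y) * b x))%E.
  apply: eq_integral => x _; rewrite /fubini_F/ab/=.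
  exact: (ge0_integralZr mu measurableT ma (fun y _ => a0 y) (b0 x)).
rewrite (ge0_integralZl mu measurableT mb (fun y _ => b0 y) ia0).
rewrite expr2 EFinM; exact: (lee_pmul ia0 ib0 aT bT).
Qed.

End PoincareSobolev.

(** * Smallest minimizers on an interval *)

Section SmallestMinimizer.
Context {R : realType}.

(** A square-root modulus of continuity in the form that Young's inequality produces. Taking t
    proportional to e makes the second term small; then x and y are brought close enough for the
    first. *)
Lemma modulus_of_continuity (h : R -> R) (a b M K : R) :
  (forall t x y : R, 0 < t -> a <= x <= b -> a <= y <= b ->
    `|h x - h y| <= M * `|x - y| / t + K * t) ->
  forall e : R, 0 < e -> exists2 d : R, 0 < d &
    forall x y, a <= x <= b -> a <= y <= b -> `|x - y| < d -> `|h x - h y| < e.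
Proof.
move=> H e e0.
pose t := e / (2 * (`|K| + 1)); pose d := e * t / (2 * (`|M| + 1)).
have K1 : 0 < `|K| + 1 by rewrite ltr_wpDl.
have M1 : 0 < `|M| + 1 by rewrite ltr_wpDl.
have t0 : 0 < t by rewrite divr_gt0// mulr_gt0.
exists d; first by rewrite divr_gt0 ?mulr_gt0.
move=> x y xab yab xy; apply: (le_lt_trans (H t x y t0 xab yab)).
have Kt : K * t <= `|K| * t by rewrite ler_wpM2r ?ler_norm// ltW.
have Kt2 : `|K| * t < e / 2.
  have -> : e / 2 = (`|K| + 1) * t by rewrite /t; field; rewrite gt_eqF.
  by rewrite ltr_pM2r// ltrDl.
have Mx : M * `|x - y| <= (`|M| + 1) * `|x - y|.
  by rewrite ler_wpM2r// (le_trans (ler_norm M))// lerDl.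
have Md : (`|M| + 1) * `|x - y| < e * t / 2.
  have -> : e * t / 2 = (`|M| + 1) * d by rewrite /d; field; rewrite gt_eqF.
  by rewrite ltr_pM2l.
have : M * `|x - y| / t < e / 2.
  rewrite ltr_pdivrMr// mulrAC; exact: le_lt_trans Mx Md.
lra.
Qed.

(** The minimizers form a nonempty closed set, so their infimum is one of them. *)
Lemma smallest_minimizer_exists (h : R -> R) (a b M K : R) : a <= b ->
  (forall t x y : R, 0 < t -> a <= x <= b -> a <= y <= b ->
    `|h x - h y| <= M * `|x - y| / t + K * t) ->
  exists m, [/\ a <= m <= b, forall y, a <= y <= b -> h m <= h y &
    forall y, a <= y <= b -> (forall y', a <= y' <= b -> h y <= h y') -> m <= y].
Proof.
move=> ab H; have mod := modulus_of_continuity H.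
(* Clamping to [a, b] extends h to a continuous function on the line, although the hypothesis
   controls h on [a, b] alone. *)
pose g x := h (Num.max a (Num.min b x)).
have clamp x : a <= Num.max a (Num.min b x) <= b.
  by rewrite le_max lexx/= ge_max ab/= ge_min lexx.
have gE x : a <= x <= b -> g x = h x.
  by move=> /andP[ax xb]; rewrite /g min_r// max_r.
have cg : continuous g.
  move=> x; apply/cvgrPdist_lt => e e0; have [d d0 hd] := mod e e0.
  have := @nbhsx_ballx _ R x _ d0; apply: filterS => y xy.
  apply: hd => //; apply: le_lt_trans xy.
  rewrite ler_norml.
  have := ler_norm (x - y); have := ler_norm (- (x - y)); rewrite normrN.
  case: (leP b x) => h1; case: (leP b y) => h2; rewrite ?(max_r ab);
    case: (leP a x) => h3; case: (leP a y) => h4 h5 h6; apply/andP; split; lra.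
have [c cab hc] := EVT_min ab (continuous_subspaceT cg).
move: cab; rewrite in_itv => cab.
have {}hc y : a <= y <= b -> h c <= h y by move=> yab; rewrite -!gE// hc// in_itv.
pose S := [set y | a <= y <= b /\ h y <= h c].
have cS : S c by split => //; move: cab; rewrite in_itv.
have hiS : has_inf S.
  by split; [exists c|exists a => y [/andP[]]].
have aS : a <= inf S.
  by apply: lb_le_inf; [exists c|move=> y [/andP[]]].
have Sc : inf S <= c by apply: ge_inf => //; exists a => y [/andP[]].
have Sb : inf S <= b by rewrite (le_trans Sc)//; case: cS => /andP[].
have hS : h (inf S) <= h c.
  rewrite leNgt; apply/negP => hlt.
  have e0 : 0 < h (inf S) - h c by rewrite subr_gt0.
  have [d d0 hd] := mod _ e0.
  have [y yS yd] := inf_adherent d0 hiS.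
  have iy : inf S <= y by apply: ge_inf => //; exists a => z [/andP[]].
  have [yab hy] := yS.
  have := hd (inf S) y _ yab; rewrite aS Sb => /(_ isT).
  rewrite ler0_norm ?subr_le0// opprB ltrBlDl => /(_ yd).
  by rewrite ltr_norml => /andP[_]; lra.
exists (inf S); split.
- by rewrite aS Sb.
- by move=> y yab; rewrite (le_trans hS)// hc.
- move=> y yab hy; apply: ge_inf; first by exists a => z [/andP[]].
  by split => //; apply: hy.
Qed.

End SmallestMinimizer.

(** * Uniqueness of minimizers and their dependence on the parameter *)

Section MinimizerStability.
Context d (T : measurableType d) (R : realType)
  (mu : {measure set T -> \bar R}) (D : set T).
Hypotheses (mD : measurable D) (Dfin : (mu D < +oo)%E).
Variable Phi : set (T -> R).
Hypotheses (Phi0 : Phi (fun=> 0))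
  (PhiB : forall psi, Phi psi -> measurable_fun D psi /\
     exists K : R, forall x, D x -> `|psi x| <= K).
Variable f : T -> R.
Hypothesis hf : L2 mu D f.

Local Notation G := (dual_sup mu D Phi).
Local Notation E := (energy mu D Phi f).

(** The growth inequality is part of the notion because uniqueness and stability in [beta] both
    follow from it directly. *)
Definition strong_minimizer (beta : R) (u : T -> R) : Prop :=
  [/\ L2 mu D u, (G u < +oo)%E & forall v : T -> R, measurable_fun D v ->
    (E beta u + (2^-1 * \int[mu]_(x in D) ((u x - v x) ^+ 2))%:E <= E beta v)%E].

Lemma strong_minimizer_exists (beta : R) : 0 < beta -> exists u, strong_minimizer beta u.
Proof. by move=> beta0; have [u hu] := direct_method mD Dfin Phi0 PhiB hf beta0; exists u. Qed.

Lemma dual_sup0 : G (fun=> 0) = 0%E.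
Proof.
apply/eqP; rewrite eq_le dual_sup_ge0// andbT; apply: ge_ereal_sup => _ [psi _ <-].
by under eq_integral do rewrite mul0r; rewrite integral0.
Qed.

Lemma strong_minimizer_bound (beta : R) u : strong_minimizer beta u ->
  \int[mu]_(x in D) ((f x - u x) ^+ 2) + beta * fine (G u) <= \int[mu]_(x in D) (f x ^+ 2).
Proof.
move=> [uL uG umin]; have := umin (fun=> 0) (measurable_cst _).
have L0 : L2 mu D (fun=> 0 : R) by exact: L2_cst.
have G0 : (G (fun=> 0%R) < +oo)%E by rewrite dual_sup0 ltry.
rewrite !energyE// dual_sup0/= mulr0 addr0 -EFinD lee_fin.
under [in leRHS]eq_Rintegral do rewrite subr0.
apply: le_trans; rewrite lerDl mulr_ge0//; exact: L2_int_ge0.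
Qed.

Lemma L2_int_sub_sym (u v : T -> R) :
  \int[mu]_(x in D) ((u x - v x) ^+ 2) = \int[mu]_(x in D) ((v x - u x) ^+ 2).
Proof. by apply: eq_Rintegral => x _; rewrite -sqrrN opprB. Qed.

(** Adding the two growth inequalities cancels the distances to f and leaves |u - v|^2 <= (a - b) (G
    v - G u). Comparison with 0 puts both values of G between 0 and |f|^2 / c, so the estimate is
    uniform over all parameters above c. *)
Lemma strong_minimizer_stability (a b c : R) u v : 0 < c -> c <= a -> c <= b ->
  strong_minimizer a u -> strong_minimizer b v ->
  \int[mu]_(x in D) ((u x - v x) ^+ 2) <= ((\int[mu]_(x in D) (f x ^+ 2)) / c) * `|a - b|.
Proof.
move=> c0 ca cb hu hv; have [uL uG umin] := hu; have [vL vG vmin] := hv.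
have a0 := lt_le_trans c0 ca; have b0 := lt_le_trans c0 cb.
have := umin v (L2_measurable vL); have := vmin u (L2_measurable uL).
rewrite !energyE// -!EFinD !lee_fin (L2_int_sub_sym v u) => h1 h2.
set M := (\int[mu]_(x in D) (f x ^+ 2)) / c.
have bd (beta : R) w : c <= beta -> strong_minimizer beta w -> 0 <= fine (G w) <= M.
  move=> cbeta hw; have beta0 := lt_le_trans c0 cbeta.
  have gw0 : 0 <= fine (G w) by rewrite fine_ge0// dual_sup_ge0.
  rewrite gw0/= ler_pdivlMr//.
  have := strong_minimizer_bound hw.
  have := L2_int_ge0 mu D (fun x => f x - w x).
  have : c * fine (G w) <= beta * fine (G w) by rewrite ler_wpM2r.
  lra.
have := bd _ _ ca hu; have := bd _ _ cb hv.
move: h1 h2; set dd := \int[mu]_(x in D) ((u x - v x) ^+ 2); set gu := fine (G u); set gv := fine (G v).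
set Fu := \int[mu]_(x in D) ((f x - u x) ^+ 2); set Fv := \int[mu]_(x in D) ((f x - v x) ^+ 2).
move=> h1 h2 /andP[gv0 gvM] /andP[gu0 guM].
apply: (@le_trans _ _ ((a - b) * (gv - gu))); first by nra.
rewrite mulrC (le_trans (ler_norm _))// normrM ler_wpM2r//.
by rewrite ler_norml; apply/andP; split; lra.
Qed.

Lemma strong_minimizer_unique (beta : R) u v : 0 < beta -> strong_minimizer beta u ->
  measurable_fun D v -> (E beta v <= E beta u)%E -> ae_eq mu D v u.
Proof.
move=> beta0 [uL uG umin] mv vu.
have [|vL vG] := energy_fin mD Phi0 hf beta0 mv.
  by rewrite (le_lt_trans vu)// energyE// ltry.
have := le_trans (umin v mv) vu; rewrite energyE// -EFinD lee_fin gerDl => h.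
have int0 : \int[mu]_(x in D) ((u x - v x) ^+ 2) = 0.
  apply/eqP; rewrite eq_le L2_int_ge0 andbT; lra.
have duv := L2_sub mD uL vL.
have mduv : measurable_fun D (fun x => ((u x - v x) ^+ 2)%:E).
  by have [_ /measurable_int] := duv.
have int0' : (\int[mu]_(x in D) `|((u x - v x) ^+ 2)%:E| = 0)%E.
  transitivity (\int[mu]_(x in D) ((u x - v x) ^+ 2)%:E)%E.
    by apply: eq_integral => x _; rewrite gee0_abs// lee_fin sqr_ge0.
  by rewrite L2_intE// int0.
have [/(_ int0') + _] := @ae_eq_integral_abs _ _ _ mu D mD _ mduv.
apply: ae_mono => x H Dx; have [/eqP] := H Dx.
by rewrite sqrf_eq0 subr_eq0 => /eqP.
Qed.

End MinimizerStability.

Section L2Inequalities.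
Context d (T : measurableType d) (R : realType)
  (mu : {measure set T -> \bar R}) (D : set T).
Hypotheses (mD : measurable D) (Dfin : (mu D < +oo)%E).
Implicit Types f g h u v : T -> R.

(** Pointwise this is |A^2 - B^2| = |A - B| |A + B| with Young's inequality of weight t. The free t
    is the one in the hypothesis of [smallest_minimizer_exists]. *)
Lemma L2_cost_modulus g u v (t : R) : 0 < t -> L2 mu D g -> L2 mu D u -> L2 mu D v ->
  `|\int[mu]_(x in D) ((g x - u x) ^+ 2) - \int[mu]_(x in D) ((g x - v x) ^+ 2)| <=
  (\int[mu]_(x in D) ((u x - v x) ^+ 2)) / t +
  t * (\int[mu]_(x in D) ((g x - u x) ^+ 2) + \int[mu]_(x in D) ((g x - v x) ^+ 2)).
Proof.
move=> t0 hg hu hv.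
have j1 := L2_sqr (L2_sub mD hg hu); have j2 := L2_sqr (L2_sub mD hg hv).
have j3 := L2_sqr (L2_sub mD hu hv).
have j12 := integrableDf mD j1 j2.
have j3t := integrableZf mD t^-1 j3; have j12t := integrableZf mD t j12.
rewrite [_ / t]mulrC -(RintegralD mD j1 j2) -(RintegralB mD j1 j2).
rewrite -(RintegralZl _ mD j3) -(RintegralZl _ mD j12) -(RintegralD mD j3t j12t).
have j1_2 : mu.-integrable D (EFin \o (fun x => (g x - u x) ^+ 2 - (g x - v x) ^+ 2)).
  by have := integrableB mD j1 j2; apply: eq_integrable.
apply: (le_trans (le_normr_Rintegral mD j1_2)).
apply: le_Rintegral => //.
- by have := integrable_abse j1_2; apply: eq_integrable.
- exact: integrableDf.
move=> x _.
have -> : u x - v x = (g x - v x) - (g x - u x) by ring.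
move: (g x - u x) (g x - v x) => A B.
rewrite -(ler_pM2l t0) mulrDr mulrA divff ?gt_eqF// mul1r.
rewrite -{1}(gtr0_norm t0) -normrM ler_norml.
have := sqr_ge0 (2 * (B - A) - t * (A + B)); have := sqr_ge0 (2 * (B - A) + t * (A + B)).
have := sqr_ge0 (t * (A - B)); have := sqr_ge0 (t * (A + B)).
by move=> *; apply/andP; split; nra.
Qed.

Lemma L2_cauchy_schwarz g h (a b : R) : 0 < a -> 0 <= b -> L2 mu D g -> L2 mu D h ->
  \int[mu]_(x in D) (g x ^+ 2) <= a ^+ 2 -> \int[mu]_(x in D) (h x ^+ 2) <= b ^+ 2 ->
  \int[mu]_(x in D) (g x * h x) <= a * b.
Proof.
move=> a0 b0 hg hh ga hb.
have key (t : R) : 0 < t -> 2 * \int[mu]_(x in D) (g x * h x) <= t * a ^+ 2 + t^-1 * b ^+ 2.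
  move=> t0.
  have jg := integrableZf mD t (L2_sqr hg); have jh := integrableZf mD t^-1 (L2_sqr hh).
  have jgh := L2_mul mD hg hh.
  apply: (@le_trans _ _ (t * \int[mu]_(x in D) (g x ^+ 2) + t^-1 * \int[mu]_(x in D) (h x ^+ 2))).
    rewrite -(RintegralZl _ mD (L2_sqr hg)) -(RintegralZl _ mD (L2_sqr hh)) -(RintegralZl _ mD jgh).
    rewrite -(RintegralD mD jg jh); apply: le_Rintegral => //.
    - exact: integrableZf.
    - exact: integrableDf.
    move=> x _; rewrite -(ler_pM2l t0) mulrDr [t * (t^-1 * _)]mulrA divff ?gt_eqF// mul1r.
    by have := sqr_ge0 (t * g x - h x); nra.
  by apply: lerD; rewrite ler_pM2l ?invr_gt0.
(* The optimal t = b / a is not positive for b = 0, a case that arises from functions of zero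
   variation. There t is chosen so that t a^2 is the integral itself, and twice the integral would
   be at most the integral. *)
have [b_0|b1] := eqVneq b 0.
  rewrite b_0 mulr0 leNgt; apply/negP => I0.
  have t0 : 0 < \int[mu]_(x in D) (g x * h x) / a ^+ 2 by rewrite divr_gt0// exprn_gt0.
  have := key _ t0; rewrite divfK ?expf_neq0 ?gt_eqF// b_0 expr0n/= mulr0.
  lra.
have bp : 0 < b by rewrite lt_def b1.
have := key (b / a); rewrite divr_gt0// => /(_ isT).
have -> : b / a * a ^+ 2 = a * b by field; rewrite gt_eqF.
have -> : (b / a)^-1 * b ^+ 2 = a * b by field; rewrite !gt_eqF.
lra.
Qed.

End L2Inequalities.

Lemma continuous_pair (R : realType) (X : topologicalType) (f g : X -> R) :
  continuous f -> continuous g -> continuous (fun x => (f x, g x)).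
Proof.
move=> cf cg x.
exact: (@cvg_pair _ _ _ (nbhs x) (nbhs (f x)) (nbhs (g x)) _ _ _ f g (cf x) (cg x)).
Qed.

(** * The divergence theorem for compactly supported fields *)

Section DivergenceTheorem.
Context {R : realType}.
Local Notation mu := (@lebesgue_measure R).
Local Notation mR := (measurableTypeR R).

Lemma compact_box (K : set (R * R)) : compact K -> exists2 M : R, 0 < M &
  forall x, K x -> `|x.1| <= M /\ `|x.2| <= M.
Proof.
move=> /compact_bounded/pinfty_ex_gt0[M M0 /= hM]; exists M => // x /hM.
by rewrite prod_normE/= ge_max => /andP.
Qed.

Lemma leb2_open_rectangle (p p' q q' : R) : p < p' -> q < q' ->
  leb2 (open_rectangle p p' q q') = ((p' - p) * (q' - q))%:E.
Proof.
move=> pp' qq'.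
have mI (a b : R) : measurable (`]a, b[%classic : set mR) by exact: measurable_itv.
have lI (a b : R) : a < b -> mu (`]a, b[%classic : set R) = (b - a)%:E.
  by move=> ab; rewrite lebesgue_measure_itv/= lte_fin ab -EFinD.
rewrite EFinM -(lI _ _ pp') -(lI _ _ qq').
exact: (product_measure1E mu mu (mI p p') (mI q q')).
Qed.

Lemma integrable_bounded_box (w : R * R -> R) (M C : R) : 0 < M ->
  measurable_fun setT (w : mR * mR -> R) -> (forall x, `|w x| <= C) ->
  (forall x, ~ (`|x.1| <= M /\ `|x.2| <= M) -> w x = 0) ->
  leb2.-integrable setT (EFin \o w).
Proof.
move=> M0 mw wC w0.
pose S := open_rectangle (- M - 1) (M + 1) (- M - 1) (M + 1).
have MM : - M - 1 < M + 1 by lra.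
have mS : measurable (S : set (mR * mR)) := measurable_open_rectangle _ _ _ _.
have Sfin : (leb2 S < +oo)%E by rewrite leb2_open_rectangle// ltry.
have jS : leb2.-integrable S (EFin \o w).
  apply: (@dominated_integrable_fin _ _ _ leb2 _ mS _ (fun=> C)).
  - exact: measurable_funTS mw.
  - by move=> x _; exact: wC.
  - exact: (@integrable_constant _ _ _ leb2 _ mS Sfin C).
move: jS; rewrite integrable_mkcond//; apply: eq_integrable => // x _.
rewrite patchE; have [//|/negP xS] := boolP (x \in S).
rewrite /= w0// => -[]; rewrite !ler_norml => /andP[h1 h2] /andP[h3 h4]; apply: xS.
by rewrite inE; split; rewrite /= in_itv/=; apply/andP; split; lra.
Qed.

Lemma Rintegral_section0 (w : R * R -> R) : leb2.-integrable setT (EFin \o w) ->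
  (forall y, \int[mu]_x w (x, y) = 0) ->
  (forall y, mu.-integrable setT (EFin \o (fun x => w (x, y)))) ->
  \int[leb2]_x w x = 0.
Proof.
move=> jw w0 jy; have E2 := integral21_prod_meas1 jw.
rewrite /Rintegral -[X in fine X]E2 (_ : (\int[mu]_y _ = 0)%E)//.
transitivity (\int[mu]_(y in setT) (0 : \bar R))%E; last exact: integral0.
apply: eq_integral => y _.
have := w0 y; rewrite /Rintegral => h.
by rewrite /fubini_G/= -[LHS]fineK ?h//; exact: integrable_fin_num (jy y).
Qed.

(** On each horizontal line f has compact support, so its derivative integrates to 0 there; Fubini
    does the rest. *)
Lemma partial1_integral0 (f : R * R -> R) (K : set (R * R)) : C1 f -> compact K ->
  (forall x, ~ K x -> f x = 0) -> leb2.-integrable setT (EFin \o partial1 f) /\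
  \int[leb2]_x partial1 f x = 0.
Proof.
move=> [df [c1 c2]] cK f0.
have [M M0 hM] := compact_box cK.
have clK : closed K by apply: compact_closed => //; exact: norm_hausdorff.
have sK : closure [set x | f x != 0] `<=` K.
  rewrite [X in _ `<=` X](closure_id K).1//; apply: closureS => x /= /eqP.
  by apply: contra_notP => /f0.
have p0 x : ~ K x -> partial1 f x = 0.
  by move=> nK; have [] := @partials_out _ f x (fun h => nK (sK _ h)).
have out x : ~ (`|x.1| <= M /\ `|x.2| <= M) -> ~ K x by move=> h /hM.
have [C hC] := continuous_compact_bound c1 cK p0.
have j : leb2.-integrable setT (EFin \o partial1 f).
  apply: (integrable_bounded_box M0 (continuous_measurable_plane c1) hC) => x.
  by move=> /out/p0.
have cx y : continuous (fun x => partial1 f (x, y)).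
  move=> x; apply: (@continuous_comp _ _ _ (fun x => (x, y)) (partial1 f)); last exact: c1.
  by apply: (@continuous_pair R R id (cst y)) => z; [exact: cvg_id|exact: cvg_cst].
have o1 y t : t < - M - 1 \/ M + 1 < t -> ~ K (t, y).
  by move=> h; apply: out => /= -[]; rewrite ler_norml => /andP[h1 h2] _; case: h; lra.
have MM : - M - 1 < M + 1 by lra.
split => //; apply: Rintegral_section0 => // y.
  have dF (x : R) : is_derive x 1 (fun t => f (t, y)) (partial1 f (x, y)).
    rewrite /partial1 derive1E; apply: derivableP; exact: (df (x, y)).1.
  rewrite (integral_compact_support MM (cx y) dF).
    rewrite !f0 ?subr0//; apply: out => /= -[]; rewrite ler_norml => /andP[h1 h2] _; lra.
  by move=> t /(o1 y)/p0.
by apply: (integrable_compact_support (cx y)) => t /(o1 y)/p0.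
Qed.

Lemma C1_swap (f : R * R -> R) : C1 f -> C1 (f \o swap_plane).
Proof.
have cs : continuous (@swap_plane R).
  by apply: continuous_pair => z; [exact: cvg_snd|exact: cvg_fst].
move=> [df [c1 c2]]; split; last split.
- by move=> x; have [h1 h2] := df (swap_plane x).
- rewrite (_ : partial1 _ = partial2 f \o swap_plane)//.
  by move=> x; apply: continuous_comp; [exact: cs|exact: c2].
- rewrite (_ : partial2 _ = partial1 f \o swap_plane)//.
  by move=> x; apply: continuous_comp; [exact: cs|exact: c1].
Qed.

Lemma partial2_integral0 (f : R * R -> R) (K : set (R * R)) : C1 f -> compact K ->
  (forall x, ~ K x -> f x = 0) -> leb2.-integrable setT (EFin \o partial2 f) /\
  \int[leb2]_x partial2 f x = 0.
Proof.
move=> Cf cK f0.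
have cs : continuous (@swap_plane R).
  by apply: continuous_pair => z; [exact: cvg_snd|exact: cvg_fst].
have cK' : compact (swap_plane @` K).
  by apply: continuous_compact => //; exact: continuous_subspaceT.
have f0' x : ~ (swap_plane @` K) x -> (f \o swap_plane) x = 0.
  move=> h; apply: f0 => Kx; apply: h; exists (swap_plane x) => //.
  by case: x {Kx}.
have [j i0] := partial1_integral0 (C1_swap Cf) cK' f0'.
have E : partial2 f = partial1 (f \o swap_plane) \o swap_plane by [].
split; first by rewrite E; exact: integrable_swap.
by rewrite E; rewrite -[RHS]i0; exact: Rintegral_swap.
Qed.

Lemma divergence_theorem (D : set (R * R)) phi : C1c D phi ->
  leb2.-integrable setT (EFin \o div2 phi) /\ \int[leb2]_x div2 phi x = 0.
Proof.
move=> [C_1 C_2 [cK _]].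
have o1 x : ~ closure [set x | phi x != 0] x -> phi x = 0.
  by move=> h; apply: contrapT => /eqP hx; apply: h; exact: subset_closure.
have [j1 i1] := partial1_integral0 C_1 cK (fun x h => f_equal fst (o1 x h)).
have [j2 i2] := partial2_integral0 C_2 cK (fun x h => f_equal snd (o1 x h)).
split; first exact: (integrableDf measurableT j1 j2).
by have := RintegralD measurableT j1 j2; rewrite i1 i2 addr0.
Qed.

(** The divergence of an admissible field vanishes off S, so its integral over S is the one over the
    plane, which is 0. This is what lets a mean value compete at level 3 at no cost in variation. *)
Lemma TV_cst (S : set (R * R)) (c : R) : measurable (S : set (mR * mR)) ->
  TV S (fun=> c) = 0%E.
Proof.
move=> mS; apply/eqP; rewrite eq_le TV_ge0 andbT.
apply: ge_ereal_sup => _ [phi [cphi _] <-].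
have [j i0] := divergence_theorem cphi.
have out x : ~ S x -> div2 phi x = 0.
  move: cphi => [C_1 C_2 [cK KS]] nS.
  have nK : ~ closure [set x | phi x != 0] x by move=> /KS.
  have o (g : R * R -> R) : (forall y, phi y = 0 -> g y = 0) -> partial1 g x = 0 /\ partial2 g x = 0.
    move=> gphi; apply: partials_out => /closureS H; apply: nK; apply: H.
    by move=> y /=; apply: contra_neq => /gphi.
  rewrite /div2 (o (fun y => (phi y).1) _).1 ?(o (fun y => (phi y).2) _).2 ?addr0//.
    by move=> y ->.
  by move=> y ->.
have jS : leb2.-integrable S (EFin \o div2 phi).
  exact: integrableS measurableT mS (@subsetT _ _) j.
under eq_integral do rewrite EFinM.
rewrite integralZl//.
have -> : (\int[leb2]_(x in S) (div2 phi x)%:E = 0)%E.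
  rewrite integral_mkcond.
  transitivity (\int[leb2]_x (div2 phi x)%:E)%E.
    apply: eq_integral => x _; rewrite patchE; have [//|/negP nS] := boolP (x \in S).
    by rewrite out// => h; apply: nS; exact: mem_set.
  by rewrite -[LHS]fineK; [rewrite -/(Rintegral _ _ _) i0|exact: integrable_fin_num j].
by rewrite mule0.
Qed.

End DivergenceTheorem.

(** * The two variations as instances of the abstract one *)

Section Tests.
Context {R : realType}.
Local Notation mR := (measurableTypeR R).

Definition TV_tests (S : set (R * R)) : set (R * R -> R) :=
  div2 @` [set phi | C1c S phi /\ forall x, S x -> enorm (phi x) <= 1].

Definition TVw_tests (w : R * R -> R) (S : set (R * R)) : set (R * R -> R) :=
  div2 @` [set phi | Lipc S phi /\ forall x, S x -> enorm (phi x) <= w x].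

Lemma TV_dual_sup S v : TV S v = dual_sup leb2 S (TV_tests S) v.
Proof. by rewrite /TV /dual_sup /TV_tests image_comp. Qed.

Lemma TVw_dual_sup w S v : TVw w S v = dual_sup leb2 S (TVw_tests w S) v.
Proof. by rewrite /TVw /dual_sup /TVw_tests image_comp. Qed.

Lemma div2_zero_fun : div2 (fun=> 0 : R * R) = (fun=> 0).
Proof. by apply/funext => x; exact: div2_zero. Qed.

Lemma TV_tests0 S : TV_tests S (fun=> 0).
Proof.
exists (fun=> 0); last exact: div2_zero_fun.
by split; [exact: C1c_zero|move=> x _; rewrite /enorm/= expr0n/= addr0 sqrtr0].
Qed.

Lemma lipschitz_zero : lipschitz ((fun=> 0) : R * R -> R * R).
Proof.
exists 0; split => // M M0 x _ /=.
by rewrite subrr normr0 mulr_ge0// ltW.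
Qed.

Lemma TVw_tests0 w S : (forall x, S x -> 0 <= w x) -> TVw_tests w S (fun=> 0).
Proof.
move=> w0; exists (fun=> 0); last exact: div2_zero_fun.
split; first by split; [exact: lipschitz_zero|exact: compactly_supported_zero].
by move=> x Sx; rewrite /enorm/= expr0n/= addr0 sqrtr0 w0.
Qed.

Lemma TV_tests_bounded S psi : TV_tests S psi ->
  measurable_fun (S : set (mR * mR)) psi /\ exists K : R, forall x, S x -> `|psi x| <= K.
Proof.
move=> [phi [cphi _] <-]; have [m [K hK]] := C1c_div2 cphi.
by split; [exact: measurable_funTS m|exists K => x _; exact: hK].
Qed.

Lemma TVw_tests_bounded w S psi : TVw_tests w S psi ->
  measurable_fun (S : set (mR * mR)) psi /\ exists K : R, forall x, S x -> `|psi x| <= K.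
Proof.
move=> [phi [cphi _] <-]; have [m [K hK]] := Lipc_div2 cphi.
by split; [exact: measurable_funTS m|exists K => x _; exact: hK].
Qed.

(** A strong minimizer is compared with all measurable functions, whereas the definitions minimize
    over [BV] or [BVw]. The class A therefore enters only through the measurability of its members
    and the membership of u. *)
Lemma strong_unique_minimizer (S : set (R * R)) (Phi A : set (R * R -> R)) J f (alpha : R) u :
  measurable (S : set (mR * mR)) -> (leb2 S < +oo)%E -> Phi (fun=> 0) ->
  (forall psi, Phi psi -> measurable_fun (S : set (mR * mR)) psi /\
     exists K : R, forall x, S x -> `|psi x| <= K) ->
  L2 leb2 S f -> 0 < alpha -> (forall v, J v = energy leb2 S Phi f alpha v) ->
  (forall v, A v -> measurable_fun (S : set (mR * mR)) v) -> A u ->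
  strong_minimizer leb2 S Phi f alpha u -> unique_minimizer S A J u.
Proof.
move=> mS Sfin Phi0 PhiB hf a0 JE Am Au hu.
split => //.
- move=> v Av; rewrite !JE; have [_ _ umin] := hu.
  apply: le_trans (umin v (Am v Av)); rewrite leeDl// lee_fin mulr_ge0//; exact: L2_int_ge0.
- move=> v Av vmin; apply: (strong_minimizer_unique mS Phi0 hf a0 hu (Am v Av)).
  by rewrite -!JE; exact: vmin.
Qed.

Lemma ae_eq_sqdist (S : set (R * R)) (g u v : R * R -> R) : measurable (S : set (mR * mR)) ->
  measurable_fun (S : set (mR * mR)) g -> measurable_fun (S : set (mR * mR)) u ->
  measurable_fun (S : set (mR * mR)) v -> ae_eq leb2 S u v -> sqdist S g u = sqdist S g v.
Proof.
move=> mS mg mu_ mv uv.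
have mgx (w : R * R -> R) : measurable_fun (S : set (mR * mR)) w ->
    measurable_fun (S : set (mR * mR)) (fun x => (`|g x - w x| ^+ 2)%:E).
  move=> mw; apply/measurable_EFinP; apply: measurable_funX.
  by apply: measurableT_comp => //; exact: measurable_funB.
apply: ae_eq_integral; [exact: mS|exact: mgx|exact: mgx|].
by apply: ae_mono uv => x h Sx; rewrite h.
Qed.

End Tests.

(** * Level 3: existence and uniqueness of the parameter of a square *)

Section Level3.
Context {R : realType}.
Local Notation mR := (measurableTypeR R).
Variables (p q l : R) (ueta uc : R * R -> R) (c0 : R).
Hypotheses (l0 : 0 < l) (c01 : 0 < c0 < 1).
Let S := open_rectangle p (p + l) q (q + l).
Hypotheses (hueta : L2 leb2 S ueta) (huc : L2 leb2 S uc).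
Variable L : set (R * R).
Hypothesis LS : L° = S.

Let mS : measurable (S : set (mR * mR)) := measurable_open_rectangle _ _ _ _.

Let pl : p < p + l. Proof. by rewrite ltrDl. Qed.
Let ql : q < q + l. Proof. by rewrite ltrDl. Qed.

Let Sfin : (leb2 S < +oo)%E.
Proof. by rewrite leb2_open_rectangle// ltry. Qed.

Let c0_gt0 : 0 < c0. Proof. by case/andP: c01. Qed.

Let c0_le : c0 <= c0^-1.
Proof. by case/andP: c01 => h1 /ltW h2; rewrite (le_trans h2)// invf_ge1. Qed.

Local Notation SM := (strong_minimizer leb2 S (TV_tests S) ueta).

Lemma level3_strong (alpha : R) u : 0 < alpha -> SM alpha u -> level3_solution ueta L alpha u.
Proof.
move=> a0 hu; rewrite /level3_solution LS.
apply: (strong_unique_minimizer mS Sfin (TV_tests0 S) (@TV_tests_bounded _ S) hueta a0 _ _ _ hu).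
- by move=> v; rewrite /energy -TV_dual_sup.
- by move=> v [/measurable_int/measurable_EFinP].
- have [uL uT _] := hu; split; first exact: (L2_integrable mS Sfin uL).
  by rewrite TV_dual_sup.
Qed.

Lemma SM_family : exists u : R -> (R * R -> R), forall alpha, 0 < alpha -> SM alpha (u alpha).
Proof.
have /choice[u hu] : forall alpha : R, exists u, 0 < alpha -> SM alpha u.
  move=> alpha; have [a0|a0] := ltP 0 alpha; last by exists (fun=> 0).
  have [u hu] := strong_minimizer_exists mS Sfin (TV_tests0 S) (@TV_tests_bounded _ S) hueta a0.
  by exists u.
by exists u.
Qed.

Lemma sqdist_L2 u : L2 leb2 S u ->
  sqdist S uc u = (\int[leb2]_(x in S) ((uc x - u x) ^+ 2))%:E.
Proof.
move=> uL; rewrite -L2_intE//; last exact: L2_sub.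
by apply: eq_integral => x _; rewrite real_normK// num_real.
Qed.

(** [L2_cost_modulus] and the stability of minimizers give the cost the modulus that
    [smallest_minimizer_exists] asks for: stability supplies the constant M / c0, and a uniform
    bound H on the cost supplies 2 H. *)
Lemma level3_parameter_exists : exists a, level3_parameter ueta uc c0 L a.
Proof.
have [u hu] := SM_family.
have uL alpha : 0 < alpha -> L2 leb2 S (u alpha) by move=> /hu[].
pose h alpha := \int[leb2]_(x in S) ((uc x - u alpha x) ^+ 2).
pose M := \int[leb2]_(x in S) (ueta x ^+ 2).
(* From |uc - u|^2 <= 2 |uc - ueta|^2 + 2 |ueta - u|^2, where |ueta - u|^2 is at most |ueta|^2 by
   comparison of u with 0. *)
pose H := 2 * \int[leb2]_(x in S) ((uc x - ueta x) ^+ 2) + 2 * M.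
have hH alpha : 0 < alpha -> h alpha <= H.
  move=> a0; have bd := strong_minimizer_bound mS Sfin (TV_tests0 S) hueta (hu alpha a0).
  have F1 : \int[leb2]_(x in S) ((ueta x - u alpha x) ^+ 2) <= M.
    apply: le_trans bd; rewrite lerDl mulr_ge0 ?(ltW a0)//.
    by apply: fine_ge0; apply: dual_sup_ge0; exact: TV_tests0.
  have j1 := L2_sqr (L2_sub mS huc hueta); have j2 := L2_sqr (L2_sub mS hueta (uL _ a0)).
  have j3 := L2_sqr (L2_sub mS huc (uL _ a0)).
  have j1' := integrableZf mS 2 j1; have j2' := integrableZf mS 2 j2.
  apply: (@le_trans _ _ (2 * \int[leb2]_(x in S) ((uc x - ueta x) ^+ 2) +
     2 * \int[leb2]_(x in S) ((ueta x - u alpha x) ^+ 2))); last by rewrite lerD2l ler_pM2l.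
  rewrite -(RintegralZl _ mS j1) -(RintegralZl _ mS j2) -(RintegralD mS j1' j2').
  apply: (le_Rintegral mS j3 (integrableDf mS j1' j2')) => x _.
  have -> : uc x - u alpha x = (uc x - ueta x) + (ueta x - u alpha x) by ring.
  by have := sqr_ge0 ((uc x - ueta x) - (ueta x - u alpha x)); nra.
have [a [aI amin asm]] : exists m, [/\ c0 <= m <= c0^-1,
    forall y, c0 <= y <= c0^-1 -> h m <= h y &
    forall y, c0 <= y <= c0^-1 -> (forall y', c0 <= y' <= c0^-1 -> h y <= h y') -> m <= y].
  apply: (@smallest_minimizer_exists _ h c0 c0^-1 (M / c0) (2 * H)) => // t x y t0 /andP[cx _] /andP[cy _].
  have x0 := lt_le_trans c0_gt0 cx; have y0 := lt_le_trans c0_gt0 cy.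
  apply: (le_trans (L2_cost_modulus mS t0 huc (uL _ x0) (uL _ y0))).
  apply: lerD.
    rewrite ler_pM2r ?invr_gt0//.
    exact: (strong_minimizer_stability mS Sfin (TV_tests0 S) hueta c0_gt0 cx cy (hu _ x0) (hu _ y0)).
  rewrite [leRHS]mulrC ler_pM2l// mulrDl mul1r.
  by rewrite lerD// hH.
have pos y : `[c0, c0^-1]%classic y -> 0 < y.
  by rewrite /= in_itv/= => /andP[/(lt_le_trans c0_gt0)].
exists a; exists u; first by move=> alpha a0; apply: level3_strong => //; exact: hu.
rewrite LS; split.
- by rewrite /= in_itv.
- move=> b hb; rewrite !sqdist_L2 ?lee_fin; first by apply: amin; move: hb; rewrite /= in_itv.
    exact: uL (pos _ hb).
  by apply: uL; apply: pos; rewrite /= in_itv.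
- move=> b hb bmin; apply: asm; first by move: hb; rewrite /= in_itv.
  move=> y hy; have hy' : `[c0, c0^-1]%classic y by rewrite /= in_itv.
  have := bmin y hy'; rewrite !sqdist_L2 ?lee_fin//; first exact: uL (pos _ hy').
  exact: uL (pos _ hb).
Qed.

(** Each parameter comes with its own family of minimizers. Two families differ on null sets at
    most, so they have the same costs on the box and the same smallest minimizer. *)
Lemma level3_parameter_unique a b : level3_parameter ueta uc c0 L a ->
  level3_parameter ueta uc c0 L b -> a = b.
Proof.
move=> [u hu] + [v hv] +; rewrite LS => -[aI amin asm] [bI bmin bsm].
have pos y : `[c0, c0^-1]%classic y -> 0 < y.
  by rewrite /= in_itv/= => /andP[/(lt_le_trans c0_gt0)].
have mBV (w : R * R -> R) : BV S w -> measurable_fun (S : set (mR * mR)) w by move=> [/measurable_int/measurable_EFinP].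
have E y : `[c0, c0^-1]%classic y -> sqdist S uc (u y) = sqdist S uc (v y).
  move=> /pos y0; have := hu y y0; have := hv y y0; rewrite /level3_solution LS.
  move=> [Av vmin _] [Au _ uuni].
  apply: ae_eq_sqdist; [exact: mS|exact: L2_measurable huc|exact: mBV|exact: mBV|].
  by apply: ae_mono (uuni _ Av vmin) => x h /h ->.
apply/eqP; rewrite eq_le; apply/andP; split.
- by apply: asm => // y hy; rewrite !E//; exact: bmin.
- by apply: bsm => // y hy; rewrite -!E//; exact: amin.
Qed.

End Level3.

(** * Level 3 on squares where [ueta] is small *)

Section Level3Small.
Context {R : realType}.
Local Notation mR := (measurableTypeR R).
Variables (p q l : R) (ueta uc : R * R -> R) (c0 : R).
Hypotheses (l0 : 0 < l) (c01 : 0 < c0 < 1).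
Let S := open_rectangle p (p + l) q (q + l).
Hypotheses (hueta : L2 leb2 S ueta) (huc : L2 leb2 S uc).

Let mS : measurable (S : set (mR * mR)) := measurable_open_rectangle _ _ _ _.

Let pl : p < p + l. Proof. by rewrite ltrDl. Qed.
Let ql : q < q + l. Proof. by rewrite ltrDl. Qed.

Let leb2S : leb2 S = (l * l)%:E.
Proof. by rewrite leb2_open_rectangle// !(addrAC _ l) !subrr !add0r. Qed.

Let Sfin : (leb2 S < +oo)%E.
Proof. by rewrite leb2S ltry. Qed.

Let c0_gt0 : 0 < c0. Proof. by case/andP: c01. Qed.

Lemma BV_cst (m : R) : BV S (fun=> m).
Proof. by split; [exact: integrable_constant|rewrite TV_cst// ltry]. Qed.

(** The Poincare-Sobolev inequality puts v - c in L2, and constants are there because the square has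
    finite measure. *)
Lemma BV_L2 v : BV S v -> exists c : R, L2 leb2 S v /\
  L2 leb2 S (fun x => v x - c) /\
  \int[leb2]_(x in S) ((v x - c) ^+ 2) <= (5 * fine (TV S v)) ^+ 2.
Proof.
move=> hv; have [c hc] := poincare_sobolev l0 hv.
have mv : measurable_fun (S : set (mR * mR)) v by case: hv => /measurable_int/measurable_EFinP.
have vcL : L2 leb2 S (fun x => v x - c).
  apply: L2P; first exact: measurable_funB.
  by rewrite (le_lt_trans hc)// ltry.
exists c; split; last split => //.
  have := L2_add mS vcL (L2_cst mS Sfin c).
  by rewrite (_ : (fun x => _) = v)//; apply/funext => x; rewrite subrK.
by rewrite -lee_fin -L2_intE.
Qed.

Let m := (\int[leb2]_(x in S) ueta x) / (l * l).
Let g x := ueta x - m.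

Let gL : L2 leb2 S g. Proof. exact: (L2_sub mS hueta (L2_cst mS Sfin m)). Qed.

Let int_cst (r : R) : \int[leb2]_(x in S) r = r * (l * l).
Proof. by rewrite Rintegral_cst// [X in fine X]leb2S. Qed.

Let int_g : \int[leb2]_(x in S) g x = 0.
Proof.
have j := L2_integrable mS Sfin hueta.
have := RintegralB mS j (integrable_constant mS Sfin m).
rewrite /g => ->; rewrite int_cst /m divfK ?subrr//.
by rewrite mulf_neq0// gt_eqF.
Qed.

Let int_g2 : \int[leb2]_(x in S) (g x ^+ 2) <= \int[leb2]_(x in S) (ueta x ^+ 2).
Proof.
have mL := L2_cst mS Sfin m.
have := L2_expand mS gL mL.
have -> : \int[leb2]_(x in S) ((g x + m) ^+ 2) = \int[leb2]_(x in S) (ueta x ^+ 2).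
  by apply: eq_Rintegral => x _; rewrite /g subrK.
have -> : \int[leb2]_(x in S) (g x * m) = 0.
  rewrite (RintegralZr m mS (L2_integrable mS Sfin gL)) int_g mul0r//.
have := L2_int_ge0 leb2 S (fun=> m).
lra.
Qed.

(** In the expansion of |ueta - v|^2 around the mean m, only the cross term can be negative. As g =
    ueta - m is orthogonal to constants, that term is -2 <g, v - c>. By Cauchy-Schwarz it is at
    least -2 (c0 / 10) 5 TV(v) = -c0 TV(v), which alpha TV(v) absorbs; hence the 10. *)
Lemma mean_minimizes (alpha : R) v : c0 <= alpha ->
  \int[leb2]_(x in S) (ueta x ^+ 2) <= (c0 / 10) ^+ 2 -> BV S v ->
  (sqdist S ueta (fun=> m) + alpha%:E * TV S (fun=> m) <=
   sqdist S ueta v + alpha%:E * TV S v)%E.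
Proof.
move=> ca small hv; have [c [vL [vcL vc]]] := BV_L2 hv.
set t := fine (TV S v) in vc.
have TVt : TV S v = t%:E by rewrite /t fineK// ge0_fin_numE ?TV_ge0//; case: hv.
have t0 : 0 <= t by apply: fine_ge0; exact: TV_ge0.
rewrite TV_cst// mule0 adde0 TVt -EFinM.
rewrite (sqdist_L2 hueta (L2_cst mS Sfin m)) (sqdist_L2 hueta vL).
rewrite -EFinD lee_fin.
have hm := L2_sub mS (L2_cst mS Sfin m) vL.
have := L2_expand mS gL hm.
have -> : \int[leb2]_(x in S) ((g x + (m - v x)) ^+ 2) = \int[leb2]_(x in S) ((ueta x - v x) ^+ 2).
  by apply: eq_Rintegral => x _; congr (_ ^+ 2); rewrite /g; ring.
move=> ->.
have E : \int[leb2]_(x in S) (g x * (m - v x)) = - \int[leb2]_(x in S) (g x * (v x - c)).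
  have j1 := L2_integrable mS Sfin gL; have j2 := L2_mul mS gL vcL.
  have j1' := integrableZf mS (m - c) j1.
  transitivity (\int[leb2]_(x in S) ((m - c) * g x - g x * (v x - c))).
    by apply: eq_Rintegral => x _; ring.
  by rewrite (RintegralB mS j1' j2) (RintegralZl _ mS j1) int_g mulr0 sub0r.
have CS : \int[leb2]_(x in S) (g x * (v x - c)) <= c0 / 10 * (5 * t).
  apply: L2_cauchy_schwarz => //.
  - by rewrite divr_gt0.
  - by rewrite mulr_ge0.
  - exact: le_trans int_g2 small.
have := L2_int_ge0 leb2 S (fun x => m - v x).
have : c0 * t <= alpha * t by rewrite ler_wpM2r.
rewrite E /g; lra.
Qed.

Lemma level3_parameter_small L a : L° = S ->
  \int[leb2]_(x in S) (ueta x ^+ 2) <= (c0 / 10) ^+ 2 ->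
  level3_parameter ueta uc c0 L a -> a = c0.
Proof.
move=> LS small [u hu]; rewrite LS => -[aI amin asm].
have pos y : `[c0, c0^-1]%classic y -> c0 <= y /\ 0 < y.
  by rewrite /= in_itv/= => /andP[h _]; split => //; exact: lt_le_trans h.
have mBV (w : R * R -> R) : BV S w -> measurable_fun (S : set (mR * mR)) w by move=> [/measurable_int/measurable_EFinP].
have E y : `[c0, c0^-1]%classic y -> sqdist S uc (u y) = sqdist S uc (fun=> m).
  move=> /pos[cy y0]; have := hu y y0; rewrite /level3_solution LS => -[Au _ uuni].
  (* The mean is a minimizer and minimizers are unique up to null sets, so [u y] is the mean for
     every y in the box. *)
  have H := uuni _ (BV_cst m) (fun v hv => mean_minimizes cy small hv).
  apply: ae_eq_sqdist; [exact: mS|exact: L2_measurable huc|exact: mBV|exact: mBV (BV_cst m)|].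
  by apply: ae_mono H => x h /h ->.
have cI : `[c0, c0^-1]%classic c0.
  rewrite /= in_itv/= lexx/=; case/andP: c01 => h1 /ltW h2.
  by rewrite (le_trans h2)// invf_ge1.
apply/eqP; rewrite eq_le; apply/andP; split; last by case: (pos _ aI).
by apply: asm => // y hy; rewrite !E.
Qed.

End Level3Small.

(** * Level 2: minimizers for a given weight *)

Section Level2.
Context {R : realType}.
Local Notation mR := (measurableTypeR R).

Lemma Q_open_rectangle : @Q R = open_rectangle 0 (0 + 1) 0 (0 + 1).
Proof.
by rewrite add0r; apply/seteqP; split => -[x y]; rewrite /Q /open_rectangle/= !in_itv.
Qed.

Lemma measurable_Q : measurable (Q : set (mR * mR)).
Proof. by rewrite Q_open_rectangle; exact: measurable_open_rectangle. Qed.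

Lemma leb2_Q_fin : (leb2 (@Q R) < +oo)%E.
Proof. by rewrite Q_open_rectangle leb2_open_rectangle ?addr0 ?add0r// ?ltry. Qed.

(** The abstract energy is taken with factor 1, as the parameters sit in the weight. The bound K
    gives the integrability of |u| w for the minimizer u, which is known to be in L2. *)
Lemma level2_minimizer_exists (ueta w : R * R -> R) (K : R) :
  L2 leb2 (Q : set (mR * mR)) ueta -> measurable_fun (Q : set (mR * mR)) w ->
  (forall x, Q x -> 0 <= w x <= K) ->
  exists u, unique_minimizer Q (BVw w Q) (fun v => sqdist Q ueta v + TVw w Q v)%E u.
Proof.
move=> hueta mw w0K.
have w0 x : Q x -> 0 <= w x by move=> /w0K/andP[].
have [u hu] := strong_minimizer_exists measurable_Q leb2_Q_fin (TVw_tests0 w0)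
  (@TVw_tests_bounded _ w Q) hueta (@ltr01 R).
exists u.
apply: (strong_unique_minimizer measurable_Q leb2_Q_fin (TVw_tests0 w0)
  (@TVw_tests_bounded _ w Q) hueta (@ltr01 R) _ _ _ hu).
- by move=> v; rewrite /energy mul1e -TVw_dual_sup.
- by move=> v [].
have [uL udual _] := hu.
have mu_ := L2_measurable uL.
split => //; last by rewrite TVw_dual_sup.
have iu := integrable_abse (L2_integrable measurable_Q leb2_Q_fin uL).
have iK := integrableZr measurable_Q K iu.
have /integrableP[_ iK'] := iK.
apply: le_lt_trans iK'.
apply: ge0_le_integral.
- exact: measurable_Q.
- by move=> x Qx; rewrite lee_fin mulr_ge0// w0.
- apply/measurable_EFinP; apply: measurable_funM => //; exact: measurableT_comp.
- apply: measurableT_comp => //; exact: measurable_int iK.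
- move=> x Qx /=; rewrite lee_fin normrM normr_id.
  apply: ler_wpM2l => //; have /andP[wx0 /le_trans->//] := w0K x Qx.
  exact: ler_norm.
Qed.

End Level2.

(** * Dyadic squares and their finiteness at each scale *)

Section DyadicBox.
Context {R : realType}.
Local Notation mR := (measurableTypeR R).
Implicit Types (k i j : nat) (L : set (R * R)).

Definition dyadic_box k i j : set (R * R) :=
  (`]i%:R / 2 ^+ k, i%:R / 2 ^+ k + 2 ^- k] `*` `]j%:R / 2 ^+ k, j%:R / 2 ^+ k + 2 ^- k])
  `&` Q.

Lemma dyadic_index (k : nat) (i : int) : 0 <= (i%:~R / 2 ^+ k : R) < 1 ->
  exists2 n : nat, (n < 2 ^ k)%N & i = n%:Z.
Proof.
have p2 : 0 < 2 ^+ k :> R by rewrite exprn_gt0.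
rewrite ler_pdivlMr// mul0r ltr_pdivrMr// mul1r ler0z.
case: i => // n /andP[_ h]; exists n => //.
by move: h; rewrite -[X in _ < X]natrX -pmulrn ltr_nat.
Qed.

Lemma dyadic_squareP L : dyadic_square L ->
  exists k i j, [/\ (i < 2 ^ k)%N, (j < 2 ^ k)%N & L = dyadic_box k i j].
Proof.
move=> [k [i [j /= [/dyadic_index[i' hi ->] /dyadic_index[j' hj ->] ->]]]].
exists k, i', j'; split => //; congr (_ `&` _).
Qed.

Lemma dyadic_bounds k i : (i < 2 ^ k)%N ->
  0 <= i%:R / 2 ^+ k :> R /\ i%:R / 2 ^+ k + 2 ^- k <= 1 :> R.
Proof.
move=> ik; have p2 : 0 < 2 ^+ k :> R by rewrite exprn_gt0.
split; first by rewrite divr_ge0 ?ler0n// ltW.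
rewrite -[X in _ + X]mul1r -mulrDl ler_pdivrMr// mul1r.
by rewrite -[X in _ <= X]natrX natr1 ler_nat.
Qed.

(** The index bounds keep the half-open box inside ]0, 1] x ]0, 1], so cutting with Q removes only
    boundary points. *)
Lemma interior_dyadic_box k i j : (i < 2 ^ k)%N -> (j < 2 ^ k)%N ->
  (dyadic_box k i j)° = open_rectangle (i%:R / 2 ^+ k) (i%:R / 2 ^+ k + 2 ^- k)
                                       (j%:R / 2 ^+ k) (j%:R / 2 ^+ k + 2 ^- k).
Proof.
move=> /dyadic_bounds[a0 b1] /dyadic_bounds[c0 d1]; rewrite /dyadic_box.
set a := i%:R / _ in a0 b1 *; set c := j%:R / _ in c0 d1 *; set l := 2 ^- k in b1 d1 *.
have int (s : R) : `]s, s + l]° = `]s, s + l[%classic by rewrite interior_itv_bnd.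
apply/seteqP; split => -[x y] /=.
- move=> nL; split => /=.
    have : \forall t \near x, `]a, a + l]%classic t.
      have h : continuous (fun t : R => (t, y)).
        by apply: (@continuous_pair R R id (cst y)) => z; [exact: cvg_id|exact: cvg_cst].
      apply: (@filterS _ (nbhs x) _ (fun t => dyadic_box k i j (t, y))); last exact: h _ _ nL.
      by move=> t [[]].
    by rewrite -[X in X -> _]/(`]a, a + l]° x) int.
  have : \forall t \near y, `]c, c + l]%classic t.
    have h : continuous (fun t : R => (x, t)).
      by apply: (@continuous_pair R R (cst x) id) => z; [exact: cvg_cst|exact: cvg_id].
    apply: (@filterS _ (nbhs y) _ (fun t => dyadic_box k i j (x, t))); last exact: h _ _ nL.
    by move=> t [[]].
  by rewrite -[X in X -> _]/(`]c, c + l]° y) int.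
- move=> [xa yc]; exists (`]a, a + l[%classic, `]c, c + l[%classic).
    by split; apply: open_nbhs_nbhs; split => //; exact: interval_open.
  move=> [s t] [/=]; rewrite !in_itv/= => /andP[h1 h2] /andP[h3 h4].
  rewrite h1 h3 !ltW//; split => //.
  by rewrite /Q/=; split; apply/andP; split; lra.
Qed.

Lemma measurable_dyadic_box k i j : measurable (dyadic_box k i j : set (mR * mR)).
Proof.
by apply: measurableI; [exact: measurableX|exact: measurable_Q].
Qed.

Lemma dyadic_box_Q k i j : dyadic_box k i j `<=` Q.
Proof. exact: subIsetr. Qed.

Lemma finite_dyadic_boxes (n : nat) : finite_set [set L | exists k i j,
  [/\ (k < n)%N, (i < 2 ^ k)%N, (j < 2 ^ k)%N & L = dyadic_box k i j]].
Proof.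
pose f (p : nat * nat * nat) := dyadic_box p.1.1 p.1.2 p.2.
apply: (@sub_finite_set _ _ (f @` (`I_n `*` `I_(2 ^ n) `*` `I_(2 ^ n)))).
  move=> L [k [i [j [kn ik jk ->]]]]; exists (k, i, j) => //=.
  have le2 : (2 ^ k <= 2 ^ n)%N by rewrite leq_exp2l// ltnW.
  by split; [split => //=|]; apply: leq_trans le2.
by apply: finite_image; apply: finite_setX => //; apply: finite_setX.
Qed.

Lemma dyadic_square_Q : dyadic_square (Q : set (R * R)).
Proof.
exists 0%N, 0, 0 => /=; rewrite expr0 mul0r invr1 add0r lexx ltr01; split => //.
apply/seteqP; split => [[x y]|[x y] []//] [/= /andP[x0 x1] /andP[y0 y1]].
by rewrite /Q/= x0 y0 x1 y1 !ltW.
Qed.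

Lemma dyadic_partition_Q : dyadic_partition [set (Q : set (R * R))].
Proof.
split; first exact: finite_set1.
  by move=> _ ->; exact: dyadic_square_Q.
split; first by rewrite /cover bigcup_set1.
  by move=> L L' /= -> ->.
move=> _ -> /=; exists (2^-1, 2^-1); rewrite /Q/=; split; lra.
Qed.

End DyadicBox.

Section SmallSquares.
Context {R : realType}.
Local Notation mR := (measurableTypeR R).

Lemma L2_subset (S S' : set (R * R)) (f : R * R -> R) :
  measurable (S : set (mR * mR)) -> measurable (S' : set (mR * mR)) -> S `<=` S' ->
  L2 leb2 (S' : set (mR * mR)) f -> L2 leb2 (S : set (mR * mR)) f.
Proof.
move=> mS mS' SS' [mf If]; split; first exact: measurable_funS mf.
exact: integrableS If.
Qed.

(** Absolute continuity of the integral sees only the measure of a square, so one n serves all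
    positions. *)
Lemma small_squares (f : R * R -> R) (e : R) : L2 leb2 (Q : set (mR * mR)) f -> 0 < e ->
  exists n, forall k i j, (n <= k)%N -> (i < 2 ^ k)%N -> (j < 2 ^ k)%N ->
    \int[leb2]_(x in (dyadic_box k i j)°) (f x ^+ 2) <= e.
Proof.
move=> fL e0; pose g (x : mR * mR) : R := f x ^+ 2 * \1_(Q : set (mR * mR)) x.
have Ig : (@leb2 R).-integrable setT (EFin \o g).
  have := (integrable_mkcond (fun x : mR * mR => (f x ^+ 2)%:E) (@measurable_Q R)).1 (L2_sqr fL).
  apply: eq_integrable; [exact: measurableT|move=> x _]; rewrite /= /g /patch indicE.
  by case: ifP; rewrite ?mulr1 ?mulr0.
have [d [d0 hd]] := integral_normr_continuous Ig e0.
have [n hn] : exists n : nat, 2 ^- n < d :> R.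
  have [n hn] := ltr_add_invr d0; exists n; rewrite add0r in hn.
  apply: le_lt_trans hn; rewrite lef_pV2 ?posrE ?exprn_gt0//.
  by rewrite -natrX ler_nat ltn_expl.
exists n => k i j nk ik jk.
have l0 : 0 < 2 ^- k :> R by rewrite invr_gt0 exprn_gt0.
have SQ : (dyadic_box k i j)° `<=` @Q R.
  by apply: subset_trans (@interior_subset _ _) _; exact: dyadic_box_Q.
rewrite interior_dyadic_box// in SQ *; set S := open_rectangle _ _ _ _ in SQ *.
have mS : measurable (S : set (mR * mR)) := measurable_open_rectangle _ _ _ _.
have -> : \int[leb2]_(x in S) (f x ^+ 2) = \int[leb2]_(x in S) `|g x|.
  apply: eq_Rintegral => x; rewrite inE => /SQ Qx.
  by rewrite /g indicE mem_set// mulr1 ger0_norm// sqr_ge0.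
apply/ltW/hd => //.
rewrite leb2_open_rectangle ?ltrDl// !(addrAC _ (2 ^- k)) !subrr !add0r lte_fin.
apply: (@le_lt_trans _ _ (2 ^- n)) => //.
(* The area 4^-k is bounded crudely by the side 2^-k. *)
apply: (@le_trans _ _ (2 ^- k)).
  rewrite ler_piMr ?(ltW l0)// invf_le1 ?exprn_gt0// exprn_ege1//; exact: ler1n.
by rewrite lef_pV2 ?posrE ?exprn_gt0// ler_weXn2l ?ler1n.
Qed.

End SmallSquares.

(** * The parameters of the dyadic squares *)

Section DyadicParameters.
Context {R : realType}.
Local Notation mR := (measurableTypeR R).
Variables (ueta uc : R * R -> R) (c0 : R).
Hypotheses (c01 : 0 < c0 < 1).
Hypotheses (hueta : L2 leb2 (Q : set (mR * mR)) ueta) (huc : L2 leb2 (Q : set (mR * mR)) uc).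
Implicit Types L : set (R * R).

Lemma dyadic_square_interior L : dyadic_square L -> exists p q l : R,
  [/\ 0 < l, L° = open_rectangle p (p + l) q (q + l),
      L2 leb2 (open_rectangle p (p + l) q (q + l) : set (mR * mR)) ueta &
      L2 leb2 (open_rectangle p (p + l) q (q + l) : set (mR * mR)) uc].
Proof.
move=> /dyadic_squareP[k [i [j [ik jk ->]]]].
have SQ : (dyadic_box k i j)° `<=` @Q R.
  by apply: subset_trans (@interior_subset _ _) _; exact: dyadic_box_Q.
rewrite interior_dyadic_box// in SQ *.
do 3 eexists; split; [|reflexivity| |]; first by rewrite invr_gt0 exprn_gt0.
- apply: (L2_subset _ measurable_Q SQ hueta); exact: measurable_open_rectangle.
- apply: (L2_subset _ measurable_Q SQ huc); exact: measurable_open_rectangle.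
Qed.

Lemma dyadic_parameter_exists L : dyadic_square L -> exists a, level3_parameter ueta uc c0 L a.
Proof.
move=> /dyadic_square_interior[p [q [l [l0 LS h1 h2]]]].
exact: level3_parameter_exists l0 c01 h1 h2 _ LS.
Qed.

Lemma dyadic_parameter_unique L a b : dyadic_square L ->
  level3_parameter ueta uc c0 L a -> level3_parameter ueta uc c0 L b -> a = b.
Proof.
move=> /dyadic_square_interior[p [q [l [l0 LS _ h2]]]].
exact: (level3_parameter_unique c01 h2 LS).
Qed.

Lemma finite_nonminimal_parameters : finite_set
  [set L | dyadic_square L /\ exists2 a, level3_parameter ueta uc c0 L a & a <> c0].
Proof.
have c00 : 0 < c0 by case/andP: c01.
have e0 : 0 < (c0 / 10) ^+ 2 by rewrite exprn_gt0// divr_gt0.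
have [n hn] := small_squares hueta e0.
apply: sub_finite_set (finite_dyadic_boxes n).
move=> L [dL [a ha ac]]; have [k [i [j [ik jk LE]]]] := dyadic_squareP dL.
exists k, i, j; split => //; rewrite ltnNge; apply/negP => nk; apply: ac.
have := hn k i j nk ik jk.
have SQ : (dyadic_box k i j)° `<=` @Q R.
  by apply: subset_trans (@interior_subset _ _) _; exact: dyadic_box_Q.
rewrite interior_dyadic_box// in SQ * => bd.
have h1 := L2_subset (measurable_open_rectangle _ _ _ _) measurable_Q SQ hueta.
have h2 := L2_subset (measurable_open_rectangle _ _ _ _) measurable_Q SQ huc.
apply: (level3_parameter_small _ c01 h1 h2 _ bd ha); first by rewrite invr_gt0 exprn_gt0.
by rewrite LE interior_dyadic_box.
Qed.

End DyadicParameters.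

(** * Weights of partitions *)

Section Weights.
Context {R : realType}.
Local Notation mR := (measurableTypeR R).
Implicit Types (Ls : set (set (R * R))) (a : set (R * R) -> R).

Lemma eq_weight Ls a b : (forall L, Ls L -> a L = b L) -> weight Ls a = weight Ls b.
Proof.
by move=> ab; apply/funext => x; apply: eq_fsbigr => L; rewrite inE => /ab ->.
Qed.

Lemma weight_cst Ls (c : R) (x : R * R) : dyadic_partition Ls ->
  weight Ls (fun=> c) x = c * \1_Q x.
Proof.
move=> [Lfin _ [cov triv _]]; rewrite /weight indicE -cov.
have [|nx] := boolP (x \in cover Ls id).
  rewrite inE => -[L LsL Lx]; rewrite (fsbigD1 L)//= indicE mem_set// fsbig1 ?addr0//.
  move=> L' [LsL' LL']; rewrite indicE memNset ?mulr0// => L'x; apply: LL'.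
  by apply: triv => //; exists x.
rewrite mulr0 fsbig1// => L LsL; rewrite indicE memNset ?mulr0// => Lx.
by move: nx; rewrite notin_setE; apply; exists L.
Qed.

(** A constant weight on a partition is that constant on Q, so for a given [a] a weight remembers
    only the part of its partition that lies in B. If B is finite, finitely many weights arise from
    the infinitely many partitions. *)
Lemma weight_split Ls a (B : set (set (R * R))) (c : R) : dyadic_partition Ls ->
  (forall L, Ls L -> ~ B L -> a L = c) ->
  weight Ls a = fun x => c * \1_Q x + weight (Ls `&` B) (fun L => a L - c) x.
Proof.
move=> Lp ac; have [Lfin _ _] := Lp; apply/funext => x.
rewrite -(weight_cst _ _ Lp) /weight.
rewrite (fsbig_widen (Ls `&` B) Ls); [|by move=> L []|].
  by rewrite -fsbig_split//; apply: eq_fsbigr => L _ /=; rewrite mulrBl addrC subrK.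
move=> L [LsL nLB] /=; rewrite ac ?subrr ?mul0r// => BL; exact: nLB.
Qed.

Lemma weight_bounds Ls a (K : R) (x : R * R) : dyadic_partition Ls ->
  (forall L, Ls L -> 0 <= a L <= K) -> 0 <= K -> 0 <= weight Ls a x <= K.
Proof.
move=> Lp aK K0; have [Lfin _ _] := Lp; apply/andP; split.
  rewrite /weight; apply: fsumr_ge0 => // L LsL.
  by rewrite mulr_ge0 ?indicE//; have /andP[] := aK L LsL.
apply: (@le_trans _ _ (weight Ls (fun=> K) x)).
  rewrite /weight !fsbig_finite//= big_seq [leRHS]big_seq; apply: ler_sum => L.
  rewrite in_fset_set// inE => LsL.
  by rewrite ler_wpM2r ?indicE//; have /andP[] := aK L LsL.
by rewrite weight_cst// indicE; case: (_ \in _); rewrite ?mulr1 ?mulr0.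
Qed.

Lemma measurable_weight Ls a : dyadic_partition Ls ->
  measurable_fun (Q : set (mR * mR)) (weight Ls a).
Proof.
move=> [Lfin Ldy _].
have -> : weight Ls a = fun x => \sum_(L <- fset_set Ls) a L * \1_L x.
  by apply/funext => x; rewrite /weight fsbig_finite.
have mL L : L \in fset_set Ls -> measurable (L : set (mR * mR)).
  rewrite in_fset_set// inE => /Ldy/dyadic_squareP[k [i [j [_ _ ->]]]].
  exact: measurable_dyadic_box.
(* Summands outside the partition are replaced by 0: measurability is asked for every index L but
   known for dyadic squares. *)
rewrite (_ : (fun x => _) = (fun x => \sum_(L <- fset_set Ls)
   (if L \in fset_set Ls then a L * \1_L x else 0))); last first.
  by apply/funext => x; rewrite big_seq big_mkcond.
apply: (@measurable_sum _ (mR * mR)%type R Q _ (fset_set Ls)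
  (fun L x => if L \in fset_set Ls then a L * \1_L x else 0)) => L.
have [/mL m|_] := boolP (L \in fset_set Ls); last exact: measurable_cst.
apply: measurable_funM; first exact: measurable_cst.
by apply: measurable_funTS; exact: measurable_indic.
Qed.

End Weights.

(** * Level 1: a minimum over finitely many weights *)

Lemma finite_set_powerset (T : choiceType) (B : set T) :
  finite_set B -> finite_set [set A | A `<=` B].
Proof.
move=> Bf.
apply: (@sub_finite_set _ _ ((fun F : {fset T} => [set` F]) @` [set` fpowerset (fset_set B)])).
  move=> A AB; have Af := sub_finite_set AB Bf.
  exists (fset_set A); last by rewrite fset_setK.
  rewrite /= fpowersetE; apply/fsubsetP => x; rewrite !in_fset_set// !inE; exact: AB.
exact: finite_image.
Qed.

Lemma finite_set_argmin d (T : choiceType) (V : orderType d) (W : set T) (f : T -> V) :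
  finite_set W -> W !=set0 -> exists2 w, W w & forall w', W w' -> (f w <= f w')%O.
Proof.
move=> Wfin [w0 Ww0].
have W0 : w0 \in fset_set W by rewrite in_fset_set// inE.
have [w _ hw] := @Order.TotalTheory.arg_minP _ _ (fset_set W) [` W0]%fset xpredT (f \o val) isT.
exists (val w); first by have := valP w; rewrite in_fset_set// inE.
move=> w' Ww'; have W' : w' \in fset_set W by rewrite in_fset_set// inE.
exact: (hw [` W']%fset).
Qed.

(** Q is itself a square, so the Poincare-Sobolev inequality applies to it. *)
Lemma BV_Q_L2 (R : realType) (v : R * R -> R) : BV Q v ->
  L2 leb2 (Q : set (measurableTypeR R * measurableTypeR R)) v.
Proof. by rewrite Q_open_rectangle => /(BV_L2 ltr01)[c []]. Qed.

Unset Implicit Arguments.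

Theorem theorem1p5 (R : realType) (ueta uc : R * R -> R) (c0 : R)
    (hueta : BV Q ueta) (huc : BV Q uc) (hc0 : 0 < c0 < 1) :
  (forall Ls : set (set (R * R)), dyadic_partition Ls ->
     exists u : R * R -> R, level2_solution ueta uc c0 Ls u) /\
  exists (Lstar : set (set (R * R))) (ustar : R * R -> R),
    [/\ dyadic_partition Lstar,
        level2_solution ueta uc c0 Lstar ustar &
        forall (Ls : set (set (R * R))) (u : R * R -> R),
          dyadic_partition Ls -> level2_solution ueta uc c0 Ls u ->
          (sqdist Q uc ustar <= sqdist Q uc u)%E].
Proof.
have c00 : 0 < c0 by case/andP: hc0.
have Lueta := BV_Q_L2 hueta; have Luc := BV_Q_L2 huc.
(* One parameter per dyadic square, fixed for the whole proof; the value 0 elsewhere is a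
   placeholder. *)
have /choice[alpha halpha] : forall L : set (R * R), exists a : R,
    dyadic_square L -> level3_parameter ueta uc c0 L a.
  move=> L; have [dL|ndL] := pselect (dyadic_square L); last by exists 0.
  by have [a ha] := dyadic_parameter_exists hc0 Lueta Luc dL; exists a.
(* [level2_solution] brings its own parameters [beta]; by uniqueness they define the same weight as
   [alpha]. *)
have alphaE Ls beta : dyadic_partition Ls ->
    (forall L, Ls L -> level3_parameter ueta uc c0 L (beta L)) ->
    weight Ls beta = weight Ls alpha.
  move=> [_ Ldy _] hbeta; apply: eq_weight => L LsL; have dL := Ldy _ LsL.
  exact: (dyadic_parameter_unique hc0 Lueta Luc dL (hbeta L LsL) (halpha L dL)).
have min_exists Ls : dyadic_partition Ls -> exists u, unique_minimizer Q
    (BVw (weight Ls alpha) Q) (fun v => sqdist Q ueta v + TVw (weight Ls alpha) Q v)%E u.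
  move=> Lp; have mw := measurable_weight alpha Lp.
  apply: (@level2_minimizer_exists R ueta (weight Ls alpha) c0^-1) => // x _.
  apply: weight_bounds => //; last by rewrite invr_ge0 ltW.
  move=> L LsL; have [_ Ldy _] := Lp; have [u _ [+ _ _]] := halpha L (Ldy _ LsL).
  by rewrite /= in_itv/= => /andP[/(le_trans (ltW c00))-> ->].
have alpha_solution Ls u : dyadic_partition Ls -> unique_minimizer Q
    (BVw (weight Ls alpha) Q) (fun v => sqdist Q ueta v + TVw (weight Ls alpha) Q v)%E u ->
    level2_solution ueta uc c0 Ls u.
  by move=> [_ Ldy _] hu; exists alpha => // L /Ldy; exact: halpha.
(* Level 2 is solvable on every partition, so the comparison that follows leaves none of them
   out. *)
split; first by move=> Ls Lp; have [u hu] := min_exists Ls Lp; exists u; exact: alpha_solution.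
(* The minimum is sought over weights instead of partitions: level 2 depends on the partition only
   through its weight. *)
pose W := [set weight Ls alpha | Ls in @dyadic_partition R].
pose B : set (set (R * R)) :=
  [set L | dyadic_square L /\ exists2 a, level3_parameter ueta uc c0 L a & a <> c0].
have Wfin : finite_set W.
  (* By [weight_split] every weight is [F T] for some subset T of B, the finite set of squares whose
     parameter differs from c0. *)
  pose F (T : set (set (R * R))) (x : R * R) : R :=
    c0 * \1_Q x + weight T (fun L => alpha L - c0) x.
  apply: (@sub_finite_set _ _ (F @` [set T | T `<=` B])).
    move=> _ [Ls Lp <-]; exists (Ls `&` B) => /=; first exact: subIsetr.
    rewrite (weight_split (B := B) (c := c0) Lp)// => L LsL nBL.
    have [_ Ldy _] := Lp; have dL := Ldy _ LsL.
    apply: contrapT => ac; apply: nBL; split => //; exists (alpha L) => //; exact: halpha.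
  apply/finite_image/finite_set_powerset; exact: finite_nonminimal_parameters.
have W0 : W !=set0.
  by exists (weight [set Q] alpha), [set Q] => //; exact: dyadic_partition_Q.
(* One minimizer is fixed for each weight, so that the cost becomes a function on the finite set
   W. *)
have /choice[u hu] : forall w, exists u : R * R -> R, W w ->
    unique_minimizer Q (BVw w Q) (fun v => sqdist Q ueta v + TVw w Q v)%E u.
  move=> w; have [[Ls Lp <-]|nW] := pselect (W w); last by exists (fun=> 0).
  by have [u hu] := min_exists Ls Lp; exists u.
have [_ [Lstar Lp <-] hmin] := finite_set_argmin (fun w => sqdist Q uc (u w)) Wfin W0.
have WL Ls : dyadic_partition Ls -> W (weight Ls alpha) by exists Ls.
exists Lstar, (u (weight Lstar alpha)); split => //.
  by apply: alpha_solution => //; apply: hu; exact: WL.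
(* Here v is some minimizer for the weight of Ls; it agrees almost everywhere with the chosen one
   and so has the same cost. *)
move=> Ls v Lsp [beta hbeta]; rewrite (alphaE _ _ Lsp hbeta) => -[Av vmin _].
have [Au _ uuni] := hu _ (WL _ Lsp).
have [mu_ _ _] := Au; have [mv _ _] := Av.
apply: le_trans (hmin _ (WL _ Lsp)) _.
rewrite (ae_eq_sqdist (@measurable_Q R) (L2_measurable Luc) mv mu_)//.
exact: uuni.
Qed.
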